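(* Let $c\in\mathbb{C}$ and $\kappa\in\mathbb{C}\setminus\{1,0,-1,-2,\dots\}$. Let $\Omega\subset\mathbb{C}$, let $q\in\mathcal{Q}_0\cap\mathcal{H}_0$, and let $\phi\in\Phi_H[\Omega,q]$. If $f\in\mathcal{A}$ satisfies $$\left\{\phi\left(B_{\kappa+1}^{c}f(z),B_{\kappa}^{c}f(z),B_{\kappa-1}^{c}f(z);z\right):z\in\mathbb{D}\right\}\subset\Omega,$$ then $B_{\kappa+1}^{c}f\prec q$ in $\mathbb{D}$.
   Context: $\mathbb{D}=\{z\in\mathbb{C}:|z|<1\}$. $\mathcal{A}$ is the class of functions $f(z)=z+\sum_{n\geq1}a_{n+1}z^{n+1}$ analytic in $\mathbb{D}$. For $c\in\mathbb{C}$, $\lambda\in\mathbb{C}\setminus\{0,-1,-2,\dots\}$ and $f\in\mathcal{A}$, put $$B_\lambda^c f(z)=z+\sum_{n\geq1}\frac{(-c)^n a_{n+1}}{4^n(\lambda)_n}\frac{z^{n+1}}{n!},\qquad (\lambda)_n=\lambda(\lambda+1)\cdots(\lambda+n-1).$$ For $f,F$ analytic in $\mathbb{D}$, $f\prec F$ means that there is $w$ analytic in $\mathbb{D}$ with $w(0)=0$, $|w(z)|<1$ and $f(z)=F(w(z))$ for all $z\in\mathbb{D}$. $\mathcal{H}_0$ is the class of analytic functions in $\mathbb{D}$ vanishing at $0$. $\mathcal{Q}$ is the class of functions $q$ that are analytic and injective on $\overline{\mathbb{D}}\setminus E(q)$, where $E(q)=\{\zeta\in\partial\mathbb{D}:\lim_{z\to\zeta}q(z)=\infty\}$,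 and such that $q'(\zeta)\neq0$ for $\zeta\in\partial\mathbb{D}\setminus E(q)$; $\mathcal{Q}_0=\{q\in\mathcal{Q}:q(0)=0\}$. For $\Omega\subset\mathbb{C}$ and $q\in\mathcal{Q}_0\cap\mathcal{H}_0$, the class of admissible functions $\Phi_H[\Omega,q]$ consists of all functions $\phi:\mathbb{C}^3\times\mathbb{D}\to\mathbb{C}$ such that $\phi(u,v,w;z)\notin\Omega$ whenever $$u=q(\zeta),\qquad v=\frac{k\zeta q'(\zeta)+(\kappa-1)q(\zeta)}{\kappa},$$ $$\operatorname{Re}\left(\frac{\kappa(\kappa-1)w-(\kappa-2)(\kappa-1)u}{v\kappa-(\kappa-1)u}-(2\kappa-3)\right)\geq k\operatorname{Re}\left(\frac{\zeta q''(\zeta)}{q'(\zeta)}+1\right),$$ with $z\in\mathbb{D}$, $\zeta\in\partial\mathbb{D}\setminus E(q)$ and real $k\geq1$. *)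

(* Defs.v *)
(* Stdlib reals and Coquelicot's complex numbers. *)
From Stdlib Require Import Reals Factorial.
From Coquelicot Require Import Coquelicot.
Open Scope C_scope.

Definition disk (z : C) : Prop := Cmod z < 1.
Definition closed_disk (z : C) : Prop := Cmod z <= 1.
Definition unit_circle (z : C) : Prop := Cmod z = 1%R.

Definition analytic_at (f : C -> C) (z0 : C) : Prop :=
  exists (a : nat -> C) (r : R), 0 < r /\
    forall z : C, Cmod (z - z0) < r ->
      @is_pseries C_AbsRing C_NormedModule a (z - z0) (f z).

(* On a set S that is not open this is analyticity in a neighbourhood (in C)
   of every point of S. *)
Definition analytic_on (S : C -> Prop) (f : C -> C) : Prop :=
  forall z : C, S z -> analytic_at f z.

(* Coquelicot's Series is real-valued; the sum of a complex series is taken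
   componentwise. *)
Definition CSeries (u : nat -> C) : C :=
  (Series (fun n => Re (u n)), Series (fun n => Im (u n))).

Lemma CSeries_unique (u : nat -> C) (l : C) :
  @is_series C_AbsRing C_NormedModule u l -> CSeries u = l.
Proof.
  intros H.
  assert (Hs : forall n, @sum_n C_NormedModule u n
    = (sum_n (fun k => Re (u k)) n, sum_n (fun k => Im (u k)) n)).
  { intros n; induction n as [|n IH].
    - rewrite (@sum_O C_NormedModule u), !sum_O; now destruct (u O).
    - rewrite (@sum_Sn C_NormedModule u), IH, !sum_Sn; reflexivity. }
  unfold CSeries; rewrite (surjective_pairing l); f_equal;
    apply is_series_unique; intros P [e He].
  - assert (HP : @locally C_UniformSpace l (fun z => P (fst z)))
      by (exists e; intros z [Hz _]; now apply He).
    destruct (H _ HP) as [N HN]; exists N; intros n Hn.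
    generalize (HN n Hn); now rewrite Hs.
  - assert (HP : @locally C_UniformSpace l (fun z => P (snd z)))
      by (exists e; intros z [_ Hz]; now apply He).
    destruct (H _ HP) as [N HN]; exists N; intros n Hn.
    generalize (HN n Hn); now rewrite Hs.
Qed.

(* f z = z + sum_{n >= 1} a_{n+1} z^{n+1}, with the sum reindexed from 0. *)
Definition class_A (f : C -> C) : Prop :=
  analytic_on disk f /\
  exists a : nat -> C, forall z : C, disk z ->
    @is_series C_AbsRing C_NormedModule
      (fun n => a (n + 2)%nat * z ^ (n + 2)) (f z - z).

(* The coefficient of z^n in the expansion of f at 0. *)
Definition taylor_coef (f : C -> C) (n : nat) : C :=
  Nat.iter n C_derive f 0 / INR (fact n).

Fixpoint poch (lambda : C) (n : nat) : C :=
  match n with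
  | O => 1
  | S m => poch lambda m * (lambda + INR m)
  end.

(* The n-th term below is the (n+1)-st term of the sum over n >= 1. *)
Definition Bop (lambda c : C) (f : C -> C) (z : C) : C :=
  z + CSeries (fun m => let n := S m in
        (- c) ^ n * taylor_coef f (n + 1) / (4 ^ n * poch lambda n)
        * (z ^ (n + 1) / INR (fact n))).

Definition subordinate (f F : C -> C) : Prop :=
  exists w : C -> C,
    analytic_on disk w /\ w 0 = 0 /\
    (forall z : C, disk z -> Cmod (w z) < 1) /\
    (forall z : C, disk z -> f z = F (w z)).

Definition class_H0 (q : C -> C) : Prop := analytic_on disk q /\ q 0 = 0.

(* E(q); the limit is taken along the open disk. *)
Definition exceptional (q : C -> C) (zeta : C) : Prop :=
  unit_circle zeta /\
  filterlim (fun z => Cmod (q z)) (within disk (locally zeta))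
    (Rbar_locally p_infty).

(* The values of q outside the closed disk minus E(q) matter only through the
   analyticity at boundary points, where q stands for its analytic continuation
   to a neighbourhood; this is also what makes q' and q'' meaningful there. *)
Definition class_Q (q : C -> C) : Prop :=
  let S := fun z => closed_disk z /\ ~ exceptional q z in
  analytic_on S q /\
  (forall z1 z2 : C, S z1 -> S z2 -> q z1 = q z2 -> z1 = z2) /\
  (forall zeta : C, unit_circle zeta -> ~ exceptional q zeta ->
     C_derive q zeta <> 0).

Definition class_Q0 (q : C -> C) : Prop := class_Q q /\ q 0 = 0.

(* The last argument z of phi is only used in the open disk. *)
Definition admissible (kappa : C) (Omega : C -> Prop) (q : C -> C)
    (phi : C -> C -> C -> C -> C) : Prop :=
  forall (u v w z zeta : C) (k : R),
    disk z -> unit_circle zeta -> ~ exceptional q zeta -> 1 <= k ->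
    u = q zeta ->
    v = (k * zeta * C_derive q zeta + (kappa - 1) * q zeta) / kappa ->
    (Re ((kappa * (kappa - 1) * w - (kappa - 2) * (kappa - 1) * u)
           / (v * kappa - (kappa - 1) * u) - (2 * kappa - 3))
     >= k * Re (zeta * C_derive (C_derive q) zeta / C_derive q zeta + 1))%R ->
    ~ Omega (phi u v w z).

(* Main.v *)
(* Put p = B_{kappa+1} f.  The recurrence z (B_{l+1} f)' = l B_l f - (l - 1) B_{l+1} f
   turns the three arguments of phi into combinations of p, z p' and z^2 p'', for which
   admissibility is exactly the conclusion of the Miller-Mocanu boundary lemma.  If p(D)
   is not contained in q(D), let z0 be a first point with p(z0) outside q(D).  The lift
   w = q^{-1} o p is holomorphic in |z| < |z0|, and continues across z0 by the local
   inverse of q at a boundary point zeta = w(z0), |zeta| = 1.  Schwarz' lemma and the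
   maximality of |w| at z0 on |z| <= |z0| give z0 w'(z0) = k zeta with k >= 1 and
   Re (1 + z0 w''/w') >= k, hence, since p = q o w, a point at which admissibility of phi
   contradicts the hypothesis.  So p(D) lies in q(D), and w = q^{-1} o p is the
   subordinating map. *)

Require Import Defs.
From Stdlib Require Import Reals Ranalysis5 Factorial Lra Lia Wf_nat.
From Stdlib Require Import Classical ClassicalEpsilon.
From Coquelicot Require Import Coquelicot.
Open Scope R_scope.

(** The lift [w] is obtained as a merely differentiable map, whereas the conclusion asks for its
    analyticity and the boundary lemma for its second-order Taylor expansion at [z0]. A Cauchy
    expansion is therefore indispensable, and it is derived here without integrals: strict
    derivatives make secant estimates uniform on compact balls, and averages over the vertices of
    regular polygons take the place of contour integrals.

    Two points at the boundary are delicate. On the way to [z0] only a cluster value [zeta] of [w]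
    is available, not a limit, so the branch of the inverse of [q] at [zeta] must still be shown to
    coincide with [w] on the side [|z| < |z0|]. Moreover the comparison [|w z| <= |z| / |z0|] is
    known on that side only, so second-order information cannot come from maximising along the
    circle itself; it is extracted from points inside that approach it tangentially. *)

(** * Elementary estimates for the modulus *)

Lemma Cmod_minus_sym (x y : C) : Cmod (x - y) = Cmod (y - x).
Proof. replace (x - y)%C with (- (y - x))%C by ring. apply Cmod_opp. Qed.

Lemma Cmod_minus_triangle (x y z : C) : Cmod (x - z) <= Cmod (x - y) + Cmod (y - z).
Proof. replace (x - z)%C with ((x - y) + (y - z))%C by ring. apply Cmod_triangle. Qed.

Lemma Cmod_le_minus (x y : C) : Cmod x <= Cmod (x - y) + Cmod y.
Proof. replace x with ((x - y) + y)%C at 1 by ring. apply Cmod_triangle. Qed.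

Lemma Cmod_minus_le (x y : C) : Cmod (x - y) <= Cmod x + Cmod y.
Proof. rewrite <- (Cmod_opp y). apply Cmod_triangle. Qed.

Lemma Cmod_minus_diag (x : C) : Cmod (x - x) = 0.
Proof. replace (x - x)%C with (RtoC 0) by ring. apply Cmod_0. Qed.

Lemma Cminus_eq_0 (x y : C) : (x - y)%C = 0%C -> x = y.
Proof. intros H. replace x with ((x - y) + y)%C by ring. rewrite H. ring. Qed.

Lemma Ceq_of_Cmod_lt (x y : C) : (forall e, 0 < e -> Cmod (x - y) < e) -> x = y.
Proof.
  intros H. apply Cminus_eq_0, Cmod_eq_0.
  destruct (Rle_lt_or_eq_dec 0 (Cmod (x - y)) (Cmod_ge_0 _)) as [h|h]; [|easy].
  specialize (H _ h). lra.
Qed.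

Lemma Rle_of_le_mult_eps (x y K : R) :
  0 <= K -> (forall e, 0 < e -> x <= y + K * e) -> x <= y.
Proof.
  intros HK H. apply Rnot_lt_le; intros h.
  assert (He : 0 < (x - y) / (2 * (K + 1))) by (apply Rdiv_lt_0_compat; lra).
  specialize (H _ He).
  assert (K * ((x - y) / (2 * (K + 1))) <= (x - y) / 2).
  { replace ((x - y) / 2) with ((K + 1) * ((x - y) / (2 * (K + 1)))) by (field; lra).
    apply Rmult_le_compat_r; lra. }
  lra.
Qed.

Lemma Rmin_pos_lt (a b : R) : 0 < a -> 0 < b ->
  0 < Rmin a b /\ Rmin a b <= a /\ Rmin a b <= b.
Proof.
  intros; repeat split; [now apply Rmin_pos | apply Rmin_l | apply Rmin_r].
Qed.

(** * Strict complex derivatives *)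

(** Stated with [Cmod] instead of the componentwise balls of [C_UniformSpace], so that it feeds
    directly into modulus estimates. *)
Definition continuous_C (f : C -> C) (z : C) : Prop :=
  forall e, 0 < e -> exists d, 0 < d /\
    forall x, Cmod (x - z) < d -> Cmod (f x - f z) < e.

(* Strict differentiability at every point of an open set amounts to
   C^1-holomorphy there, and it needs neither a mean value inequality nor a
   separate continuity hypothesis on the derivative. *)
Definition strict_derive (f : C -> C) (z l : C) : Prop :=
  forall e, 0 < e -> exists d, 0 < d /\
    forall x y, Cmod (x - z) < d -> Cmod (y - z) < d ->
      Cmod (f x - f y - l * (x - y)) <= e * Cmod (x - y).

(** The free constant [K] lets the rules below add up their errors without rescaling [e] in advance;
    [e <= 1] keeps the factors of a product bounded. *)
Lemma strict_derive_intro (f : C -> C) (z l : C) (K : R) :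
  0 <= K ->
  (forall e, 0 < e <= 1 -> exists d, 0 < d /\
    forall x y, Cmod (x - z) < d -> Cmod (y - z) < d ->
      Cmod (f x - f y - l * (x - y)) <= K * e * Cmod (x - y)) ->
  strict_derive f z l.
Proof.
  intros HK H e He.
  assert (He' : 0 < e / (K + 1)) by (apply Rdiv_lt_0_compat; lra).
  destruct (Rmin_pos_lt 1 (e / (K + 1)) Rlt_0_1 He') as [h1 [h2 h3]].
  destruct (H (Rmin 1 (e / (K + 1))) (conj h1 h2)) as [d [Hd Hf]].
  exists d; split; [easy|]. intros x y Hx Hy.
  eapply Rle_trans; [now apply Hf|].
  apply Rmult_le_compat_r; [apply Cmod_ge_0|].
  apply Rle_trans with ((K + 1) * (e / (K + 1))).
  - apply Rmult_le_compat; lra.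
  - right; field; lra.
Qed.

Lemma strict_derive_lipschitz (f : C -> C) (z l : C) :
  strict_derive f z l -> exists d, 0 < d /\
    forall x y, Cmod (x - z) < d -> Cmod (y - z) < d ->
      Cmod (f x - f y) <= (Cmod l + 1) * Cmod (x - y).
Proof.
  intros H. destruct (H 1 Rlt_0_1) as [d [Hd Hf]].
  exists d; split; [easy|]. intros x y Hx Hy.
  eapply Rle_trans; [apply (Cmod_le_minus _ (l * (x - y))%C)|].
  rewrite Cmod_mult. specialize (Hf x y Hx Hy). lra.
Qed.

Lemma strict_derive_continuous (f : C -> C) (z l : C) :
  strict_derive f z l -> continuous_C f z.
Proof.
  intros H e He. destruct (strict_derive_lipschitz f z l H) as [d [Hd Hf]].
  pose proof (Cmod_ge_0 l).
  assert (He' : 0 < e / (Cmod l + 1)) by (apply Rdiv_lt_0_compat; lra).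
  destruct (Rmin_pos_lt d _ Hd He') as [h1 [h2 h3]].
  exists (Rmin d (e / (Cmod l + 1))); split; [easy|].
  intros x Hx. eapply Rle_lt_trans; [apply Hf|].
  - lra.
  - rewrite Cmod_minus_diag; lra.
  - apply Rlt_le_trans with ((Cmod l + 1) * (e / (Cmod l + 1))).
    + apply Rmult_lt_compat_l; lra.
    + right; field; lra.
Qed.

Lemma strict_derive_ext_loc (f g : C -> C) (z l : C) (r : R) :
  0 < r -> (forall x, Cmod (x - z) < r -> f x = g x) ->
  strict_derive f z l -> strict_derive g z l.
Proof.
  intros Hr E H e He. destruct (H e He) as [d [Hd Hf]].
  destruct (Rmin_pos_lt d r Hd Hr) as [h1 [h2 h3]].
  exists (Rmin d r); split; [easy|]. intros x y Hx Hy.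
  rewrite <- !E by lra. apply Hf; lra.
Qed.

Lemma strict_derive_const (c z : C) : strict_derive (fun _ => c) z 0.
Proof.
  intros e He; exists 1; split; [lra|]; intros x y _ _.
  replace (c - c - 0 * (x - y))%C with (RtoC 0) by ring.
  rewrite Cmod_0. pose proof (Cmod_ge_0 (x - y)). nra.
Qed.

Lemma strict_derive_id (z : C) : strict_derive (fun x => x) z 1.
Proof.
  intros e He; exists 1; split; [lra|]; intros x y _ _.
  replace (x - y - 1 * (x - y))%C with (RtoC 0) by ring.
  rewrite Cmod_0. pose proof (Cmod_ge_0 (x - y)). nra.
Qed.

Lemma strict_derive_plus (f g : C -> C) (z l m : C) :
  strict_derive f z l -> strict_derive g z m ->
  strict_derive (fun x => f x + g x)%C z (l + m).
Proof.
  intros Hf Hg. apply strict_derive_intro with 2; [lra|]. intros e [He _].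
  destruct (Hf e He) as [d1 [Hd1 H1]]. destruct (Hg e He) as [d2 [Hd2 H2]].
  destruct (Rmin_pos_lt d1 d2 Hd1 Hd2) as [h1 [h2 h3]].
  exists (Rmin d1 d2); split; [easy|]. intros x y Hx Hy.
  replace (f x + g x - (f y + g y) - (l + m) * (x - y))%C with
    ((f x - f y - l * (x - y)) + (g x - g y - m * (x - y)))%C by ring.
  eapply Rle_trans; [apply Cmod_triangle|].
  specialize (H1 x y ltac:(lra) ltac:(lra)).
  specialize (H2 x y ltac:(lra) ltac:(lra)). lra.
Qed.

Lemma strict_derive_comp (f g : C -> C) (z l m : C) :
  strict_derive f z l -> strict_derive g (f z) m ->
  strict_derive (fun x => g (f x)) z (m * l).
Proof.
  intros Hf Hg. pose proof (Cmod_ge_0 l). pose proof (Cmod_ge_0 m).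
  apply strict_derive_intro with (Cmod l + 1 + Cmod m); [lra|]. intros e [He _].
  destruct (strict_derive_lipschitz f z l Hf) as [d0 [Hd0 H0']].
  destruct (Hf e He) as [d1 [Hd1 H1]]. destruct (Hg e He) as [d2 [Hd2 H2]].
  destruct (strict_derive_continuous f z l Hf d2 Hd2) as [d3 [Hd3 H3]].
  destruct (Rmin_pos_lt d0 d1 Hd0 Hd1) as [h1 [h2 h3]].
  destruct (Rmin_pos_lt _ d3 h1 Hd3) as [h4 [h5 h6]].
  exists (Rmin (Rmin d0 d1) d3); split; [easy|]. intros x y Hx Hy.
  replace (g (f x) - g (f y) - m * l * (x - y))%C with
    ((g (f x) - g (f y) - m * (f x - f y)) + m * (f x - f y - l * (x - y)))%C by ring.
  eapply Rle_trans; [apply Cmod_triangle|]. rewrite Cmod_mult.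
  specialize (H1 x y ltac:(lra) ltac:(lra)).
  specialize (H0' x y ltac:(lra) ltac:(lra)).
  specialize (H2 (f x) (f y) (H3 x ltac:(lra)) (H3 y ltac:(lra))).
  pose proof (Cmod_ge_0 (x - y)). pose proof (Cmod_ge_0 (f x - f y)).
  apply (Rmult_le_compat_l e) in H0'; [|lra].
  apply (Rmult_le_compat_l (Cmod m)) in H1; [|lra].
  lra.
Qed.

Lemma strict_derive_mult (f g : C -> C) (z l m : C) :
  strict_derive f z l -> strict_derive g z m ->
  strict_derive (fun x => f x * g x)%C z (l * g z + f z * m).
Proof.
  intros Hf Hg.
  pose proof (Cmod_ge_0 l) as Pl. pose proof (Cmod_ge_0 m) as Pm.
  pose proof (Cmod_ge_0 (f z)) as Pf. pose proof (Cmod_ge_0 (g z)) as Pg.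
  apply strict_derive_intro with ((Cmod (g z) + 1) + Cmod l + (Cmod (f z) + 1) + Cmod m);
    [lra|]. intros e [He He1].
  destruct (Hf e He) as [d1 [Hd1 H1]]. destruct (Hg e He) as [d2 [Hd2 H2]].
  destruct (strict_derive_continuous f z l Hf e He) as [d3 [Hd3 H3]].
  destruct (strict_derive_continuous g z m Hg e He) as [d4 [Hd4 H4]].
  destruct (Rmin_pos_lt d1 d2 Hd1 Hd2) as [h1 [h2 h3]].
  destruct (Rmin_pos_lt d3 d4 Hd3 Hd4) as [h4 [h5 h6]].
  destruct (Rmin_pos_lt _ _ h1 h4) as [h7 [h8 h9]].
  exists (Rmin (Rmin d1 d2) (Rmin d3 d4)); split; [easy|]. intros x y Hx Hy.
  replace (f x * g x - f y * g y - (l * g z + f z * m) * (x - y))%C with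
    ((f x - f y - l * (x - y)) * g x + l * (g x - g z) * (x - y)
     + (f y * (g x - g y - m * (x - y)) + m * (f y - f z) * (x - y)))%C by ring.
  eapply Rle_trans; [apply Cmod_triangle|].
  eapply Rle_trans; [apply Rplus_le_compat; apply Cmod_triangle|]. rewrite !Cmod_mult.
  specialize (H1 x y ltac:(lra) ltac:(lra)). specialize (H2 x y ltac:(lra) ltac:(lra)).
  pose proof (H3 y ltac:(lra)) as H3y. pose proof (H4 x ltac:(lra)) as H4x.
  pose proof (Cmod_le_minus (f y) (f z)). pose proof (Cmod_le_minus (g x) (g z)).
  set (D := Cmod (x - y)) in *. assert (0 <= D) by apply Cmod_ge_0.
  assert (Cmod (f x - f y - l * (x - y)) * Cmod (g x) <= e * D * (Cmod (g z) + 1)).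
  { apply Rmult_le_compat; try apply Cmod_ge_0; lra. }
  assert (Cmod (f y) * Cmod (g x - g y - m * (x - y)) <= (Cmod (f z) + 1) * (e * D)).
  { apply Rmult_le_compat; try apply Cmod_ge_0; lra. }
  assert (Cmod l * Cmod (g x - g z) * D <= Cmod l * e * D).
  { apply Rmult_le_compat_r; [lra|]. apply Rmult_le_compat_l; lra. }
  assert (Cmod m * Cmod (f y - f z) * D <= Cmod m * e * D).
  { apply Rmult_le_compat_r; [lra|]. apply Rmult_le_compat_l; lra. }
  lra.
Qed.

Lemma strict_derive_pow (f : C -> C) (z l : C) (n : nat) :
  strict_derive f z l ->
  strict_derive (fun x => f x ^ n)%C z (INR n * f z ^ (n - 1) * l).
Proof.
  intros Hf; induction n as [|n IH].
  - simpl Cpow. replace (INR 0 * _ * l)%C with (RtoC 0) by (simpl; ring).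
    apply strict_derive_const.
  - replace (INR (S n) * f z ^ (S n - 1) * l)%C
      with (l * f z ^ n + f z * (INR n * f z ^ (n - 1) * l))%C.
    { now apply (strict_derive_mult f (fun x => (f x ^ n)%C)). }
    replace (S n - 1)%nat with n by lia. rewrite S_INR, RtoC_plus.
    destruct n as [|n]; [simpl; ring|].
    replace (S n - 1)%nat with n by lia. simpl Cpow. ring.
Qed.

Lemma strict_derive_unique (f : C -> C) (z l m : C) :
  strict_derive f z l -> strict_derive f z m -> l = m.
Proof.
  intros Hl Hm. apply Cminus_eq_0, Cmod_eq_0. apply Rle_antisym; [|apply Cmod_ge_0].
  apply Rle_of_le_mult_eps with 2; [lra|]. intros e He.
  destruct (Hl e He) as [d1 [Hd1 H1]]. destruct (Hm e He) as [d2 [Hd2 H2]].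
  destruct (Rmin_pos_lt d1 d2 Hd1 Hd2) as [h1 [h2 h3]].
  set (d := Rmin d1 d2) in *.
  set (x := (z + RtoC (d / 2))%C).
  assert (Hx : Cmod (x - z) = d / 2).
  { unfold x. replace (z + RtoC (d / 2) - z)%C with (RtoC (d / 2)) by ring.
    rewrite Cmod_R. apply Rabs_pos_eq. lra. }
  assert (Hz : Cmod (z - z) = 0) by apply Cmod_minus_diag.
  specialize (H1 x z ltac:(lra) ltac:(lra)). specialize (H2 x z ltac:(lra) ltac:(lra)).
  assert (H : Cmod ((l - m) * (x - z)) <= 2 * e * Cmod (x - z)).
  { replace ((l - m) * (x - z))%C with
      ((f x - f z - m * (x - z)) - (f x - f z - l * (x - z)))%C by ring.
    eapply Rle_trans; [apply Cmod_minus_le|]. lra. }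
  rewrite Cmod_mult, Hx in H.
  apply Rmult_le_reg_r with (d / 2); lra.
Qed.

Lemma Lim_C_of_eps (f : R -> C) (x : R) (l : C) :
  (forall e, 0 < e -> exists d, 0 < d /\
     forall y, y <> x -> Rabs (y - x) < d -> Cmod (f y - l) < e) ->
  Lim (fun y => fst (f y)) x = fst l /\ Lim (fun y => snd (f y)) x = snd l.
Proof.
  intros H; split; apply is_lim_unique; apply is_lim_spec; intros e;
    destruct (H e (cond_pos e)) as [d [Hd Hf]]; exists (mkposreal d Hd); intros y Hy Hne;
    (eapply Rle_lt_trans; [|apply (Hf y Hne Hy)]);
    (eapply Rle_trans; [|apply Rmax_Cmod]); simpl.
  - apply Rmax_l.
  - apply Rmax_r.
Qed.

(** [C_derive] unfolds to real limits along the horizontal line through [z]; strict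
    differentiability controls every direction, hence this one. *)
Lemma C_derive_of_strict (f : C -> C) (z l : C) :
  strict_derive f z l -> C_derive f z = l.
Proof.
  intros H. unfold C_derive, C_lim. rewrite (surjective_pairing l).
  set (g := fun x : R => ((f (x, snd z) - f z) / ((x, snd z) - z))%C).
  destruct (Lim_C_of_eps g (fst z) l) as [H1 H2].
  - intros e He. destruct (H (e / 2) ltac:(lra)) as [d [Hd Hf]].
    exists d; split; [easy|]. intros y Hne Hy.
    assert (E : ((y, snd z) - z)%C = RtoC (y - fst z)).
    { destruct z as [a b]; simpl. unfold Cminus, Cplus, Copp, RtoC; simpl. f_equal; ring. }
    assert (N : RtoC (y - fst z) <> 0%C).
    { intros K; apply RtoC_inj in K; lra. }
    assert (P : 0 < Rabs (y - fst z)) by (apply Rabs_pos_lt; lra).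
    specialize (Hf (y, snd z) z). rewrite E, Cmod_minus_diag, Cmod_R in Hf.
    specialize (Hf Hy Hd). unfold g. rewrite E.
    replace ((f (y, snd z) - f z) / RtoC (y - fst z) - l)%C with
      ((f (y, snd z) - f z - l * RtoC (y - fst z)) / RtoC (y - fst z))%C
      by (field; exact N).
    rewrite Cmod_div by exact N. rewrite Cmod_R.
    apply Rmult_lt_reg_r with (Rabs (y - fst z)); [easy|].
    unfold Rdiv. rewrite Rmult_assoc, Rinv_l by lra. nra.
  - f_equal; [apply (f_equal real H1) | apply (f_equal real H2)].
Qed.

(** The slope of one short secant at [x] is within [e / 2] of [f' z] by strictness at [z], and as
    close as desired to [f' x] by strictness at [x]. *)
Lemma strict_derive_derivative_near (f f' : C -> C) (z : C) (r : R) :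
  0 < r -> (forall x, Cmod (x - z) < r -> strict_derive f x (f' x)) ->
  continuous_C f' z.
Proof.
  intros Hr H e He.
  destruct (H z) with (e / 2) as [d [Hd Hf]]; [rewrite Cmod_minus_diag; lra|lra|].
  destruct (Rmin_pos_lt d r Hd Hr) as [h1 [h2 h3]].
  exists (Rmin d r); split; [easy|]. intros x Hx.
  apply Rle_lt_trans with (e / 2); [|lra].
  apply Rle_of_le_mult_eps with 1; [lra|]. intros e' He'.
  destruct (H x ltac:(lra) e' He') as [d' [Hd' Hf']].
  pose (s := Rmin d' (d - Cmod (x - z))).
  destruct (Rmin_pos_lt d' (d - Cmod (x - z)) Hd' ltac:(lra)) as [k1 [k2 k3]]. fold s in k1, k2, k3.
  set (y := (x + RtoC (s / 2))%C).
  assert (Hy : Cmod (y - x) = s / 2).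
  { unfold y. replace (x + RtoC (s / 2) - x)%C with (RtoC (s / 2)) by ring.
    rewrite Cmod_R. apply Rabs_pos_eq. lra. }
  pose proof (Cmod_minus_triangle y x z).
  specialize (Hf y x ltac:(lra) ltac:(lra)).
  specialize (Hf' y x ltac:(lra) ltac:(rewrite Cmod_minus_diag; lra)).
  assert (K : Cmod ((f' x - f' z) * (y - x)) <= (e / 2 + 1 * e') * Cmod (y - x)).
  { replace ((f' x - f' z) * (y - x))%C with
      ((f y - f x - f' z * (y - x)) - (f y - f x - f' x * (y - x)))%C by ring.
    eapply Rle_trans; [apply Cmod_minus_le|]. lra. }
  rewrite Cmod_mult, Hy in K. apply Rmult_le_reg_r with (s / 2); lra.
Qed.

(** * Power series *)

(** Sums over the indices below [n]: the empty sum is included, and [csum u (S n)] is Coquelicot's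
    [sum_n u n]. *)
Fixpoint csum (u : nat -> C) (n : nat) : C :=
  match n with O => 0%C | S m => (csum u m + u m)%C end.

Definition sums (u : nat -> C) (l : C) : Prop :=
  forall e, 0 < e -> exists N, forall n, (N <= n)%nat -> Cmod (csum u n - l) < e.

Lemma csum_ext (u v : nat -> C) (n : nat) :
  (forall k, (k < n)%nat -> u k = v k) -> csum u n = csum v n.
Proof.
  induction n as [|n IH]; intros H; [easy|]. simpl. rewrite IH, H; auto.
Qed.

Lemma csum_plus (u v : nat -> C) (n : nat) :
  csum (fun k => u k + v k)%C n = (csum u n + csum v n)%C.
Proof. induction n as [|n IH]; simpl; [ring|]. rewrite IH. ring. Qed.

Lemma csum_scal (c : C) (u : nat -> C) (n : nat) :
  csum (fun k => c * u k)%C n = (c * csum u n)%C.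
Proof. induction n as [|n IH]; simpl; [ring|]. rewrite IH. ring. Qed.

Lemma csum_minus (u v : nat -> C) (n : nat) :
  csum (fun k => u k - v k)%C n = (csum u n - csum v n)%C.
Proof. induction n as [|n IH]; simpl; [ring|]. rewrite IH. ring. Qed.

Lemma csum_const (c : C) (n : nat) : csum (fun _ => c) n = (INR n * c)%C.
Proof.
  induction n as [|n IH]; [simpl; ring|].
  rewrite S_INR, RtoC_plus. simpl csum. rewrite IH. ring.
Qed.

Lemma csum_S_l (u : nat -> C) (n : nat) :
  csum u (S n) = (u O + csum (fun k => u (S k)) n)%C.
Proof. induction n as [|n IH]; [simpl; ring|]. simpl in *. rewrite IH. ring. Qed.

Lemma csum_swap (u : nat -> nat -> C) (n m : nat) :
  csum (fun i => csum (u i) m) n = csum (fun j => csum (fun i => u i j) n) m.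
Proof.
  induction n as [|n IH]; simpl.
  - induction m as [|m IHm]; [easy|]. simpl. rewrite <- IHm. ring.
  - rewrite IH, <- csum_plus. easy.
Qed.

Lemma csum_telescope (u : nat -> C) (n : nat) :
  csum (fun k => u (S k) - u k)%C n = (u n - u O)%C.
Proof. induction n as [|n IH]; simpl; [ring|]. rewrite IH. ring. Qed.

Lemma csum_geom (x : C) (n : nat) : ((1 - x) * csum (fun k => x ^ k) n = 1 - x ^ n)%C.
Proof.
  induction n as [|n IH]; simpl; [ring|]. rewrite Cmult_plus_distr_l, IH. ring.
Qed.

Lemma Cmod_csum_le (u : nat -> C) (M : R) (n : nat) :
  (forall k, (k < n)%nat -> Cmod (u k) <= M) -> Cmod (csum u n) <= INR n * M.
Proof.
  induction n as [|n IH]; intros H; [simpl; rewrite Cmod_0; lra|].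
  rewrite S_INR. simpl csum. eapply Rle_trans; [apply Cmod_triangle|].
  specialize (IH (fun k hk => H k (Nat.lt_lt_succ_r _ _ hk))).
  specialize (H n (Nat.lt_succ_diag_r n)). lra.
Qed.

Lemma sums_unique (u : nat -> C) (l m : C) : sums u l -> sums u m -> l = m.
Proof.
  intros Hl Hm. apply Ceq_of_Cmod_lt; intros e He.
  destruct (Hl (e / 2) ltac:(lra)) as [N HN]. destruct (Hm (e / 2) ltac:(lra)) as [N' HN'].
  specialize (HN (N + N')%nat ltac:(lia)). specialize (HN' (N + N')%nat ltac:(lia)).
  pose proof (Cmod_minus_triangle l (csum u (N + N')) m).
  rewrite (Cmod_minus_sym l (csum u (N + N'))) in H. lra.
Qed.

Lemma sums_ext (u v : nat -> C) (l : C) : (forall n, u n = v n) -> sums u l -> sums v l.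
Proof.
  intros E H e He. destruct (H e He) as [N HN]. exists N. intros n Hn.
  rewrite <- (csum_ext u v) by auto. auto.
Qed.

Lemma sums_plus (u v : nat -> C) (l m : C) :
  sums u l -> sums v m -> sums (fun n => u n + v n)%C (l + m).
Proof.
  intros Hl Hm e He.
  destruct (Hl (e / 2) ltac:(lra)) as [N HN]. destruct (Hm (e / 2) ltac:(lra)) as [N' HN'].
  exists (N + N')%nat. intros n Hn. rewrite csum_plus.
  specialize (HN n ltac:(lia)). specialize (HN' n ltac:(lia)).
  replace (csum u n + csum v n - (l + m))%C with
    ((csum u n - l) + (csum v n - m))%C by ring.
  eapply Rle_lt_trans; [apply Cmod_triangle|]. lra.
Qed.

Lemma sums_scal (c : C) (u : nat -> C) (l : C) :
  sums u l -> sums (fun n => c * u n)%C (c * l).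
Proof.
  intros H e He. pose proof (Cmod_ge_0 c).
  assert (He' : 0 < e / (Cmod c + 1)) by (apply Rdiv_lt_0_compat; lra).
  destruct (H _ He') as [N HN]. exists N. intros n Hn. rewrite csum_scal.
  replace (c * csum u n - c * l)%C with (c * (csum u n - l))%C by ring.
  rewrite Cmod_mult. specialize (HN n Hn). pose proof (Cmod_ge_0 (csum u n - l)).
  apply Rle_lt_trans with ((Cmod c) * (e / (Cmod c + 1))).
  - apply Rmult_le_compat_l; lra.
  - apply Rlt_le_trans with ((Cmod c + 1) * (e / (Cmod c + 1))).
    + apply Rmult_lt_compat_r; lra.
    + right; field; lra.
Qed.

Lemma sums_minus (u v : nat -> C) (l m : C) :
  sums u l -> sums v m -> sums (fun n => u n - v n)%C (l - m).
Proof.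
  intros Hl Hm. replace (l - m)%C with (l + (-1) * m)%C by ring.
  apply sums_ext with (fun n => u n + (-1) * v n)%C; [intros; ring|].
  apply sums_plus; [easy|]. now apply sums_scal.
Qed.

Lemma sums_S (u : nat -> C) (l : C) :
  sums (fun n => u (S n)) l -> sums u (u O + l).
Proof.
  intros H e He. destruct (H e He) as [N HN]. exists (S N). intros [|n] Hn; [lia|].
  rewrite csum_S_l.
  replace (u O + csum (fun k => u (S k)) n - (u O + l))%C
    with (csum (fun k => u (S k)) n - l)%C by ring.
  apply HN. lia.
Qed.

Lemma sums_is_series (u : nat -> C) (l : C) :
  sums u l <-> @is_series C_AbsRing C_NormedModule u l.
Proof.
  assert (E : forall n, @sum_n C_NormedModule u n = csum u (S n)).
  { induction n as [|n IH]; [rewrite (@sum_O C_NormedModule); simpl; ring|].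
    rewrite (@sum_Sn C_NormedModule), IH. reflexivity. }
  split.
  - intros H. apply (proj2 (@filterlim_locally _ C_UniformSpace _ _ _ _)). intros e.
    destruct (H e (cond_pos e)) as [N HN]. exists N. intros n Hn.
    apply C_NormedModule_mixin_compat1. rewrite E. apply HN. lia.
  - intros H e He.
    (* The balls of [C_UniformSpace] are componentwise; returning to [Cmod] costs a factor [sqrt 2],
       which halving [e] absorbs. *)
    assert (He' : 0 < e / 2) by lra.
    destruct (proj1 (@filterlim_locally _ C_UniformSpace _ _ _ _) H (mkposreal _ He')) as [N HN].
    exists (S N). intros [|n] Hn; [lia|]. specialize (HN n ltac:(lia)).
    apply C_NormedModule_mixin_compat2 in HN. rewrite E in HN. simpl pos in HN.
    eapply Rlt_le_trans; [exact HN|].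
    assert (sqrt 2 <= 2).
    { rewrite <- (sqrt_pow2 2) at 2 by lra. apply sqrt_le_1_alt. lra. }
    nra.
Qed.

Lemma CSeries_sums (u : nat -> C) (l : C) : sums u l -> CSeries u = l.
Proof. intros H. now apply CSeries_unique, sums_is_series. Qed.

Section Geometric.

Variables (u : nat -> C) (M q : R).
Hypothesis Hq : 0 <= q < 1.
Hypothesis Hu : forall n, Cmod (u n) <= M * q ^ n.

Lemma csum_geom_tail (n k : nat) :
  Cmod (csum u (n + k) - csum u n) <= M * q ^ n * ((1 - q ^ k) / (1 - q)).
Proof.
  induction k as [|k IH].
  - rewrite Nat.add_0_r, Cmod_minus_diag. simpl. unfold Rdiv. lra.
  - rewrite Nat.add_succ_r. simpl csum.
    replace (csum u (n + k) + u (n + k)%nat - csum u n)%C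
      with ((csum u (n + k) - csum u n) + u (n + k)%nat)%C by ring.
    eapply Rle_trans; [apply Cmod_triangle|].
    specialize (Hu (n + k)). rewrite pow_add in Hu.
    replace (M * q ^ n * ((1 - q ^ S k) / (1 - q))) with
      (M * q ^ n * ((1 - q ^ k) / (1 - q)) + M * (q ^ n * q ^ k)).
    + lra.
    + simpl. field. lra.
Qed.

Lemma csum_geom_tail_le (n k : nat) :
  Cmod (csum u (n + k) - csum u n) <= M * q ^ n / (1 - q).
Proof.
  eapply Rle_trans; [apply csum_geom_tail|]. unfold Rdiv. rewrite <- Rmult_assoc.
  apply Rmult_le_compat_r; [left; apply Rinv_0_lt_compat; lra|].
  rewrite <- (Rmult_1_r (M * q ^ n)) at 2. apply Rmult_le_compat_l.
  - eapply Rle_trans; [apply Cmod_ge_0|apply Hu].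
  - pose proof (pow_le q k (proj1 Hq)). lra.
Qed.

Lemma ex_sums_geom : exists l, sums u l.
Proof.
  assert (H : @ex_series C_AbsRing C_CompleteNormedModule u).
  { apply ex_series_le with (fun n => M * q ^ n).
    - intros n. eapply Rle_trans; [|apply Hu]. right. reflexivity.
    - apply (ex_series_scal_l M (fun n => q ^ n)). apply ex_series_geom.
      rewrite Rabs_pos_eq; lra. }
  destruct H as [l Hl]. exists l. now apply sums_is_series.
Qed.

Lemma sums_geom_tail (l : C) (n : nat) :
  sums u l -> Cmod (l - csum u n) <= M * q ^ n / (1 - q).
Proof.
  intros H. apply Rle_of_le_mult_eps with 1; [lra|]. intros e He.
  destruct (H e He) as [N HN]. specialize (HN (n + N)%nat ltac:(lia)).
  pose proof (csum_geom_tail_le n N) as T.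
  pose proof (Cmod_minus_triangle l (csum u (n + N)) (csum u n)) as T'.
  rewrite (Cmod_minus_sym l (csum u (n + N))) in T'. lra.
Qed.

Lemma sums_geom_le (l : C) : sums u l -> Cmod l <= M / (1 - q).
Proof.
  intros H. pose proof (sums_geom_tail l O H) as T. simpl in T.
  replace (l - 0)%C with l in T by ring. lra.
Qed.

End Geometric.

(** Abel's criterion as a lower bound for the radius of convergence: bounded terms at every smaller
    radius. It passes to shifted and derived series without summing anything. *)
Definition radius_ge (a : nat -> C) (R : R) : Prop :=
  forall r, 0 < r < R -> exists M, forall n, Cmod (a n) * r ^ n <= M.

Definition PSum (a : nat -> C) (z : C) : C := CSeries (fun n => a n * z ^ n)%C.

Definition PS_shift (a : nat -> C) (n : nat) : C := a (S n).
Definition PS_D (a : nat -> C) (n : nat) : C := (INR (S n) * a (S n))%C.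

Lemma radius_ge_shift (a : nat -> C) (R : R) : radius_ge a R -> radius_ge (PS_shift a) R.
Proof.
  intros H r Hr. destruct (H r Hr) as [M HM]. exists (M / r). intros n.
  unfold PS_shift. apply Rmult_le_reg_r with r; [lra|].
  specialize (HM (S n)). simpl in HM. replace (M / r * r) with M by (field; lra). lra.
Qed.

(** Bernoulli's inequality for [/ q = 1 + (/ q - 1)]. It absorbs the factor that differentiation
    puts on a coefficient. *)
Lemma INR_mul_pow_le (q : R) : 0 < q < 1 -> forall n, INR n * q ^ n <= q / (1 - q).
Proof.
  intros Hq n.
  assert (B : 1 + INR n * (/ q - 1) <= (/ q) ^ n).
  { assert (P : 0 < / q - 1).
    { assert (1 < / q) by (rewrite <- Rinv_1; apply Rinv_lt_contravar; lra). lra. }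
    pose proof (poly n (/ q - 1) P) as Pn. replace (1 + (/ q - 1)) with (/ q) in Pn by ring.
    exact Pn. }
  assert (Q : 0 < q ^ n) by (apply pow_lt; lra).
  assert (E : (/ q) ^ n * q ^ n = 1).
  { rewrite <- Rpow_mult_distr, Rinv_l by lra. apply pow1. }
  apply Rmult_le_reg_r with ((1 - q) / q).
  - apply Rdiv_lt_0_compat; lra.
  - replace (q / (1 - q) * ((1 - q) / q)) with 1 by (field; lra).
    replace (INR n * q ^ n * ((1 - q) / q)) with (INR n * (/ q - 1) * q ^ n) by (field; lra).
    apply Rle_trans with ((/ q) ^ n * q ^ n); [apply Rmult_le_compat_r|]; lra.
Qed.

Lemma radius_ge_D (a : nat -> C) (R : R) : radius_ge a R -> radius_ge (PS_D a) R.
Proof.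
  (* The bound is taken at a radius [s] strictly between [r] and [R], so that the new factor [S n]
     is paid for by [(r / s) ^ S n]. *)
  intros H r Hr. destruct (H ((r + R) / 2) ltac:(lra)) as [M HM].
  set (s := (r + R) / 2) in *. set (q := r / s).
  assert (Hq : 0 < q < 1).
  { unfold q; split; [apply Rdiv_lt_0_compat; unfold s; lra|].
    apply Rmult_lt_reg_r with s; [unfold s; lra|].
    unfold Rdiv; rewrite Rmult_assoc, Rinv_l by (unfold s; lra). unfold s; lra. }
  exists (q / (1 - q) * M / r). intros n. unfold PS_D.
  rewrite Cmod_mult, Cmod_R, Rabs_pos_eq by apply pos_INR.
  apply Rmult_le_reg_r with r; [lra|].
  replace (q / (1 - q) * M / r * r) with (q / (1 - q) * M) by (field; lra).
  replace (INR (S n) * Cmod (a (S n)) * r ^ n * r) with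
    ((INR (S n) * q ^ S n) * (Cmod (a (S n)) * s ^ S n)).
  - apply Rmult_le_compat.
    + apply Rmult_le_pos; [apply pos_INR|]. apply pow_le; lra.
    + apply Rmult_le_pos; [apply Cmod_ge_0|]. apply pow_le; unfold s; lra.
    + now apply INR_mul_pow_le.
    + apply HM.
  - unfold q, Rdiv. rewrite Rpow_mult_distr, pow_inv. simpl.
    field. split; [apply pow_nonzero|]; unfold s; lra.
Qed.

Lemma radius_ge_geom (a : nat -> C) (R r : R) :
  radius_ge a R -> 0 <= r < R -> exists M q, 0 < q < 1 /\ 0 <= M /\
    forall n, Cmod (a n) * r ^ n <= M * q ^ n.
Proof.
  intros H Hr. destruct (H ((r + R) / 2) ltac:(lra)) as [M HM].
  set (s := (r + R) / 2) in *.
  assert (Hs : 0 < s /\ r < s) by (unfold s; lra).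
  assert (HM0 : 0 <= M).
  { eapply Rle_trans; [|apply (HM O)]. apply Rmult_le_pos; [apply Cmod_ge_0|simpl; lra]. }
  (* Averaging [r / s] with 1 keeps [q] strictly positive even when [r = 0]. *)
  set (q := (r / s + 1) / 2).
  assert (Hq : 0 <= r / s < 1).
  { split; [apply Rmult_le_pos; [lra|left; apply Rinv_0_lt_compat; lra]|].
    apply Rmult_lt_reg_r with s; [lra|].
    unfold Rdiv; rewrite Rmult_assoc, Rinv_l; lra. }
  exists M, q. split; [unfold q; lra|]. split; [easy|]. intros n.
  replace (r ^ n) with (s ^ n * (r / s) ^ n).
  - rewrite <- Rmult_assoc. apply Rmult_le_compat.
    + apply Rmult_le_pos; [apply Cmod_ge_0|]. apply pow_le; lra.
    + apply pow_le; lra.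
    + apply HM.
    + apply pow_incr; unfold q; lra.
  - rewrite <- Rpow_mult_distr. f_equal. field. lra.
Qed.

Lemma PSum_sums (a : nat -> C) (R : R) (z : C) :
  radius_ge a R -> Cmod z < R -> sums (fun n => a n * z ^ n)%C (PSum a z).
Proof.
  intros H Hz.
  destruct (radius_ge_geom a R (Cmod z) H (conj (Cmod_ge_0 z) Hz)) as [M [q [Hq [HM0 HM]]]].
  destruct (ex_sums_geom (fun n => a n * z ^ n)%C M q) as [l Hl].
  - lra.
  - intros n. rewrite Cmod_mult, Cmod_pow. apply HM.
  - unfold PSum. now rewrite (CSeries_sums _ _ Hl).
Qed.

Lemma PSum_unique (a : nat -> C) (z l : C) :
  sums (fun n => a n * z ^ n)%C l -> PSum a z = l.
Proof. apply CSeries_sums. Qed.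

Lemma PSum_shift (a : nat -> C) (R : R) (z : C) :
  radius_ge a R -> Cmod z < R -> PSum a z = (a O + z * PSum (PS_shift a) z)%C.
Proof.
  intros H Hz. apply PSum_unique.
  replace (a O) with (a O * z ^ 0)%C by (simpl; ring).
  apply (sums_S (fun n => a n * z ^ n)%C).
  apply sums_ext with (fun n => z * (PS_shift a n * z ^ n))%C.
  - intros n. unfold PS_shift. simpl. ring.
  - apply sums_scal. now apply PSum_sums with R; [apply radius_ge_shift|].
Qed.

Lemma PSum_0 (a : nat -> C) : PSum a 0 = a O.
Proof.
  apply PSum_unique. intros e He. exists 1%nat. intros n Hn.
  replace (csum _ n) with (a O); [rewrite Cmod_minus_diag; lra|].
  induction n as [|n IH]; [lia|]. destruct n as [|n]; [simpl; ring|].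
  simpl csum in *. rewrite <- IH by lia. simpl Cpow. ring.
Qed.

Lemma Cmod_pow_minus_le (r : R) (x y : C) (n : nat) :
  Cmod x <= r -> Cmod y <= r ->
  Cmod (x ^ n - y ^ n) <= INR n * r ^ (n - 1) * Cmod (x - y).
Proof.
  intros Hx Hy. assert (Hr : 0 <= r) by (eapply Rle_trans; [apply Cmod_ge_0|exact Hx]).
  induction n as [|n IH]; [simpl Cpow; rewrite Cmod_minus_diag; simpl; lra|].
  replace (x ^ S n - y ^ S n)%C with (x * (x ^ n - y ^ n) + (x - y) * y ^ n)%C by (simpl; ring).
  eapply Rle_trans; [apply Cmod_triangle|]. rewrite !Cmod_mult, Cmod_pow, S_INR.
  assert (A : Cmod x * Cmod (x ^ n - y ^ n) <= r * (INR n * r ^ (n - 1) * Cmod (x - y)))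
    by (apply Rmult_le_compat; try apply Cmod_ge_0; easy).
  assert (B : Cmod (x - y) * Cmod y ^ n <= Cmod (x - y) * r ^ n).
  { apply Rmult_le_compat_l; [apply Cmod_ge_0|]. apply pow_incr. split; [apply Cmod_ge_0|easy]. }
  replace (S n - 1)%nat with n by lia.
  assert (E : r * (INR n * r ^ (n - 1) * Cmod (x - y)) = INR n * r ^ n * Cmod (x - y)).
  { destruct n as [|n]; [simpl; ring|]. replace (S n - 1)%nat with n by lia. simpl. ring. }
  lra.
Qed.

(** The constant is the coefficient factor of a twice differentiated power series, so these
    remainders stay summable against the coefficients. Exponents start at 2 because the smaller ones
    leave no remainder. *)
Lemma Cmod_pow_minus_derive_le (r d : R) (x y z : C) (n : nat) :
  Cmod x <= r -> Cmod y <= r -> Cmod z <= r -> Cmod (x - z) <= d -> Cmod (y - z) <= d ->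
  Cmod (x ^ S (S n) - y ^ S (S n) - INR (S (S n)) * z ^ S n * (x - y)) <=
    INR (S (S n)) * INR (S n) * r ^ n * d * Cmod (x - y).
Proof.
  intros Hx Hy Hz Hxz Hyz. assert (Hr : 0 <= r) by (eapply Rle_trans; [apply Cmod_ge_0|exact Hx]).
  induction n as [|n IH].
  - simpl Cpow. simpl INR.
    replace (x * (x * 1) - y * (y * 1) - RtoC (1 + 1) * (z * 1) * (x - y))%C
      with (((x - z) + (y - z)) * (x - y))%C by (rewrite RtoC_plus; ring).
    rewrite Cmod_mult. simpl. pose proof (Cmod_triangle (x - z) (y - z)).
    pose proof (Cmod_ge_0 (x - y)). nra.
  - set (m := S (S n)) in *.
    replace (x ^ S m - y ^ S m - INR (S m) * z ^ m * (x - y))%C with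
      (x * (x ^ m - y ^ m - INR m * z ^ S n * (x - y))
       + (INR m * z ^ S n * (x - z) * (x - y) + (y ^ m - z ^ m) * (x - y)))%C.
    2:{ rewrite (S_INR m), RtoC_plus. unfold m. simpl Cpow. ring. }
    eapply Rle_trans; [apply Cmod_triangle|].
    eapply Rle_trans; [apply Rplus_le_compat_l, Cmod_triangle|].
    rewrite !Cmod_mult, Cmod_R, (Rabs_pos_eq _ (pos_INR m)), Cmod_pow.
    pose proof (Cmod_pow_minus_le r y z m Hy Hz) as P.
    replace (m - 1)%nat with (S n) in P by (unfold m; lia).
    pose proof (pos_INR m) as Pm. pose proof (Cmod_ge_0 (x - y)) as Pxy.
    assert (Pr : 0 <= r ^ S n) by (now apply pow_le).
    assert (A : Cmod x * Cmod (x ^ m - y ^ m - INR m * z ^ S n * (x - y)) <=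
       r * (INR m * INR (S n) * r ^ n * d * Cmod (x - y))).
    { apply Rmult_le_compat; try apply Cmod_ge_0; easy. }
    assert (B : INR m * Cmod z ^ S n * Cmod (x - z) * Cmod (x - y) <=
       INR m * r ^ S n * d * Cmod (x - y)).
    { apply Rmult_le_compat_r; [easy|]. apply Rmult_le_compat; try easy; try apply Cmod_ge_0.
      - apply Rmult_le_pos; [easy|]. apply pow_le, Cmod_ge_0.
      - apply Rmult_le_compat_l; [easy|]. apply pow_incr. split; [apply Cmod_ge_0|easy]. }
    assert (D : Cmod (y ^ m - z ^ m) * Cmod (x - y) <= INR m * r ^ S n * d * Cmod (x - y)).
    { apply Rmult_le_compat_r; [easy|]. eapply Rle_trans; [exact P|].
      apply Rmult_le_compat_l; [now apply Rmult_le_pos|easy]. }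
    rewrite (S_INR m). unfold m in *. rewrite (S_INR (S n)) in *. simpl pow in *.
    eapply Rle_trans; [apply Rplus_le_compat; [exact A|apply Rplus_le_compat; [exact B|exact D]]|].
    right. ring.
Qed.

Lemma strict_derive_PSum (a : nat -> C) (R : R) (z : C) :
  radius_ge a R -> Cmod z < R -> strict_derive (PSum a) z (PSum (PS_D a) z).
Proof.
  intros H Hz. set (r := (Cmod z + R) / 2). pose proof (Cmod_ge_0 z) as Pz.
  assert (Hr : 0 < r < R /\ Cmod z < r) by (unfold r; lra). destruct Hr as [Hr Hzr].
  destruct (radius_ge_geom (PS_D (PS_D a)) R r) as [M [q [Hq [HM0 HM]]]];
    [now do 2 apply radius_ge_D|lra|].
  apply strict_derive_intro with (M / (1 - q)).
  { apply Rmult_le_pos; [easy|]. left; apply Rinv_0_lt_compat; lra. }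
  intros e [He _].
  destruct (Rmin_pos_lt e (r - Cmod z) He ltac:(lra)) as [h1 [h2 h3]].
  exists (Rmin e (r - Cmod z)). split; [easy|]. intros x y Hx Hy.
  pose proof (Cmod_le_minus x z) as Tx. pose proof (Cmod_le_minus y z) as Ty.
  (* The secant error is summed termwise: [u 0] and [u 1] vanish, and the later terms are dominated
     geometrically through the second derived series at radius [r]. *)
  set (u := fun n => (a n * (x ^ n - y ^ n - INR n * z ^ (n - 1) * (x - y)))%C).
  assert (Su : sums u (PSum a x - PSum a y - PSum (PS_D a) z * (x - y))).
  { apply sums_ext with
      (fun n => a n * x ^ n - a n * y ^ n - (x - y) * (INR n * a n * z ^ (n - 1)))%C.
    - intros n. unfold u. ring.
    - rewrite (Cmult_comm (PSum (PS_D a) z)). apply sums_minus; [apply sums_minus|].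
      + apply PSum_sums with R; [easy|lra].
      + apply PSum_sums with R; [easy|lra].
      + apply sums_scal.
        (* The term of index 0 carries the factor [INR 0], so the truncated exponent [0 - 1] is
           harmless. *)
        replace (PSum (PS_D a) z)
          with (INR 0 * a O * z ^ (0 - 1) + PSum (PS_D a) z)%C by (simpl; ring).
        apply (sums_S (fun n => INR n * a n * z ^ (n - 1))%C).
        apply sums_ext with (fun n => PS_D a n * z ^ n)%C.
        * intros n. unfold PS_D. now replace (S n - 1)%nat with n by lia.
        * apply PSum_sums with R; [now apply radius_ge_D|easy]. }
  assert (u0 : u O = 0%C) by (unfold u; simpl; ring).
  assert (u1 : u 1%nat = 0%C) by (unfold u; simpl; ring).
  destruct (ex_sums_geom (fun n => u (S (S n))) (M * (e * Cmod (x - y))) q) as [l Hl].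
  - lra.
  - intros n. unfold u. rewrite Cmod_mult. replace (S (S n) - 1)%nat with (S n) by lia.
    eapply Rle_trans.
    + apply Rmult_le_compat_l; [apply Cmod_ge_0|].
      apply (Cmod_pow_minus_derive_le r e); lra.
    + specialize (HM n). unfold PS_D in HM. rewrite !Cmod_mult, !Cmod_R in HM.
      rewrite !(Rabs_pos_eq _ (pos_INR _)) in HM.
      apply Rle_trans with ((M * q ^ n) * (e * Cmod (x - y))); [|right; ring].
      eapply Rle_trans; [|apply Rmult_le_compat_r; [|exact HM]].
      * right; ring.
      * apply Rmult_le_pos; [lra|apply Cmod_ge_0].
  - assert (E : (PSum a x - PSum a y - PSum (PS_D a) z * (x - y))%C = l).
    { apply (sums_unique u _ _ Su). replace l with (u O + (u 1%nat + l))%C by (rewrite u0, u1; ring).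
      apply sums_S. now apply (sums_S (fun n => u (S n))). }
    rewrite E.
    eapply Rle_trans; [apply (sums_geom_le (fun n => u (S (S n))) (M * (e * Cmod (x - y))) q)|].
    + lra.
    + intros n. unfold u. rewrite Cmod_mult. replace (S (S n) - 1)%nat with (S n) by lia.
      eapply Rle_trans.
      * apply Rmult_le_compat_l; [apply Cmod_ge_0|].
        apply (Cmod_pow_minus_derive_le r e); lra.
      * specialize (HM n). unfold PS_D in HM. rewrite !Cmod_mult, !Cmod_R in HM.
        rewrite !(Rabs_pos_eq _ (pos_INR _)) in HM.
        apply Rle_trans with ((M * q ^ n) * (e * Cmod (x - y))); [|right; ring].
        eapply Rle_trans; [|apply Rmult_le_compat_r; [|exact HM]].
        -- right; ring.
        -- apply Rmult_le_pos; [lra|apply Cmod_ge_0].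
    + exact Hl.
    + right. field. lra.
Qed.

Lemma sums_terms_bounded (u : nat -> C) (l : C) :
  sums u l -> exists M, forall n, Cmod (u n) <= M.
Proof.
  intros H. destruct (H 1 Rlt_0_1) as [N HN].
  assert (B : exists M, forall n, (n < N)%nat -> Cmod (u n) <= M).
  { clear HN. induction N as [|N [M HM]]; [exists 0; intros; lia|].
    exists (Rmax M (Cmod (u N))). intros n Hn. destruct (Nat.eq_dec n N) as [->|hne].
    - apply Rmax_r.
    - eapply Rle_trans; [apply HM; lia|apply Rmax_l]. }
  destruct B as [M HM]. exists (Rmax M 2). intros n.
  destruct (Nat.lt_ge_cases n N) as [h|h].
  - eapply Rle_trans; [now apply HM|apply Rmax_l].
  - eapply Rle_trans; [|apply Rmax_r].
    pose proof (HN n h) as A. pose proof (HN (S n) ltac:(lia)) as B.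
    simpl csum in B. replace (u n) with ((csum u n + u n - l) - (csum u n - l))%C by ring.
    eapply Rle_trans; [apply Cmod_minus_le|]. lra.
Qed.

Lemma radius_ge_of_sums (a : nat -> C) (R : R) (f : C -> C) :
  (forall z, Cmod z < R -> sums (fun n => a n * z ^ n)%C (f z)) -> radius_ge a R.
Proof.
  intros H r Hr.
  destruct (sums_terms_bounded _ _ (H (RtoC r) ltac:(rewrite Cmod_R, Rabs_pos_eq; lra))) as [M HM].
  exists M. intros n. specialize (HM n).
  now rewrite Cmod_mult, Cmod_pow, Cmod_R, Rabs_pos_eq in HM by lra.
Qed.

Lemma is_pseries_sums (a : nat -> C) (z l : C) :
  @is_pseries C_AbsRing C_NormedModule a z l <-> sums (fun n => a n * z ^ n)%C l.
Proof.
  assert (P : forall n, @pow_n C_Ring z n = (z ^ n)%C).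
  { induction n as [|n IH]; [easy|]. simpl. now rewrite IH. }
  assert (E : forall n, @scal C_Ring C_NormedModule (@pow_n C_Ring z n) (a n) = (a n * z ^ n)%C).
  { intros n. rewrite P. apply Cmult_comm. }
  unfold is_pseries. rewrite <- sums_is_series.
  split; apply sums_ext; intros n; [|symmetry]; apply E.
Qed.

Lemma analytic_at_PSum (f : C -> C) (z0 : C) :
  analytic_at f z0 <-> exists a R, 0 < R /\ radius_ge a R /\
    forall z, Cmod (z - z0) < R -> f z = PSum a (z - z0).
Proof.
  split.
  - intros [a [r [Hr H]]].
    assert (K : forall h, Cmod h < r -> sums (fun n => a n * h ^ n)%C (f (z0 + h)%C)).
    { intros h Hh. apply is_pseries_sums.
      replace h with (z0 + h - z0)%C at 1 by ring. apply H.
      now replace (z0 + h - z0)%C with h by ring. }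
    exists a, r. split; [easy|]. split; [exact (radius_ge_of_sums a r _ K)|].
    intros z Hz. symmetry. apply PSum_unique. apply is_pseries_sums. now apply H.
  - intros [a [r [Hr [Ha H]]]]. exists a, r. split; [easy|]. intros z Hz.
    apply is_pseries_sums. rewrite H by easy. now apply PSum_sums with r.
Qed.

Lemma strict_derive_translate (f : C -> C) (z0 z l : C) :
  strict_derive f (z - z0) l -> strict_derive (fun x => f (x - z0)%C) z l.
Proof.
  intros H. replace l with (l * (1 + 0))%C by ring.
  apply (strict_derive_comp (fun x => x + - z0)%C f); [|exact H].
  apply strict_derive_plus; [apply strict_derive_id|apply strict_derive_const].
Qed.

Lemma strict_derive_analytic (f : C -> C) (z : C) :
  analytic_at f z -> strict_derive f z (C_derive f z).
Proof.
  intros H. apply analytic_at_PSum in H. destruct H as [a [R [HR [Ha Hf]]]].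
  assert (S : strict_derive f z (PSum (PS_D a) (z - z))).
  { apply strict_derive_ext_loc with (fun x => PSum a (x - z)) R; [easy| |].
    - intros x Hx. symmetry. now apply Hf.
    - apply (strict_derive_translate (PSum a)). apply strict_derive_PSum with R; [easy|].
      rewrite Cmod_minus_diag. lra. }
  now rewrite (C_derive_of_strict _ _ _ S).
Qed.

Lemma analytic_at_C_derive (f : C -> C) (z : C) :
  analytic_at f z ->
  (exists r, 0 < r /\ forall x, Cmod (x - z) < r -> strict_derive f x (C_derive f x)) /\
  analytic_at (C_derive f) z.
Proof.
  intros H. apply analytic_at_PSum in H. destruct H as [a [R [HR [Ha Hf]]]].
  assert (S : forall x, Cmod (x - z) < R -> strict_derive f x (PSum (PS_D a) (x - z))).
  { intros x Hx. apply strict_derive_ext_loc with (fun x => PSum a (x - z)) (R - Cmod (x - z)).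
    - lra.
    - intros y Hy. symmetry. apply Hf. pose proof (Cmod_minus_triangle y x z). lra.
    - apply (strict_derive_translate (PSum a)). now apply strict_derive_PSum with R. }
  split.
  - exists R. split; [easy|]. intros x Hx. specialize (S x Hx).
    now rewrite (C_derive_of_strict _ _ _ S).
  - apply analytic_at_PSum. exists (PS_D a), R.
    split; [easy|]. split; [now apply radius_ge_D|]. intros x Hx. now apply C_derive_of_strict, S.
Qed.

(** * Compactness *)

Lemma cluster_R (u : nat -> R) (M : R) :
  (forall n, Rabs (u n) <= M) ->
  exists l, forall e N, 0 < e -> exists n, (N <= n)%nat /\ Rabs (u n - l) < e.
Proof.
  intros H. destruct (Bolzano_Weierstrass u (fun x => - M <= x <= M)) as [l Hl].
  - apply compact_P3.
  - intros n. specialize (H n). apply Rabs_le_between in H. easy.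
  - exists l. intros e N He.
    destruct (Hl (disc l (mkposreal e He)) N) as [n [Hn Hd]].
    + exists (mkposreal e He). intros x Hx. exact Hx.
    + exists n. split; [easy|exact Hd].
Qed.

(** Bolzano-Weierstrass for the real parts, then for the imaginary parts along indices [phi n >= n]
    where the real parts already converge to [a]. *)
Lemma cluster_C (u : nat -> C) (M : R) :
  (forall n, Cmod (u n) <= M) ->
  exists l, forall e N, 0 < e -> exists n, (N <= n)%nat /\ Cmod (u n - l) < e.
Proof.
  intros H.
  destruct (cluster_R (fun n => fst (u n)) M) as [a Ha].
  { intros n. eapply Rle_trans; [|apply (H n)].
    eapply Rle_trans; [apply Rmax_l|apply Rmax_Cmod]. }
  assert (Hphi : forall n, exists m, (n <= m)%nat /\ Rabs (fst (u m) - a) < / (INR n + 1)).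
  { intros n. apply Ha. apply Rinv_0_lt_compat. pose proof (pos_INR n). lra. }
  apply choice in Hphi. destruct Hphi as [phi Hphi].
  destruct (cluster_R (fun n => snd (u (phi n))) M) as [b Hb].
  { intros n. eapply Rle_trans; [|apply (H (phi n))].
    eapply Rle_trans; [apply Rmax_r|apply Rmax_Cmod]. }
  exists (a, b). intros e N He.
  destruct (archimed_cor1 (e / 2) ltac:(lra)) as [K [HK HK0]].
  destruct (Hb (e / 2) (N + K)%nat ltac:(lra)) as [n [Hn Hbn]].
  destruct (Hphi n) as [Hge Han].
  exists (phi n). split; [lia|].
  assert (Hn' : / (INR n + 1) <= / INR K).
  { apply Rinv_le_contravar; [now apply lt_0_INR|].
    apply Rle_trans with (INR n); [apply le_INR; lia|lra]. }
  eapply Rle_lt_trans; [apply Cmod_2Rmax|]. simpl.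
  assert (S2 : 0 < sqrt 2 < 2).
  { split; [apply sqrt_lt_R0; lra|]. rewrite <- (sqrt_pow2 2) at 2 by lra.
    apply sqrt_lt_1; simpl; lra. }
  assert (Rmax (Rabs (fst (u (phi n)) + - a)) (Rabs (snd (u (phi n)) + - b)) < e / 2).
  { unfold Rminus in *. apply Rmax_lub_lt; lra. }
  assert (0 <= Rmax (Rabs (fst (u (phi n)) + - a)) (Rabs (snd (u (phi n)) + - b))).
  { eapply Rle_trans; [apply Rabs_pos|apply Rmax_l]. }
  nra.
Qed.

(* Lebesgue-number form of the compactness of closed balls. *)
Lemma compact_uniform (z0 : C) (r : R) (P : C -> R -> Prop) :
  (forall x d d', 0 < d' <= d -> P x d -> P x d') ->
  (forall l, Cmod (l - z0) <= r -> exists d, 0 < d /\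
     forall x, Cmod (x - z0) <= r -> Cmod (x - l) < d -> P x d) ->
  exists d, 0 < d /\ forall x, Cmod (x - z0) <= r -> P x d.
Proof.
  intros Hmon Hloc. apply NNPP. intros Hn.
  assert (Hu : forall n, exists x, Cmod (x - z0) <= r /\ ~ P x (/ (INR n + 1))).
  { intros n. apply NNPP. intros Hx. apply Hn. exists (/ (INR n + 1)). split.
    - apply Rinv_0_lt_compat. pose proof (pos_INR n). lra.
    - intros x Hxr. apply NNPP. intros HP. apply Hx. now exists x. }
  apply choice in Hu. destruct Hu as [u Hu].
  destruct (cluster_C u (r + Cmod z0)) as [l Hl].
  { intros n. destruct (Hu n) as [h _]. pose proof (Cmod_le_minus (u n) z0). lra. }
  assert (Hlr : Cmod (l - z0) <= r).
  { apply Rle_of_le_mult_eps with 1; [lra|]. intros e He.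
    destruct (Hl e O He) as [n [_ h]]. destruct (Hu n) as [h' _].
    pose proof (Cmod_minus_triangle l (u n) z0) as T. rewrite (Cmod_minus_sym l (u n)) in T. lra. }
  destruct (Hloc l Hlr) as [d [Hd HP]].
  destruct (archimed_cor1 d Hd) as [K [HK HK0]].
  destruct (Hl d K Hd) as [n [Hnk h]]. destruct (Hu n) as [h' HnP]. apply HnP.
  assert (Hn' : / (INR n + 1) <= / INR K).
  { apply Rinv_le_contravar; [now apply lt_0_INR|].
    apply Rle_trans with (INR n); [apply le_INR; lia|lra]. }
  apply Hmon with d.
  - split; [apply Rinv_0_lt_compat; pose proof (pos_INR n)|]; lra.
  - now apply HP.
Qed.

Lemma continuous_bounded (f : C -> C) (z0 : C) (r : R) :
  (forall x, Cmod (x - z0) <= r -> continuous_C f x) ->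
  exists M, 0 < M /\ forall x, Cmod (x - z0) <= r -> Cmod (f x) <= M.
Proof.
  intros H.
  (* A bound of the form [/ d] weakens as [d] shrinks, which is the monotonicity required by
     [compact_uniform]. *)
  destruct (compact_uniform z0 r (fun x d => Cmod (f x) <= / d)) as [d [Hd HP]].
  - intros x d d' Hd HP. eapply Rle_trans; [exact HP|]. apply Rinv_le_contravar; lra.
  - intros l Hl. destruct (H l Hl 1 Rlt_0_1) as [d [Hd Hf]].
    pose proof (Cmod_ge_0 (f l)) as Pl.
    assert (Hi : 0 < / (Cmod (f l) + 1)) by (apply Rinv_0_lt_compat; lra).
    destruct (Rmin_pos_lt d _ Hd Hi) as [h1 [h2 h3]].
    exists (Rmin d (/ (Cmod (f l) + 1))). split; [easy|]. intros x _ Hx.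
    specialize (Hf x ltac:(lra)). pose proof (Cmod_le_minus (f x) (f l)).
    apply Rle_trans with (Cmod (f l) + 1); [lra|].
    apply Rle_trans with (/ / (Cmod (f l) + 1)); [right; symmetry; apply Rinv_inv|].
    now apply Rinv_le_contravar.
  - exists (/ d). split; [now apply Rinv_0_lt_compat|easy].
Qed.

Section Holomorphic_on_ball.

Variables (f f' : C -> C) (r s : R).
Hypothesis Hrs : r < s.
Hypothesis Hf : forall x, Cmod x < s -> strict_derive f x (f' x).

(** Near a fixed [l] the estimate first holds with the slope [f' l]; continuity of the derivative
    replaces it by [f' x], and compactness makes the radius independent of [x]. *)
Lemma uniform_strict_derive (e : R) :
  0 < e -> exists d, 0 < d /\ forall x y, Cmod x <= r -> Cmod (y - x) < d ->
    Cmod (f y - f x - f' x * (y - x)) <= e * Cmod (y - x).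
Proof.
  intros He.
  destruct (compact_uniform 0 r (fun x d => forall y, Cmod (y - x) < d ->
    Cmod (f y - f x - f' x * (y - x)) <= e * Cmod (y - x))) as [d [Hd HP]].
  - intros x d d' Hd HP y Hy. apply HP. lra.
  - intros l Hl. replace (l - 0)%C with l in Hl by ring.
    destruct (Hf l ltac:(lra) (e / 2) ltac:(lra)) as [d1 [Hd1 H1]].
    destruct (strict_derive_derivative_near f f' l (s - Cmod l) ltac:(lra)) with (e / 2)
      as [d2 [Hd2 H2]]; [|lra|].
    + intros x Hx. apply Hf. pose proof (Cmod_le_minus x l). lra.
    + destruct (Rmin_pos_lt d1 d2 Hd1 Hd2) as [h1 [h2 h3]].
      exists (Rmin d1 d2 / 2). split; [lra|]. intros x _ Hx y Hy.
      pose proof (Cmod_minus_triangle y x l).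
      specialize (H1 y x ltac:(lra) ltac:(lra)). specialize (H2 x ltac:(lra)).
      replace (f y - f x - f' x * (y - x))%C with
        ((f y - f x - f' l * (y - x)) - (f' x - f' l) * (y - x))%C by ring.
      eapply Rle_trans; [apply Cmod_minus_le|]. rewrite Cmod_mult.
      pose proof (Cmod_ge_0 (y - x)). nra.
  - exists d. split; [easy|]. intros x y Hx Hy. apply HP; [|easy].
    now replace (x - 0)%C with x by ring.
Qed.

Lemma holomorphic_bounded : exists M, 0 < M /\ forall x, Cmod x <= r -> Cmod (f x) <= M.
Proof.
  destruct (continuous_bounded f 0 r) as [M [HM H]].
  - intros x Hx. replace (x - 0)%C with x in Hx by ring.
    apply strict_derive_continuous with (f' x). apply Hf. lra.
  - exists M. split; [easy|]. intros x Hx. apply H. now replace (x - 0)%C with x by ring.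
Qed.

(** Pairs closer than [d] are controlled by the derivative, all others by the sup bound, through
    [2 * B <= 2 * B / d * |y - x|]. *)
Lemma holomorphic_lipschitz :
  exists L, 0 < L /\ forall x y, Cmod x <= r -> Cmod y <= r ->
    Cmod (f y - f x) <= L * Cmod (y - x).
Proof.
  destruct (uniform_strict_derive 1 Rlt_0_1) as [d [Hd HP]].
  destruct holomorphic_bounded as [B [HB HfB]].
  destruct (continuous_bounded f' 0 r) as [M [HM HfM]].
  { intros x Hx. replace (x - 0)%C with x in Hx by ring.
    apply strict_derive_derivative_near with f (s - Cmod x); [lra|].
    intros y Hy. apply Hf. pose proof (Cmod_le_minus y x). lra. }
  assert (HBd : 0 < 2 * B / d) by (apply Rdiv_lt_0_compat; lra).
  exists (M + 1 + 2 * B / d). split; [lra|]. intros x y Hx Hy.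
  pose proof (Cmod_ge_0 (y - x)) as Pxy.
  destruct (Rlt_le_dec (Cmod (y - x)) d) as [h|h].
  - specialize (HP x y Hx h). specialize (HfM x). replace (x - 0)%C with x in HfM by ring.
    specialize (HfM Hx).
    eapply Rle_trans; [apply (Cmod_le_minus _ (f' x * (y - x))%C)|]. rewrite Cmod_mult.
    apply (Rmult_le_compat_r _ _ _ Pxy) in HfM.
    assert (0 <= 2 * B / d * Cmod (y - x)) by (apply Rmult_le_pos; lra). lra.
  - eapply Rle_trans; [apply Cmod_minus_le|].
    pose proof (HfB x Hx). pose proof (HfB y Hy).
    apply Rle_trans with (2 * B / d * d).
    + replace (2 * B / d * d) with (2 * B) by (field; lra). lra.
    + apply Rmult_le_compat; lra.
Qed.

End Holomorphic_on_ball.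

(** * Roots of unity and the Cauchy expansion *)

Definition cis (t : R) : C := (cos t, sin t).

Lemma cis_0 : cis 0 = 1%C.
Proof. unfold cis. now rewrite cos_0, sin_0. Qed.

Lemma cis_add (a b : R) : cis (a + b) = (cis a * cis b)%C.
Proof.
  unfold cis, Cmult; simpl. rewrite cos_plus, sin_plus. f_equal. ring.
Qed.

Lemma cis_pow (t : R) (n : nat) : (cis t ^ n)%C = cis (INR n * t).
Proof.
  induction n as [|n IH]; [now rewrite Rmult_0_l, cis_0|].
  rewrite S_INR, Rmult_plus_distr_r, Rmult_1_l, Rplus_comm, cis_add, <- IH. easy.
Qed.

Lemma Cmod_cis (t : R) : Cmod (cis t) = 1.
Proof.
  unfold Cmod, cis; simpl. rewrite !Rmult_1_r, Rplus_comm.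
  pose proof (sin2_cos2 t) as H. unfold Rsqr in H. rewrite H. apply sqrt_1.
Qed.

Lemma cis_2PI : cis (2 * PI) = 1%C.
Proof. unfold cis. now rewrite cos_2PI, sin_2PI. Qed.

(** The chord has length [2 * sin (t / 2)]. *)
Lemma Cmod_cis_minus_1 (t : R) : 0 < t <= PI -> Cmod (cis t - 1) <= t.
Proof.
  intros Ht. assert (S0 : 0 <= sin (t / 2)) by (apply sin_ge_0; lra).
  assert (S1 : sin (t / 2) < t / 2) by (apply sin_lt_x; lra).
  unfold Cmod, cis; simpl.
  replace ((cos t + - (1)) * ((cos t + - (1)) * 1) + (sin t + - 0) * ((sin t + - 0) * 1))
    with (4 * (sin (t / 2) * sin (t / 2))).
  - apply Rle_trans with (sqrt (t ^ 2)); [|right; apply sqrt_pow2; lra].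
    apply sqrt_le_1_alt. simpl. nra.
  - pose proof (sin2_cos2 t) as H. unfold Rsqr in H.
    pose proof (cos_2a_sin (t / 2)) as D. replace (2 * (t / 2)) with t in D by field. nra.
Qed.

Lemma cis_neq_1 (t : R) : 0 < t < 2 * PI -> cis t <> 1%C.
Proof.
  intros Ht H. assert (S0 : 0 < sin (t / 2)) by (apply sin_gt_0; lra).
  pose proof (cos_2a_sin (t / 2)) as D. replace (2 * (t / 2)) with t in D by field.
  assert (E : cos t = 1) by exact (f_equal fst H). nra.
Qed.

Lemma Cmod_1_neq_0 (x : C) : Cmod x = 1 -> x <> 0%C.
Proof. intros H ->. rewrite Cmod_0 in H. lra. Qed.

Lemma Cpow_swap (x : C) (m n : nat) : ((x ^ m) ^ n)%C = ((x ^ n) ^ m)%C.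
Proof. now rewrite <- !Cpow_mult_r, Nat.mul_comm. Qed.

Lemma Cdiff_neq_0 (x y : C) : x <> y -> (x - y)%C <> 0%C.
Proof. intros H E. now apply H, Cminus_eq_0. Qed.

Lemma Cmod_mult_INR (n : nat) (x : C) : Cmod (INR n * x) = INR n * Cmod x.
Proof. rewrite Cmod_mult, Cmod_R, Rabs_pos_eq; [easy|apply pos_INR]. Qed.

(** * Cauchy's formula on the vertices of a regular polygon, with an error term *)

Section Discrete_Cauchy.

Variables (f f' : C -> C) (e d : R).
Hypothesis He : 0 < e.
Hypothesis Hd : forall x y, Cmod x <= 1 -> Cmod (y - x) < d ->
    Cmod (f y - f x - f' x * (y - x)) <= e * Cmod (y - x).

Variables (N : nat) (om v : C).
Hypothesis HN : (1 < N)%nat.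
Hypothesis Hom : Cmod om = 1.
Hypothesis Homv : (om * v)%C = 1%C.
Hypothesis HomN : (om ^ N)%C = 1%C.
Hypothesis Hprim : forall n, (0 < n < N)%nat -> (v ^ n)%C <> 1%C.
Hypothesis Hstep : Cmod (om - 1) < d.

Let HvN : (v ^ N)%C = 1%C.
Proof.
  pose proof (Cpow_mult_l om v N) as H. rewrite Homv, HomN, Cpow_1_l in H.
  rewrite H. ring.
Qed.

Let Hv : Cmod v = 1.
Proof.
  pose proof (f_equal Cmod Homv) as H. rewrite Cmod_mult, Hom, Cmod_1 in H. lra.
Qed.

Let Hom1 : om <> 1%C.
Proof.
  intros E. apply (Hprim 1); [lia|]. rewrite E in Homv.
  transitivity (1 * v)%C; [simpl; ring|exact Homv].
Qed.

Let Cmod_om (j : nat) : Cmod (om ^ j) = 1.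
Proof. rewrite Cmod_pow, Hom. apply pow1. Qed.

Let Cmod_v (j : nat) : Cmod (v ^ j) = 1.
Proof. rewrite Cmod_pow, Hv. apply pow1. Qed.

Variable z : C.
Hypothesis Hz : Cmod z < 1.

(** Since [v] inverts [om], this is [om ^ j / (om ^ j - z)]: the Cauchy kernel at the vertex
    [om ^ j] with the line element included. *)
Let kernel (j : nat) : C := (/ (1 - z * v ^ j))%C.

Let kernel_neq_0 (j : nat) : (1 - z * v ^ j)%C <> 0%C.
Proof.
  intros H. assert (E : (z * v ^ j)%C = 1%C) by (symmetry; now apply Cminus_eq_0).
  apply (f_equal Cmod) in E. rewrite Cmod_mult, Cmod_v, Cmod_1 in E. lra.
Qed.

Let Cmod_kernel (j : nat) : Cmod (kernel j) <= / (1 - Cmod z).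
Proof.
  unfold kernel. rewrite Cmod_inv by auto. apply Rinv_le_contravar; [lra|].
  pose proof (Cmod_le_minus 1 (z * v ^ j)) as H.
  rewrite Cmod_1, Cmod_mult, Cmod_v in H. lra.
Qed.

Let kernel_node (j : nat) : (kernel j * (om ^ j - z))%C = (om ^ j)%C.
Proof.
  assert (E : (om ^ j - z)%C = (om ^ j * (1 - z * v ^ j))%C).
  { replace (om ^ j * (1 - z * v ^ j))%C with (om ^ j - z * (om ^ j * v ^ j))%C by ring.
    rewrite <- Cpow_mult_l, Homv, Cpow_1_l. ring. }
  rewrite E. unfold kernel. field. apply kernel_neq_0.
Qed.

(** A finite geometric sum: [(z * v ^ j) ^ N = z ^ N] does not depend on the vertex, so no infinite
    expansion of the kernel is needed. *)
Let kernel_geom (j : nat) :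
  ((1 - z ^ N) * kernel j)%C = csum (fun n => z ^ n * (v ^ j) ^ n)%C N.
Proof.
  pose proof (csum_geom (z * v ^ j) N) as H.
  rewrite (csum_ext _ (fun n => z ^ n * (v ^ j) ^ n)%C) in H
    by (intros; apply Cpow_mult_l).
  rewrite Cpow_mult_l, (Cpow_swap v), HvN, Cpow_1_l, Cmult_1_r in H.
  rewrite <- H. unfold kernel. field. apply kernel_neq_0.
Qed.

Let roots_sum (x : C) : x <> 1%C -> (x ^ N)%C = 1%C -> csum (fun j => x ^ j)%C N = 0%C.
Proof.
  intros Hx HxN. pose proof (csum_geom x N) as H. rewrite HxN in H.
  apply NNPP. intros h. assert (Hx' : (1 - x)%C <> 0%C) by (apply Cdiff_neq_0; auto).
  apply (Cmult_neq_0 _ _ Hx' h). rewrite H. ring.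
Qed.

(** Orthogonality of characters: summed over the vertices, every positive power of [z] below [N]
    disappears. *)
Let kernel_sum : ((1 - z ^ N) * csum kernel N)%C = INR N.
Proof.
  rewrite <- csum_scal.
  rewrite (csum_ext _ (fun j => csum (fun n => z ^ n * (v ^ j) ^ n)%C N))
    by (intros; apply kernel_geom).
  rewrite csum_swap. destruct N as [|N']; [lia|]. rewrite csum_S_l.
  rewrite (csum_ext (fun i => z ^ 0 * (v ^ i) ^ 0)%C (fun _ => 1%C)) by (intros; simpl; ring).
  rewrite csum_const.
  rewrite (csum_ext (fun k => csum _ (S N')) (fun _ => 0%C)).
  - rewrite csum_const. ring.
  - intros n Hn.
    rewrite (csum_ext _ (fun i => z ^ S n * (v ^ S n) ^ i)%C)
      by (intros; now rewrite Cpow_swap).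
    rewrite csum_scal, roots_sum; [ring| |].
    + apply Hprim. lia.
    + now rewrite Cpow_swap, HvN, Cpow_1_l.
Qed.

Let node (t : R) (j : nat) : C := (z + t * (om ^ j - z))%C.

Let Cmod_node (t : R) (j : nat) : 0 <= t <= 1 -> Cmod (node t j) <= 1.
Proof.
  intros Ht. unfold node.
  replace (z + t * (om ^ j - z))%C with (RtoC (1 - t) * z + t * om ^ j)%C
    by (rewrite RtoC_minus; ring).
  eapply Rle_trans; [apply Cmod_triangle|].
  rewrite !Cmod_mult, !Cmod_R, !Rabs_pos_eq, Cmod_om by lra. nra.
Qed.

(* Increments of [f] along the closed polygon of nodes telescope to [0]. *)
Let derivative_average (t : R) :
  0 <= t <= 1 -> Cmod (csum (fun j => f' (node t j) * om ^ j)%C N) <= INR N * e.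
Proof.
  intros Ht. destruct (Rle_lt_or_eq_dec 0 t (proj1 Ht)) as [Ht0|Ht0].
  - assert (H1 : 0 < Cmod (om - 1)).
    { apply Cmod_gt_0. now apply Cdiff_neq_0. }
    assert (E : csum (fun j => f (node t (S j)) - f (node t j))%C N = 0%C).
    { rewrite (csum_telescope (fun j => f (node t j))). unfold node.
      rewrite HomN. simpl. ring. }
    assert (B : Cmod (csum (fun j => (f (node t (S j)) - f (node t j))
                - f' (node t j) * (node t (S j) - node t j))%C N)
             <= INR N * (e * (t * Cmod (om - 1)))).
    { apply Cmod_csum_le. intros j _.
      assert (D : Cmod (node t (S j) - node t j) = t * Cmod (om - 1)).
      { unfold node. replace (z + t * (om ^ S j - z) - (z + t * (om ^ j - z)))%C
          with (t * om ^ j * (om - 1))%C by (simpl; ring).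
        rewrite !Cmod_mult, Cmod_om, Cmod_R, Rabs_pos_eq by lra. ring. }
      rewrite <- D. apply Hd; [now apply Cmod_node|]. rewrite D. nra. }
    rewrite csum_minus, E in B.
    rewrite (csum_ext _ (fun j => (t * (om - 1)) * (f' (node t j) * om ^ j))%C) in B
      by (intros; unfold node; simpl; ring).
    rewrite csum_scal in B.
    replace (0 - _)%C with (- (t * (om - 1) * csum (fun j => f' (node t j) * om ^ j) N))%C
      in B by ring.
    rewrite Cmod_opp, !Cmod_mult, Cmod_R, Rabs_pos_eq in B by lra.
    apply Rmult_le_reg_l with (t * Cmod (om - 1)); [nra|].
    lra.
  (* At [t = 0] the polygon collapses to [z] and division by [t] is impossible; the sum is then
     [f' z] times the vanishing sum of the roots of unity. *)
  - subst t.
    rewrite (csum_ext _ (fun j => f' z * om ^ j)%C).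
    + rewrite csum_scal, roots_sum, Cmult_0_r, Cmod_0 by easy.
      apply Rmult_le_pos; [apply pos_INR|lra].
    + intros j _. unfold node. now replace (z + 0 * (om ^ j - z))%C with z by ring.
Qed.

(** A homotopy contracting the vertices to [z]. Formally its derivative in [t] is the sum of
    [f' (node t j) * om ^ j], by [kernel_node], and [derivative_average] says that this is small. It
    is the discrete form of differentiating the integral of [f (z + t (w - z)) / (w - z)] in [t]. *)
Let A (t : R) : C := csum (fun j => f (node t j) * kernel j)%C N.

Let A_step (t s : R) :
  0 <= t -> 0 <= s -> t + s <= 1 -> 2 * s < d ->
  Cmod (A (t + s) - A t) <= s * (INR N * (e * (1 + 2 / (1 - Cmod z)))).
Proof.
  intros Ht Hs Hts Hsd. unfold A. rewrite <- csum_minus.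
  assert (Q : 0 < / (1 - Cmod z)) by (apply Rinv_0_lt_compat; lra).
  rewrite (csum_ext _ (fun j => s * (f' (node t j) * om ^ j)
     + (f (node (t + s) j) - f (node t j) - f' (node t j) * (node (t + s) j - node t j))
       * kernel j)%C).
  - rewrite csum_plus, csum_scal. eapply Rle_trans; [apply Cmod_triangle|].
    rewrite Cmod_mult, Cmod_R, Rabs_pos_eq by easy.
    assert (D := derivative_average t ltac:(lra)).
    apply (Rmult_le_compat_l s _ _ Hs) in D.
    assert (B : forall j, Cmod ((f (node (t + s) j) - f (node t j)
       - f' (node t j) * (node (t + s) j - node t j)) * kernel j)
       <= e * (2 * s) * / (1 - Cmod z)).
    { intros j. rewrite Cmod_mult.
      assert (Dn : Cmod (node (t + s) j - node t j) <= 2 * s).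
      { unfold node.
        replace (z + RtoC (t + s) * (om ^ j - z) - (z + t * (om ^ j - z)))%C
          with (s * (om ^ j - z))%C by (rewrite RtoC_plus; ring).
        rewrite Cmod_mult, Cmod_R, Rabs_pos_eq by easy.
        pose proof (Cmod_minus_le (om ^ j) z) as T. rewrite Cmod_om in T. nra. }
      apply Rmult_le_compat; try apply Cmod_ge_0; [|apply Cmod_kernel].
      eapply Rle_trans; [apply Hd; [apply Cmod_node; lra|lra]|].
      apply Rmult_le_compat_l; lra. }
    assert (B' := Cmod_csum_le _ _ N (fun j _ => B j)). cbv beta in B'.
    unfold Rdiv. lra.
  - intros j _.
    replace (f' (node t j) * om ^ j)%C with (f' (node t j) * (kernel j * (om ^ j - z)))%C
      by now rewrite kernel_node.
    replace (node (t + s) j - node t j)%C with (s * (om ^ j - z))%C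
      by (unfold node; rewrite RtoC_plus; ring).
    ring.
Qed.

Let A_total : Cmod (A 1 - A 0) <= INR N * (e * (1 + 2 / (1 - Cmod z))).
Proof.
  assert (d0 : 0 < d) by (pose proof (Cmod_ge_0 (om - 1)); lra).
  (* A time step [s] moves a node by at most [2 * s], so [m] steps of length [/ INR m < d / 2] stay
     within the range of the secant estimate; their errors add up linearly in time. *)
  destruct (archimed_cor1 (d / 2) ltac:(lra)) as [m [Hm Hm0]].
  assert (Hm' : 0 < INR m) by now apply lt_0_INR.
  set (K := INR N * (e * (1 + 2 / (1 - Cmod z)))).
  assert (H : forall i, (i <= m)%nat -> Cmod (A (INR i * / INR m) - A 0) <= INR i * / INR m * K).
  { induction i as [|i IH]; intros Hi.
    - simpl INR. rewrite !Rmult_0_l, Cmod_minus_diag. lra.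
    - eapply Rle_trans; [apply (Cmod_minus_triangle _ (A (INR i * / INR m)))|].
      specialize (IH ltac:(lia)).
      assert (P : Cmod (A (INR (S i) * / INR m) - A (INR i * / INR m)) <= / INR m * K).
      { rewrite S_INR, Rmult_plus_distr_r, Rmult_1_l. apply A_step.
        - apply Rmult_le_pos; [apply pos_INR|]. left. now apply Rinv_0_lt_compat.
        - left. now apply Rinv_0_lt_compat.
        - apply le_INR in Hi. rewrite S_INR in Hi.
          apply Rmult_le_reg_r with (INR m); [easy|].
          rewrite Rmult_plus_distr_r, Rmult_assoc, Rinv_l by lra. lra.
        - lra. }
      rewrite S_INR in P |- *. lra. }
  specialize (H m (Nat.le_refl m)). rewrite Rinv_r, Rmult_1_l in H by lra. exact H.
Qed.

(** With [v] the inverse of [om], this is the Riemann sum of the [n]-th Cauchy coefficient of [g] on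
    the unit circle. *)
Definition dft (g : C -> C) (om v : C) (N n : nat) : C :=
  (/ INR N * csum (fun j => g (om ^ j)%C * (v ^ j) ^ n) N)%C.

(** Multiplied by [1 - z ^ N], the endpoint [A 0] becomes [INR N * f z] and [A 1] becomes [INR N]
    times the polynomial with coefficients [dft]. The factor 2 bounds [|1 - z ^ N|]. *)
Lemma discrete_cauchy :
  Cmod (f z - csum (fun n => dft f om v N n * z ^ n)%C N)
    <= 2 * (e * (1 + 2 / (1 - Cmod z))).
Proof.
  assert (HN0 : 0 < INR N) by (apply lt_0_INR; lia).
  assert (HNC : RtoC (INR N) <> 0%C) by (intros K; apply RtoC_inj in K; lra).
  assert (E0 : ((1 - z ^ N) * A 0)%C = (INR N * f z)%C).
  { unfold A. rewrite (csum_ext _ (fun j => f z * kernel j)%C).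
    - rewrite csum_scal. replace ((1 - z ^ N) * (f z * csum kernel N))%C
        with (f z * ((1 - z ^ N) * csum kernel N))%C by ring.
      rewrite kernel_sum. ring.
    - intros j _. unfold node. now replace (z + 0 * (om ^ j - z))%C with z by ring. }
  assert (E1 : ((1 - z ^ N) * A 1)%C = (INR N * csum (fun n => dft f om v N n * z ^ n)%C N)%C).
  { unfold A. rewrite <- csum_scal.
    rewrite (csum_ext _ (fun j => csum (fun n => f (om ^ j)%C * (v ^ j) ^ n * z ^ n)%C N)).
    - rewrite csum_swap, <- csum_scal. apply csum_ext. intros n _. unfold dft.
      rewrite (csum_ext _ (fun j => z ^ n * (f (om ^ j)%C * (v ^ j) ^ n))%C)
        by (intros; ring).
      rewrite csum_scal. field. exact HNC.
    - intros j _.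
      replace (node 1 j) with (om ^ j)%C by (unfold node; ring).
      replace ((1 - z ^ N) * (f (om ^ j)%C * kernel j))%C
        with (f (om ^ j)%C * ((1 - z ^ N) * kernel j))%C by ring.
      rewrite kernel_geom, <- csum_scal. apply csum_ext. intros; ring. }
  apply Rmult_le_reg_l with (INR N); [easy|].
  replace (INR N * Cmod (f z - csum (fun n => dft f om v N n * z ^ n)%C N)) with
    (Cmod ((1 - z ^ N) * (A 1 - A 0))).
  - rewrite Cmod_mult. pose proof (Cmod_minus_le 1 (z ^ N)) as T.
    rewrite Cmod_1, Cmod_pow in T.
    assert (Cmod z ^ N <= 1).
    { rewrite <- (pow1 N). apply pow_incr. split; [apply Cmod_ge_0|lra]. }
    pose proof A_total.
    apply Rle_trans with (2 * (INR N * (e * (1 + 2 / (1 - Cmod z))))); [|lra].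
    apply Rmult_le_compat; try apply Cmod_ge_0; lra.
  - replace ((1 - z ^ N) * (A 1 - A 0))%C with ((1 - z ^ N) * A 1 - (1 - z ^ N) * A 0)%C by ring.
    rewrite E0, E1.
    rewrite Cmod_minus_sym, <- (Cmod_mult_INR N). f_equal. ring.
Qed.

End Discrete_Cauchy.

(** * Convergence of the discrete coefficients and the Cauchy expansion *)

Lemma pow_le_1 (x : R) (n : nat) : 0 <= x <= 1 -> x ^ n <= 1.
Proof. intros H. rewrite <- (pow1 n). now apply pow_incr. Qed.

Lemma Cmod_dft_le (g : C -> C) (om v : C) (N n : nat) (B : R) :
  (0 < N)%nat -> Cmod om = 1 -> Cmod v = 1 ->
  (forall x, Cmod x = 1 -> Cmod (g x) <= B) -> Cmod (dft g om v N n) <= B.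
Proof.
  intros HN Hom Hv HB. unfold dft.
  assert (HN0 : 0 < INR N) by (apply lt_0_INR; lia).
  rewrite Cmod_mult, Cmod_inv by (intros K; apply RtoC_inj in K; lra).
  rewrite Cmod_R, Rabs_pos_eq by lra.
  apply Rmult_le_reg_l with (INR N); [easy|]. rewrite <- Rmult_assoc, Rinv_r, Rmult_1_l by lra.
  apply Cmod_csum_le. intros j _.
  rewrite Cmod_mult, !Cmod_pow, Hv, !pow1, Rmult_1_r. apply HB.
  rewrite Cmod_pow, Hom. apply pow1.
Qed.

Lemma csum_double (u : nat -> C) (N : nat) :
  csum u (2 * N) = csum (fun j => u (2 * j)%nat + u (S (2 * j)))%C N.
Proof.
  induction N as [|N IH]; [easy|].
  replace (2 * S N)%nat with (S (S (2 * N))) by lia.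
  change (csum u (S (S (2 * N)))) with (csum u (2 * N) + u (2 * N)%nat + u (S (2 * N)))%C.
  rewrite IH. cbn [csum]. ring.
Qed.

Lemma C_pow_double (x : C) (n : nat) : (x ^ (2 * n))%C = ((x * x) ^ n)%C.
Proof. rewrite Cpow_mult_l, <- Cpow_add_r. f_equal. lia. Qed.

(** Each odd vertex [om * w j] is compared with its even neighbour [w j]: moving the argument of [g]
    costs the Lipschitz constant, turning the character by [v ^ n] costs [INR n * B]. Both are
    proportional to the step [|om - 1|], hence summable over successive doublings. *)
Lemma dft_double (g : C -> C) (om v : C) (N n : nat) (B L : R) :
  (0 < N)%nat -> Cmod om = 1 -> (om * v)%C = 1%C ->
  (forall x, Cmod x = 1 -> Cmod (g x) <= B) ->
  (forall x y, Cmod x <= 1 -> Cmod y <= 1 -> Cmod (g y - g x) <= L * Cmod (y - x)) ->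
  Cmod (dft g om v (2 * N) n - dft g (om * om) (v * v) N n)
    <= (L + INR n * B) / 2 * Cmod (om - 1).
Proof.
  intros HN Hom Homv HB HL.
  assert (Hv : Cmod v = 1).
  { pose proof (f_equal Cmod Homv) as H. rewrite Cmod_mult, Hom, Cmod_1 in H. lra. }
  assert (HN0 : 0 < INR N) by (apply lt_0_INR; lia).
  assert (HNC : RtoC (INR N) <> 0%C) by (intros K; apply RtoC_inj in K; lra).
  assert (H2 : RtoC 2 <> 0%C) by (intros K; apply RtoC_inj in K; lra).
  set (w := fun j => ((om * om) ^ j)%C). set (t := fun j => ((v * v) ^ j)%C).
  assert (E : (dft g om v (2 * N) n - dft g (om * om) (v * v) N n)%C =
    (/ (2 * INR N) * csum (fun j => (g (om * w j) - g (w j)) * (v * t j) ^ n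
       + g (w j) * ((v ^ n - 1) * t j ^ n)) N)%C).
  { unfold dft. rewrite csum_double, mult_INR, RtoC_mult.
    rewrite (csum_ext _ (fun j => g (w j) * t j ^ n + g (om * w j) * (v * t j) ^ n)%C).
    2:{ intros j _. unfold w, t. now rewrite <- !C_pow_double. }
    rewrite (csum_ext (fun j => (g (om * w j) - g (w j)) * _ + _)%C
      (fun j => (g (w j) * t j ^ n + g (om * w j) * (v * t j) ^ n)
                - 2 * (g (w j) * t j ^ n))%C).
    2:{ intros j _. rewrite Cpow_mult_l. ring. }
    rewrite csum_minus, csum_scal. simpl (INR 2). fold w.
    replace (csum (fun j => g ((om * om) ^ j) * ((v * v) ^ j) ^ n)%C N)
      with (csum (fun j => g (w j) * t j ^ n)%C N) by reflexivity.
    replace (1 + 1) with 2 by ring. field. exact HNC. }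
  rewrite E, Cmod_mult, Cmod_inv, Cmod_mult, !Cmod_R, !Rabs_pos_eq by
    (try lra; now apply Cmult_neq_0).
  assert (V : Cmod (v ^ n - 1) <= INR n * Cmod (om - 1)).
  { pose proof (Cmod_pow_minus_le 1 v 1 n) as P.
    rewrite Cpow_1_l, pow1, Rmult_1_r, Hv, Cmod_1 in P.
    replace (Cmod (om - 1)) with (Cmod (v - 1)); [apply P; lra|].
    replace (v - 1)%C with (- (v * (om - 1)))%C.
    - rewrite Cmod_opp, Cmod_mult, Hv. ring.
    - replace (v * (om - 1))%C with (om * v - v)%C by ring. rewrite Homv. ring. }
  apply Rmult_le_reg_l with (2 * INR N); [lra|].
  rewrite <- Rmult_assoc, Rinv_r, Rmult_1_l by lra.
  replace (2 * INR N * ((L + INR n * B) / 2 * Cmod (om - 1)))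
    with (INR N * ((L + INR n * B) * Cmod (om - 1))) by field.
  apply Cmod_csum_le. intros j _.
  assert (Hw : Cmod (w j) = 1).
  { unfold w. rewrite Cmod_pow, Cmod_mult, Hom, Rmult_1_l. apply pow1. }
  assert (Ht : Cmod (t j) = 1).
  { unfold t. rewrite Cmod_pow, Cmod_mult, Hv, Rmult_1_l. apply pow1. }
  eapply Rle_trans; [apply Cmod_triangle|].
  rewrite !Cmod_mult, !Cmod_pow, Cmod_mult, Hv, Ht, Rmult_1_r, !pow1, !Rmult_1_r.
  specialize (HL (w j) (om * w j)%C). rewrite Cmod_mult, Hom, Hw in HL.
  specialize (HL ltac:(lra) ltac:(lra)).
  replace (om * w j - w j)%C with ((om - 1) * w j)%C in HL by ring.
  rewrite Cmod_mult, Hw in HL.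
  assert (Cmod (g (w j)) * Cmod (v ^ n - 1) <= B * (INR n * Cmod (om - 1))).
  { apply Rmult_le_compat; try apply Cmod_ge_0; auto. }
  lra.
Qed.

Lemma csum_lim (a : nat -> nat -> C) (c : nat -> C) (z : C) (m : nat) :
  Cmod z <= 1 ->
  (forall n e, 0 < e -> exists K, forall k, (K <= k)%nat -> Cmod (a k n - c n) < e) ->
  forall e, 0 < e -> exists K, forall k, (K <= k)%nat ->
    Cmod (csum (fun n => a k n * z ^ n)%C m - csum (fun n => c n * z ^ n)%C m) < e.
Proof.
  intros Hz H. induction m as [|m IH]; intros e He.
  - exists O. intros k _. simpl. rewrite Cmod_minus_diag. lra.
  - destruct (IH (e / 2) ltac:(lra)) as [K1 H1]. destruct (H m (e / 2) ltac:(lra)) as [K2 H2].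
    exists (K1 + K2)%nat. intros k Hk. simpl.
    specialize (H1 k ltac:(lia)). specialize (H2 k ltac:(lia)).
    set (s1 := csum (fun n => a k n * z ^ n)%C m) in *.
    set (s2 := csum (fun n => c n * z ^ n)%C m) in *.
    replace (s1 + a k m * z ^ m - (s2 + c m * z ^ m))%C
      with ((s1 - s2) + (a k m - c m) * z ^ m)%C by ring.
    eapply Rle_lt_trans; [apply Cmod_triangle|]. rewrite Cmod_mult, Cmod_pow.
    assert (Cmod z ^ m <= 1) by (apply pow_le_1; split; [apply Cmod_ge_0|easy]).
    pose proof (Cmod_ge_0 (a k m - c m)). pose proof (pow_le _ m (Cmod_ge_0 z)). nra.
Qed.

(* The averages of [f] over the vertices of regular [2^k]-gons play the role of
   Cauchy's integral. *)
Section Dyadic.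

Variables (f f' : C -> C) (s B : R).
Hypothesis Hs : 1 < s.
Hypothesis Hf : forall x, Cmod x < s -> strict_derive f x (f' x).
Hypothesis HB : forall x, Cmod x = 1 -> Cmod (f x) <= B.

Let ang (k : nat) : R := 2 * PI * (1 / 2) ^ k.
Let coef (k n : nat) : C := dft f (cis (ang k)) (cis (- ang k)) (2 ^ k) n.

Let ang_pos (k : nat) : 0 < ang k.
Proof.
  unfold ang. pose proof PI_RGT_0. apply Rmult_lt_0_compat; [lra|]. apply pow_lt. lra.
Qed.

Let ang_S (k : nat) : ang (S k) <= PI.
Proof.
  unfold ang. simpl. pose proof PI_RGT_0.
  assert ((1 / 2) ^ k <= 1) by (apply pow_le_1; lra). nra.
Qed.

Let ang_double (k : nat) : ang k = ang (S k) + ang (S k).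
Proof. unfold ang. simpl. field. Qed.

Let cis_ang_inv (k : nat) : (cis (ang k) * cis (- ang k))%C = 1%C.
Proof. rewrite <- cis_add, Rplus_opp_r. apply cis_0. Qed.

Let ang_turn (k : nat) : INR (2 ^ k) * ang k = 2 * PI.
Proof.
  unfold ang. rewrite pow_INR. replace (INR 2) with 2 by easy.
  replace (2 ^ k * (2 * PI * (1 / 2) ^ k)) with (2 * PI * (2 ^ k * (1 / 2) ^ k)) by ring.
  rewrite <- Rpow_mult_distr. replace (2 * (1 / 2)) with 1 by field. rewrite pow1. ring.
Qed.

(** By [dft_double] successive coefficients differ by a multiple of [(1 / 2) ^ k], so the limit is
    the sum of a telescoping series; the uniform bound [B] survives in the limit. *)
Let coef_lim : exists c : nat -> C, (forall n, Cmod (c n) <= B) /\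
  forall n e, 0 < e -> exists K, forall k, (K <= k)%nat -> Cmod (coef k n - c n) < e.
Proof.
  destruct (holomorphic_lipschitz f f' 1 s Hs Hf) as [L [HL0 HL]].
  assert (HB0 : 0 <= B).
  { eapply Rle_trans; [apply Cmod_ge_0|apply (HB 1); apply Cmod_1]. }
  set (D := fun n => (L + INR n * B) / 2 * PI).
  assert (HD0 : forall n, 0 <= D n).
  { intros n. unfold D. pose proof PI_RGT_0. pose proof (Rmult_le_pos _ _ (pos_INR n) HB0).
    apply Rmult_le_pos; lra. }
  assert (Hdiff : forall n k, Cmod (coef (S k) n - coef k n) <= D n * (1 / 2) ^ k).
  { intros n k. unfold coef.
    replace (cis (ang k)) with (cis (ang (S k)) * cis (ang (S k)))%C
      by (rewrite <- cis_add, <- ang_double; easy).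
    replace (cis (- ang k)) with (cis (- ang (S k)) * cis (- ang (S k)))%C
      by (rewrite <- cis_add; f_equal; rewrite (ang_double k); ring).
    rewrite Nat.pow_succ_r'.
    eapply Rle_trans; [apply (dft_double f _ _ _ n B L)|]; auto.
    - apply Nat.neq_0_lt_0, Nat.pow_nonzero. lia.
    - apply Cmod_cis.
    - pose proof (Cmod_cis_minus_1 (ang (S k)) (conj (ang_pos _) (ang_S k))) as P.
      unfold D. rewrite Rmult_assoc. apply Rmult_le_compat_l.
      + pose proof (Rmult_le_pos _ _ (pos_INR n) HB0). lra.
      + eapply Rle_trans; [exact P|]. unfold ang. simpl. right. field. }
  assert (Hl : forall n, exists l, sums (fun k => coef (S k) n - coef k n)%C l).
  { intros n. apply (ex_sums_geom _ (D n) (1 / 2)); [lra|apply Hdiff]. }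
  apply choice in Hl. destruct Hl as [l Hl].
  assert (Hlim : forall n e, 0 < e -> exists K, forall k, (K <= k)%nat ->
            Cmod (coef k n - (coef 0 n + l n)) < e).
  { intros n e He. destruct (Hl n e He) as [K HK]. exists K. intros k Hk.
    specialize (HK k Hk). rewrite (csum_telescope (fun k => coef k n)) in HK.
    now replace (coef k n - (coef 0 n + l n))%C with (coef k n - coef 0 n - l n)%C by ring. }
  exists (fun n => coef 0 n + l n)%C. split; [|exact Hlim].
  intros n. apply Rle_of_le_mult_eps with 1; [lra|]. intros e He.
  destruct (Hlim n e He) as [K HK]. specialize (HK K (Nat.le_refl K)).
  pose proof (Cmod_le_minus (coef 0 n + l n)%C (coef K n)) as T. rewrite Cmod_minus_sym in T.
  assert (Cmod (coef K n) <= B).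
  { unfold coef. apply Cmod_dft_le; auto; try apply Cmod_cis.
    apply Nat.neq_0_lt_0, Nat.pow_nonzero. lia. }
  lra.
Qed.

(** The truncation order [m] is fixed before the polygon is refined. The uniform bound [B] on the
    coefficients controls the discrete polynomial beyond order [m] geometrically, so letting [e]
    tend to 0 leaves a tail bound that depends on [m] alone. *)
Lemma cauchy_expansion_unit :
  exists c : nat -> C, (forall n, Cmod (c n) <= B) /\
    forall z, Cmod z < 1 -> sums (fun n => c n * z ^ n)%C (f z).
Proof.
  destruct coef_lim as [c [Hc Hlim]]. exists c. split; [easy|]. intros z Hz.
  pose proof (Cmod_ge_0 z) as Pz.
  assert (Q : 0 < / (1 - Cmod z)) by (apply Rinv_0_lt_compat; lra).
  assert (HB0 : 0 <= B).
  { eapply Rle_trans; [apply Cmod_ge_0|apply (HB 1); apply Cmod_1]. }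
  assert (Htail : forall m, Cmod (f z - csum (fun n => c n * z ^ n)%C m)
                    <= B * Cmod z ^ m / (1 - Cmod z)).
  { intros m. apply Rle_of_le_mult_eps with (2 * (1 + 2 / (1 - Cmod z)) + 1).
    { unfold Rdiv. lra. }
    intros e He.
    destruct (uniform_strict_derive f f' 1 s Hs Hf e He) as [d [Hd Hunif]].
    destruct (csum_lim coef c z m ltac:(lra) Hlim e He) as [K1 HK1].
    destruct (pow_lt_1_zero (1 / 2) ltac:(rewrite Rabs_pos_eq; lra) (d / (2 * PI)))
      as [K2 HK2].
    { apply Rdiv_lt_0_compat; [lra|]. pose proof PI_RGT_0. lra. }
    (* [K1] makes the first [m] coefficients accurate, [K2] makes the angle smaller than [d], [m]
       ensures [m <= 2 ^ k], and the final 1 gives at least two vertices and an angle of at most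
       [PI]. *)
    set (k := (K1 + K2 + m + 1)%nat).
    specialize (HK1 k ltac:(lia)). specialize (HK2 k ltac:(lia)).
    assert (Hk : (k < 2 ^ k)%nat) by (apply Nat.pow_gt_lin_r; lia).
    assert (Hang : ang k < d).
    { rewrite Rabs_pos_eq in HK2 by (apply pow_le; lra). pose proof PI_RGT_0.
      unfold ang. apply (Rmult_lt_compat_l (2 * PI)) in HK2; [|lra].
      replace (2 * PI * (d / (2 * PI))) with d in HK2 by (field; lra). lra. }
    pose proof (discrete_cauchy f f' e d He Hunif (2 ^ k) (cis (ang k)) (cis (- ang k))) as DC.
    specialize (DC ltac:(lia) (Cmod_cis _) (cis_ang_inv k)).
    specialize (DC ltac:(rewrite cis_pow, ang_turn; apply cis_2PI)).
    specialize (fun h1 h2 => DC h1 h2 z Hz).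
    fold (coef k) in DC.
    assert (DC' : Cmod (f z - csum (fun n => coef k n * z ^ n)%C (2 ^ k)) <=
         2 * (e * (1 + 2 / (1 - Cmod z)))).
    { apply DC.
      - intros n [Hn0 Hn] E. rewrite cis_pow in E.
        apply (cis_neq_1 (INR n * ang k)).
        + pose proof (ang_pos k). pose proof (lt_0_INR n Hn0). apply lt_INR in Hn.
          split; [nra|]. rewrite <- (ang_turn k). nra.
        + pose proof (cis_add (INR n * ang k) (INR n * - ang k)) as P.
          rewrite E, Cmult_1_r in P. rewrite <- P.
          replace (INR n * ang k + INR n * - ang k) with 0 by ring. apply cis_0.
      - eapply Rle_lt_trans; [apply Cmod_cis_minus_1|exact Hang].
        split; [apply ang_pos|]. unfold k. rewrite Nat.add_1_r. apply ang_S. }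
    assert (T : Cmod (csum (fun n => coef k n * z ^ n)%C (m + (2 ^ k - m))
                      - csum (fun n => coef k n * z ^ n)%C m)
                <= B * Cmod z ^ m / (1 - Cmod z)).
    { apply csum_geom_tail_le; [lra|]. intros n. rewrite Cmod_mult, Cmod_pow.
      apply Rmult_le_compat_r; [now apply pow_le|].
      unfold coef. apply Cmod_dft_le; auto; try apply Cmod_cis. lia. }
    replace (m + (2 ^ k - m))%nat with (2 ^ k)%nat in T by lia.
    set (F := csum (fun n => coef k n * z ^ n)%C (2 ^ k)) in *.
    set (Fm := csum (fun n => coef k n * z ^ n)%C m) in *.
    pose proof (Cmod_minus_triangle (f z) F (csum (fun n => c n * z ^ n)%C m)).
    pose proof (Cmod_minus_triangle F Fm (csum (fun n => c n * z ^ n)%C m)).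
    lra. }
  intros e He.
  destruct (pow_lt_1_zero (Cmod z) ltac:(rewrite Rabs_pos_eq; lra) (e * (1 - Cmod z) / (B + 1)))
    as [K HK].
  { apply Rdiv_lt_0_compat; [apply Rmult_lt_0_compat|]; lra. }
  exists K. intros n Hn. specialize (HK n Hn). rewrite Rabs_pos_eq in HK by now apply pow_le.
  rewrite Cmod_minus_sym. eapply Rle_lt_trans; [apply Htail|].
  apply Rmult_lt_reg_r with (1 - Cmod z); [lra|].
  unfold Rdiv at 1. rewrite Rmult_assoc, Rinv_l, Rmult_1_r by lra.
  apply (Rmult_lt_compat_l (B + 1)) in HK; [|lra].
  replace ((B + 1) * (e * (1 - Cmod z) / (B + 1))) with (e * (1 - Cmod z)) in HK by (field; lra).
  pose proof (pow_le _ n Pz). lra.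
Qed.

End Dyadic.

(** Rescaling to the unit circle. The bound [B] is required on the circle [|x - z0| = r] only, which
    is what makes the coefficient estimate strong enough for the maximum principle. *)
Lemma cauchy_expansion (f f' : C -> C) (z0 : C) (r s B : R) :
  0 < r < s -> (forall x, Cmod (x - z0) < s -> strict_derive f x (f' x)) ->
  (forall x, Cmod (x - z0) = r -> Cmod (f x) <= B) ->
  exists c : nat -> C, (forall n, Cmod (c n) * r ^ n <= B) /\
    forall z, Cmod (z - z0) < r -> sums (fun n => c n * (z - z0) ^ n)%C (f z).
Proof.
  intros Hr Hf HB.
  assert (Hr0 : RtoC r <> 0%C) by (intros K; apply RtoC_inj in K; lra).
  assert (Em : forall x, Cmod (z0 + r * x - z0) = r * Cmod x).
  { intros x. replace (z0 + r * x - z0)%C with (r * x)%C by ring.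
    rewrite Cmod_mult, Cmod_R, Rabs_pos_eq; lra. }
  destruct (cauchy_expansion_unit (fun x => f (z0 + r * x)%C)
    (fun x => f' (z0 + r * x) * (0 + (0 * x + r * 1)))%C (s / r) B) as [c [Hc Hsum]].
  - apply Rmult_lt_reg_r with r; [lra|]. unfold Rdiv. rewrite Rmult_assoc, Rinv_l; lra.
  - intros x Hx. apply (strict_derive_comp (fun x => z0 + r * x)%C f).
    + apply (strict_derive_plus (fun _ => z0) (fun x => r * x)%C); [apply strict_derive_const|].
      apply (strict_derive_mult (fun _ => RtoC r) (fun x => x));
        [apply strict_derive_const|apply strict_derive_id].
    + apply Hf. rewrite Em.
      apply (Rmult_lt_compat_l r) in Hx; [|lra].
      replace (r * (s / r)) with s in Hx by (field; lra). exact Hx.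
  - intros x Hx. apply HB. rewrite Em, Hx. ring.
  - exists (fun n => c n / r ^ n)%C. split.
    + intros n. rewrite Cmod_div, Cmod_pow, Cmod_R, Rabs_pos_eq by (try lra; now apply Cpow_nz).
      replace (Cmod (c n) / r ^ n * r ^ n) with (Cmod (c n)) by (field; apply pow_nonzero; lra).
      apply Hc.
    + intros z Hz. specialize (Hsum ((z - z0) / r)%C).
      replace (z0 + r * ((z - z0) / r))%C with z in Hsum by (field; exact Hr0).
      apply sums_ext with (fun n => c n * ((z - z0) / r) ^ n)%C.
      * intros n. unfold Cdiv. rewrite Cpow_mult_l.
        rewrite Cpow_inv by easy. ring.
      * apply Hsum. rewrite Cmod_div, Cmod_R, Rabs_pos_eq by (try lra; easy).
        apply Rmult_lt_reg_r with r; [lra|]. unfold Rdiv. rewrite Rmult_assoc, Rinv_l; lra.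
Qed.

Lemma holomorphic_PSum (f f' : C -> C) (z0 : C) (r s : R) :
  0 < r < s -> (forall x, Cmod (x - z0) < s -> strict_derive f x (f' x)) ->
  exists c, radius_ge c r /\ forall z, Cmod (z - z0) < r -> f z = PSum c (z - z0).
Proof.
  intros Hr Hf.
  destruct (continuous_bounded f z0 r) as [B [_ HB]].
  { intros x Hx. apply strict_derive_continuous with (f' x). apply Hf. lra. }
  destruct (cauchy_expansion f f' z0 r s B Hr Hf) as [c [Hc Hsum]].
  { intros x Hx. apply HB. lra. }
  exists c. split.
  - intros t Ht. exists B. intros n. eapply Rle_trans; [|apply Hc].
    apply Rmult_le_compat_l; [apply Cmod_ge_0|]. apply pow_incr. lra.
  - intros z Hz. symmetry. apply PSum_unique. now apply Hsum.
Qed.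

(* Applied to all powers [f^n], the crude bound of the Cauchy expansion
   self-improves to the maximum principle. *)
Lemma maximum_modulus (f f' : C -> C) (r s B : R) (z : C) :
  0 < r < s -> (forall x, Cmod x < s -> strict_derive f x (f' x)) ->
  (forall x, Cmod x = r -> Cmod (f x) <= B) ->
  Cmod z < r -> Cmod (f z) <= B.
Proof.
  intros Hr Hf HB Hz.
  assert (HB0 : 0 <= B).
  { eapply Rle_trans; [apply Cmod_ge_0|apply (HB r)]. rewrite Cmod_R, Rabs_pos_eq; lra. }
  set (q := Cmod z / r).
  assert (Hq : 0 <= q < 1).
  { unfold q. split; [apply Rmult_le_pos; [apply Cmod_ge_0|left; apply Rinv_0_lt_compat; lra]|].
    apply Rmult_lt_reg_r with r; [lra|]. unfold Rdiv. rewrite Rmult_assoc, Rinv_l; lra. }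
  assert (Hpow : forall n, Cmod (f z) ^ n <= B ^ n / (1 - q)).
  { intros n.
    destruct (cauchy_expansion (fun x => f x ^ n)%C (fun x => INR n * f x ^ (n - 1) * f' x)%C
      0 r s (B ^ n) Hr) as [c [Hc Hsum]].
    - intros x Hx. replace (x - 0)%C with x in Hx by ring. now apply strict_derive_pow, Hf.
    - intros x Hx. replace (x - 0)%C with x in Hx by ring. rewrite Cmod_pow.
      apply pow_incr. split; [apply Cmod_ge_0|now apply HB].
    - specialize (Hsum z). replace (z - 0)%C with z in Hsum by ring. specialize (Hsum Hz).
      rewrite <- Cmod_pow. apply (sums_geom_le _ (B ^ n) q Hq) with (2 := Hsum).
      intros m. rewrite Cmod_mult, Cmod_pow.
      replace (Cmod z) with (r * q) by (unfold q; field; lra). rewrite Rpow_mult_distr.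
      rewrite <- Rmult_assoc. apply Rmult_le_compat_r; [now apply pow_le|apply Hc]. }
  apply Rnot_lt_le. intros hlt.
  destruct (Rle_lt_or_eq_dec 0 B HB0) as [HBp|<-].
  - destruct (pow_lt_1_zero (B / Cmod (f z))) with (1 - q) as [n Hn].
    + rewrite Rabs_pos_eq.
      * apply Rmult_lt_reg_r with (Cmod (f z)); [lra|].
        unfold Rdiv. rewrite Rmult_assoc, Rinv_l; lra.
      * apply Rmult_le_pos; [lra|]. left. apply Rinv_0_lt_compat. lra.
    + lra.
    + specialize (Hn n (Nat.le_refl n)). specialize (Hpow n).
      assert (P : 0 < Cmod (f z) ^ n) by (apply pow_lt; lra).
      rewrite Rabs_pos_eq in Hn.
      * unfold Rdiv in Hn. rewrite Rpow_mult_distr, pow_inv in Hn.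
        apply (Rmult_lt_compat_r (Cmod (f z) ^ n)) in Hn; [|easy].
        rewrite Rmult_assoc, Rinv_l in Hn by lra.
        apply (Rmult_le_compat_r (1 - q)) in Hpow; [|lra].
        unfold Rdiv in Hpow. rewrite Rmult_assoc, Rinv_l in Hpow; lra.
      * apply pow_le. apply Rmult_le_pos; [lra|]. left. apply Rinv_0_lt_compat. lra.
  - specialize (Hpow 1%nat). simpl in Hpow. rewrite !Rmult_1_r in Hpow.
    unfold Rdiv in Hpow. lra.
Qed.

(** * Local inverses *)

(** The tolerance [|a| / 2] yields two-sided Lipschitz bounds for [q] and the contraction ratio 1/2
    for Newton's iteration with slope [a]. *)
Definition near_linear (q : C -> C) (zeta a : C) (d : R) : Prop :=
  forall x y, Cmod (x - zeta) < d -> Cmod (y - zeta) < d ->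
    Cmod (q x - q y - a * (x - y)) <= Cmod a / 2 * Cmod (x - y).

Lemma near_linear_ge (q : C -> C) (zeta a : C) (d : R) (x y : C) :
  near_linear q zeta a d -> Cmod (x - zeta) < d -> Cmod (y - zeta) < d ->
  Cmod a / 2 * Cmod (x - y) <= Cmod (q x - q y).
Proof.
  intros H Hx Hy. specialize (H x y Hx Hy).
  pose proof (Cmod_le_minus (a * (x - y)) (q x - q y)) as T.
  rewrite Cmod_minus_sym, Cmod_mult in T. lra.
Qed.

Lemma near_linear_le (q : C -> C) (zeta a : C) (d : R) (x y : C) :
  near_linear q zeta a d -> Cmod (x - zeta) < d -> Cmod (y - zeta) < d ->
  Cmod (q x - q y) <= 2 * Cmod a * Cmod (x - y).
Proof.
  intros H Hx Hy. specialize (H x y Hx Hy).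
  pose proof (Cmod_le_minus (q x - q y) (a * (x - y))) as T. rewrite Cmod_mult in T.
  pose proof (Rmult_le_pos _ _ (Cmod_ge_0 a) (Cmod_ge_0 (x - y))). lra.
Qed.

Lemma near_linear_inj (q : C -> C) (zeta a : C) (d : R) (x y : C) :
  a <> 0%C -> near_linear q zeta a d -> Cmod (x - zeta) < d -> Cmod (y - zeta) < d ->
  q x = q y -> x = y.
Proof.
  intros Ha H Hx Hy E. pose proof (near_linear_ge q zeta a d x y H Hx Hy) as G.
  rewrite E, Cmod_minus_diag in G. apply Cmod_gt_0 in Ha.
  apply Cminus_eq_0, Cmod_eq_0. pose proof (Cmod_ge_0 (x - y)). nra.
Qed.

(* Newton's iteration with the frozen slope [a]. *)
Lemma local_inverse (q : C -> C) (zeta a : C) (rho : R) :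
  strict_derive q zeta a -> a <> 0%C -> 0 < rho ->
  exists d eta, 0 < d <= rho /\ 0 < eta /\ near_linear q zeta a d /\
    forall y, Cmod (y - q zeta) < eta -> exists x, Cmod (x - zeta) <= d / 2 /\ q x = y.
Proof.
  intros Hq Ha Hrho. pose proof Ha as Ha'. apply Cmod_gt_0 in Ha'.
  destruct (Hq (Cmod a / 2) ltac:(lra)) as [d0 [Hd0 Hlin]].
  destruct (Rmin_pos_lt d0 rho Hd0 Hrho) as [h1 [h2 h3]]. set (d := Rmin d0 rho) in *.
  assert (NL : near_linear q zeta a d) by (intros x y Hx Hy; apply Hlin; lra).
  (* The first Newton step is at most [eta / |a| = d / 4] long and the steps halve, so all iterates
     stay within [d / 2] of [zeta], well inside the ball of the estimate. *)
  exists d, (Cmod a * d / 4). split; [lra|]. split.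
  { apply Rmult_lt_0_compat; [apply Rmult_lt_0_compat|]; lra. }
  split; [easy|]. intros y Hy. set (eta := Cmod a * d / 4) in *.
  set (x := fun n => Nat.iter n (fun t => t - (q t - y) / a)%C zeta).
  assert (HM : eta / Cmod a = d / 4) by (unfold eta; field; lra).
  assert (step : forall n, (x (S n) - x n)%C = (- ((q (x n) - y) / a))%C)
    by (intros n; simpl; ring).
  assert (Cstep : forall n, Cmod (x (S n) - x n) = Cmod (q (x n) - y) / Cmod a).
  { intros n. rewrite step, Cmod_opp. now apply Cmod_div. }
  assert (I : forall n, Cmod (q (x n) - y) <= eta * (1 / 2) ^ n /\
                        Cmod (x n - zeta) <= d / 2 * (1 - (1 / 2) ^ n)).
  { induction n as [|n [IH1 IH2]].
    - simpl. rewrite Cmod_minus_diag, Cmod_minus_sym. lra.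
    - assert (Hp : 0 < (1 / 2) ^ n) by (apply pow_lt; lra).
      assert (Hx' : Cmod (x (S n) - x n) <= d / 4 * (1 / 2) ^ n).
      { rewrite Cstep, <- HM. unfold Rdiv in *.
        replace (eta * / Cmod a * (1 * / 2) ^ n) with (eta * (1 * / 2) ^ n * / Cmod a) by ring.
        apply Rmult_le_compat_r; [left; now apply Rinv_0_lt_compat|exact IH1]. }
      assert (Hx2 : Cmod (x (S n) - zeta) <= d / 2 * (1 - (1 / 2) ^ S n)).
      { pose proof (Cmod_minus_triangle (x (S n)) (x n) zeta). simpl pow. nra. }
      split; [|exact Hx2].
      assert (Hp' : 0 < (1 / 2) ^ S n) by (apply pow_lt; lra).
      replace (q (x (S n)) - y)%C with (q (x (S n)) - q (x n) - a * (x (S n) - x n))%C.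
      + eapply Rle_trans; [apply NL; nra|]. rewrite Cstep.
        replace (Cmod a / 2 * (Cmod (q (x n) - y) / Cmod a)) with (Cmod (q (x n) - y) / 2)
          by (field; lra).
        simpl pow. lra.
      + rewrite step. field. exact Ha. }
  destruct (ex_sums_geom (fun n => x (S n) - x n)%C (d / 4) (1 / 2)) as [l Hl].
  - lra.
  - intros n. rewrite Cstep, <- HM. destruct (I n) as [I1 _]. unfold Rdiv in *.
    replace (eta * / Cmod a * (1 * / 2) ^ n) with (eta * (1 * / 2) ^ n * / Cmod a) by ring.
    apply Rmult_le_compat_r; [left; now apply Rinv_0_lt_compat|exact I1].
  - assert (Hlb : Cmod l <= d / 2).
    { apply Rle_of_le_mult_eps with 1; [lra|]. intros e He. destruct (Hl e He) as [N HN].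
      specialize (HN N (Nat.le_refl N)). rewrite csum_telescope in HN.
      destruct (I N) as [_ I2]. simpl (x O) in HN.
      assert (Hp : 0 < (1 / 2) ^ N) by (apply pow_lt; lra).
      pose proof (Cmod_le_minus l (x N - zeta)) as T. rewrite Cmod_minus_sym in T. nra. }
    exists (zeta + l)%C. replace (zeta + l - zeta)%C with l by ring. split; [easy|].
    apply Ceq_of_Cmod_lt. intros e He.
    assert (He' : 0 < e / 2 / (2 * Cmod a)) by (apply Rdiv_lt_0_compat; lra).
    destruct (Hl _ He') as [N1 HN1].
    assert (Heta : 0 < eta) by (unfold eta; apply Rmult_lt_0_compat; [nra|lra]).
    destruct (pow_lt_1_zero (1 / 2) ltac:(rewrite Rabs_pos_eq; lra) (e / 2 / eta)) as [N2 HN2].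
    { apply Rdiv_lt_0_compat; lra. }
    set (n := (N1 + N2)%nat).
    specialize (HN1 n ltac:(lia)). specialize (HN2 n ltac:(lia)).
    rewrite csum_telescope in HN1. simpl (x O) in HN1.
    assert (Hp : 0 < (1 / 2) ^ n) by (apply pow_lt; lra).
    rewrite Rabs_pos_eq in HN2 by lra.
    destruct (I n) as [I1 I2].
    pose proof (Cmod_minus_triangle (q (zeta + l)%C) (q (x n)) y) as T.
    pose proof (near_linear_le q zeta a d (zeta + l)%C (x n) NL) as LE.
    replace (zeta + l - zeta)%C with l in LE by ring.
    specialize (LE ltac:(lra) ltac:(nra)).
    replace (zeta + l - x n)%C with (- (x n - zeta - l))%C in LE by ring.
    rewrite Cmod_opp in LE.
    apply (Rmult_lt_compat_l (2 * Cmod a)) in HN1; [|lra].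
    replace (2 * Cmod a * (e / 2 / (2 * Cmod a))) with (e / 2) in HN1 by (field; lra).
    apply (Rmult_lt_compat_l eta) in HN2; [|lra].
    replace (eta * (e / 2 / eta)) with (e / 2) in HN2 by (field; lra).
    lra.
Qed.

(** A vanishing derivative would give short secants below the lower Lipschitz bound [|a| / 2]. *)
Lemma near_linear_derive_neq_0 (q : C -> C) (zeta a x b : C) (d : R) :
  a <> 0%C -> near_linear q zeta a d -> Cmod (x - zeta) < d -> strict_derive q x b -> b <> 0%C.
Proof.
  intros Ha NL Hx Hb E. subst b. apply Cmod_gt_0 in Ha.
  destruct (Hb (Cmod a / 4) ltac:(lra)) as [d' [Hd' H]].
  destruct (Rmin_pos_lt d' (d - Cmod (x - zeta)) Hd' ltac:(lra)) as [k1 [k2 k3]].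
  set (s := Rmin d' (d - Cmod (x - zeta))) in *.
  set (y := (x + RtoC (s / 2))%C).
  assert (Hy : Cmod (y - x) = s / 2).
  { unfold y. replace (x + RtoC (s / 2) - x)%C with (RtoC (s / 2)) by ring.
    rewrite Cmod_R. apply Rabs_pos_eq. lra. }
  pose proof (Cmod_minus_triangle y x zeta).
  specialize (H y x ltac:(lra) ltac:(rewrite Cmod_minus_diag; lra)).
  pose proof (near_linear_ge q zeta a d y x NL ltac:(lra) Hx) as G.
  replace (q y - q x - 0 * (y - x))%C with (q y - q x)%C in H by ring.
  rewrite Hy in *. nra.
Qed.

(** Continuity of [w] is not a premise: confined to a ball where [q] has a lower Lipschitz bound,
    [w] inherits an upper one from [p], and then the secants of [q] at [w z1] can be solved for
    those of [w]. *)
Lemma strict_derive_lift (q p w : C -> C) (zeta a z1 b a1 : C) (d r : R) :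
  a <> 0%C -> near_linear q zeta a d -> 0 < r ->
  (forall z, Cmod (z - z1) < r -> Cmod (w z - zeta) < d /\ q (w z) = p z) ->
  strict_derive p z1 b -> strict_derive q (w z1) a1 ->
  strict_derive w z1 (b / a1).
Proof.
  intros Ha NL Hr Hw Hp Hq.
  destruct (Hw z1 ltac:(rewrite Cmod_minus_diag; lra)) as [Hw1 _].
  pose proof (near_linear_derive_neq_0 q zeta a (w z1) a1 d Ha NL Hw1 Hq) as Ha1.
  pose proof Ha1 as Pa1. apply Cmod_gt_0 in Pa1. pose proof Ha as Pa. apply Cmod_gt_0 in Pa.
  destruct (strict_derive_lipschitz p z1 b Hp) as [d1 [Hd1 HL]].
  set (K := (Cmod b + 1) * 2 / Cmod a).
  pose proof (Cmod_ge_0 b) as Pb.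
  assert (HK : 0 < K) by (unfold K; apply Rdiv_lt_0_compat; lra).
  assert (HwL : forall x y, Cmod (x - z1) < Rmin r d1 -> Cmod (y - z1) < Rmin r d1 ->
            Cmod (w x - w y) <= K * Cmod (x - y)).
  { intros x y Hx Hy. pose proof (Rmin_l r d1). pose proof (Rmin_r r d1).
    destruct (Hw x ltac:(lra)) as [Hx1 Hx2]. destruct (Hw y ltac:(lra)) as [Hy1 Hy2].
    pose proof (near_linear_ge q zeta a d _ _ NL Hx1 Hy1) as G. rewrite Hx2, Hy2 in G.
    specialize (HL x y ltac:(lra) ltac:(lra)).
    apply Rmult_le_reg_l with (Cmod a / 2); [lra|].
    unfold K. replace (Cmod a / 2 * ((Cmod b + 1) * 2 / Cmod a * Cmod (x - y)))
      with ((Cmod b + 1) * Cmod (x - y)) by (field; lra). lra. }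
  apply strict_derive_intro with ((K + 1) / Cmod a1).
  { apply Rmult_le_pos; [lra|]. left. now apply Rinv_0_lt_compat. }
  intros e [He _].
  destruct (Hp e He) as [d2 [Hd2 H2]]. destruct (Hq e He) as [d3 [Hd3 H3]].
  destruct (Rmin_pos_lt r d1 Hr Hd1) as [h1 [h2 h3]].
  assert (Hd3' : 0 < d3 / K) by (apply Rdiv_lt_0_compat; lra).
  destruct (Rmin_pos_lt d2 (d3 / K) Hd2 Hd3') as [h4 [h5 h6]].
  destruct (Rmin_pos_lt _ _ h1 h4) as [h7 [h8 h9]].
  exists (Rmin (Rmin r d1) (Rmin d2 (d3 / K))). split; [easy|]. intros x y Hx Hy.
  assert (Hclose : forall t, Cmod (t - z1) < Rmin (Rmin r d1) (Rmin d2 (d3 / K)) ->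
                     Cmod (w t - w z1) < d3).
  { intros t Ht. eapply Rle_lt_trans; [apply HwL; [lra|rewrite Cmod_minus_diag; lra]|].
    apply Rlt_le_trans with (K * (d3 / K)); [apply Rmult_lt_compat_l; lra|].
    right. field. lra. }
  destruct (Hw x ltac:(lra)) as [_ Ex]. destruct (Hw y ltac:(lra)) as [_ Ey].
  specialize (H2 x y ltac:(lra) ltac:(lra)).
  specialize (H3 (w x) (w y) (Hclose x Hx) (Hclose y Hy)).
  rewrite Ex, Ey in H3. specialize (HwL x y ltac:(lra) ltac:(lra)).
  replace (w x - w y - b / a1 * (x - y))%C with
    (((p x - p y - b * (x - y)) - (p x - p y - a1 * (w x - w y))) / a1)%C by (field; exact Ha1).
  rewrite Cmod_div by exact Ha1.
  apply Rmult_le_reg_r with (Cmod a1); [easy|].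
  replace ((K + 1) / Cmod a1 * e * Cmod (x - y) * Cmod a1)
    with ((K + 1) * e * Cmod (x - y)) by (field; lra).
  unfold Rdiv. rewrite Rmult_assoc, Rinv_l, Rmult_1_r by lra.
  eapply Rle_trans; [apply Cmod_minus_le|].
  apply (Rmult_le_compat_l e) in HwL; [|lra]. lra.
Qed.

(** * Taylor remainders and the derivative of an injective function *)

Lemma PSum_split (a : nat -> C) (R : R) (z : C) (m : nat) :
  radius_ge a R -> Cmod z < R ->
  radius_ge (fun n => a (n + m)%nat) R /\
  PSum a z = (csum (fun n => a n * z ^ n)%C m + z ^ m * PSum (fun n => a (n + m)%nat) z)%C.
Proof.
  intros Ha Hz. induction m as [|m [IH1 IH2]].
  - assert (E : forall n, a (n + 0)%nat = a n) by (intros; f_equal; lia). split.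
    + intros r Hr. destruct (Ha r Hr) as [M HM]. exists M. intros n. rewrite E. apply HM.
    + replace (PSum (fun n => a (n + 0)%nat) z) with (PSum a z); [simpl; ring|].
      symmetry. apply PSum_unique. apply sums_ext with (fun n => a n * z ^ n)%C.
      * intros. now rewrite E.
      * now apply PSum_sums with R.
  - assert (E : forall n, PS_shift (fun n => a (n + m)%nat) n = a (n + S m)%nat)
      by (intros; unfold PS_shift; f_equal; lia).
    pose proof (radius_ge_shift _ _ IH1) as IH1'. split.
    + intros r Hr. destruct (IH1' r Hr) as [M HM]. exists M. intros n. rewrite <- E. apply HM.
    + rewrite IH2, (PSum_shift _ R z IH1 Hz).
      replace (PSum (fun n => a (n + S m)%nat) z)
        with (PSum (PS_shift (fun n => a (n + m)%nat)) z).
      * cbn [csum Cpow Nat.add]. ring.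
      * symmetry. apply PSum_unique.
        apply sums_ext with (fun n => PS_shift (fun n => a (n + m)%nat) n * z ^ n)%C.
        -- intros. now rewrite E.
        -- now apply PSum_sums with R.
Qed.

Lemma csum_const_term (a : nat -> C) (z : C) (m : nat) :
  (0 < m)%nat -> (forall n, (0 < n < m)%nat -> a n = 0%C) ->
  csum (fun n => a n * z ^ n)%C m = a O.
Proof.
  intros Hm H. destruct m as [|m]; [lia|]. rewrite csum_S_l.
  rewrite (csum_ext _ (fun _ => 0%C)).
  - rewrite csum_const. simpl. ring.
  - intros n Hn. rewrite H by lia. ring.
Qed.

Lemma least_nat (P : nat -> Prop) :
  (exists n, P n) -> exists n, P n /\ forall k, (k < n)%nat -> ~ P k.
Proof.
  intros [n Hn]. revert Hn. induction n as [n IH] using lt_wf_ind.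
  intros Hn. destruct (classic (exists k, (k < n)%nat /\ P k)) as [[k [Hk Pk]]|H].
  - now apply (IH k).
  - exists n. split; [easy|]. intros k Hk Pk. apply H. now exists k.
Qed.

(* If the first nonconstant term had order [m >= 2], then [f] would be
   [a0 + am psi^m] with [psi] locally invertible, so it would take the same value
   at the preimages under [psi] of [t] and of [t] times an [m]-th root of unity. *)
Lemma injective_derive_neq_0 (f : C -> C) (z0 : C) (rho : R) :
  0 < rho -> analytic_at f z0 ->
  (forall x y, Cmod (x - z0) < rho -> Cmod (y - z0) < rho -> f x = f y -> x = y) ->
  C_derive f z0 <> 0%C.
Proof.
  intros Hrho Hf Hinj HD.
  apply analytic_at_PSum in Hf. destruct Hf as [a [R [HR [Ha Hf]]]].
  assert (a1 : a 1%nat = 0%C).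
  { assert (S : strict_derive f z0 (PSum (PS_D a) (z0 - z0))).
    { apply strict_derive_ext_loc with (fun x => PSum a (x - z0)) R; [easy| |].
      - intros x Hx. symmetry. now apply Hf.
      - apply (strict_derive_translate (PSum a)). apply strict_derive_PSum with R; [easy|].
        rewrite Cmod_minus_diag. lra. }
    rewrite (C_derive_of_strict _ _ _ S) in HD.
    replace (z0 - z0)%C with (RtoC 0) in HD by ring. rewrite PSum_0 in HD.
    unfold PS_D in HD. simpl in HD. rewrite <- HD. ring. }
  destruct (Rmin_pos_lt R rho HR Hrho) as [h1 [h2 h3]]. set (r := Rmin R rho) in *.
  assert (Em : forall h, Cmod (z0 + h - z0) = Cmod h).
  { intros h. f_equal. ring. }
  assert (Hfh : forall h, Cmod h < R -> f (z0 + h)%C = PSum a h).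
  { intros h Hh. rewrite Hf by now rewrite Em. f_equal. ring. }
  destruct (classic (exists m, (0 < m)%nat /\ a m <> 0%C)) as [Hex|Hno].
  (* Without a higher nonzero coefficient [f] is constant near [z0], so [z0] and [z0 + r / 2]
     contradict injectivity. *)
  2:{ assert (Hc : forall h, Cmod h < R -> f (z0 + h)%C = a O).
      { intros h Hh. rewrite (Hfh h Hh). apply PSum_unique. intros e He. exists 1%nat.
        intros n Hn. rewrite csum_const_term; [rewrite Cmod_minus_diag; lra|lia|].
        intros k Hk. apply NNPP. intros K. apply Hno. exists k. split; [lia|easy]. }
      assert (H2 : Cmod (RtoC (r / 2)) = r / 2) by (rewrite Cmod_R; apply Rabs_pos_eq; lra).
      assert (E : (z0 + 0)%C = (z0 + RtoC (r / 2))%C).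
      { apply Hinj; rewrite ?Em, ?H2, ?Cmod_0; [lra|lra|].
        rewrite !Hc; rewrite ?H2, ?Cmod_0; lra || easy. }
      assert (E' : RtoC (r / 2) = 0%C).
      { replace (RtoC (r / 2)) with (z0 + RtoC (r / 2) - (z0 + 0))%C by ring. rewrite E. ring. }
      apply RtoC_inj in E'. lra. }
  destruct (least_nat _ Hex) as [m [[Hm0 Ham] Hleast]].
  assert (Hm : (2 <= m)%nat).
  { destruct m as [|[|m]]; [lia|now rewrite a1 in Ham|lia]. }
  set (b := fun n => a (n + m)%nat).
  assert (Hb : radius_ge b R).
  { destruct (PSum_split a R 0 m Ha ltac:(rewrite Cmod_0; lra)) as [h _]. exact h. }
  assert (Hab : forall h, Cmod h < R -> PSum a h = (a O + h ^ m * PSum b h)%C).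
  { intros h Hh. destruct (PSum_split a R h m Ha Hh) as [_ E]. rewrite E. f_equal.
    apply csum_const_term; [easy|]. intros n Hn. apply NNPP. intros K.
    apply (Hleast n); [lia|]. split; [lia|easy]. }
  set (K := fun h => (/ a m * PSum b h)%C).
  assert (K0 : K 0%C = 1%C).
  { unfold K. rewrite PSum_0. unfold b. simpl. field. exact Ham. }
  assert (HK : strict_derive K 0 (0 * PSum b 0 + / a m * PSum (PS_D b) 0)).
  { apply (strict_derive_mult (fun _ => / a m)%C); [apply strict_derive_const|].
    apply strict_derive_PSum with R; [easy|rewrite Cmod_0; lra]. }
  set (P := fun u : C => (u ^ m)%C).
  assert (HmC : RtoC (INR m) <> 0%C).
  { intros E. apply RtoC_inj in E. apply (not_0_INR m); [lia|easy]. }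
  assert (HPd : forall u, strict_derive P u (INR m * u ^ (m - 1) * 1)).
  { intros u. apply (strict_derive_pow (fun x => x)). apply strict_derive_id. }
  assert (HP1 : (INR m * 1 ^ (m - 1) * 1)%C <> 0%C).
  { rewrite Cpow_1_l. replace (INR m * 1 * 1)%C with (RtoC (INR m)) by ring. exact HmC. }
  (* An [m]-th root [s] of [K] near 1 comes from the local inverse of [u ^ m], whose derivative at 1
     is [m]; it will give [psi h = h * s h]. *)
  destruct (local_inverse P 1 _ 1 (HPd 1%C) HP1 Rlt_0_1) as [d1 [eta1 [Hd1 [Heta1 [NL1 Inv1]]]]].
  destruct (strict_derive_continuous K 0 _ HK eta1 Heta1) as [r1 [Hr1 HKc]].
  assert (Hs : exists s : C -> C, forall h, Cmod h < r1 ->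
             Cmod (s h - 1) < d1 /\ P (s h) = K h).
  { assert (Hs : forall h, exists u, Cmod h < r1 -> Cmod (u - 1) < d1 /\ P u = K h).
    { intros h. destruct (Rlt_le_dec (Cmod h) r1) as [Hh|Hh].
      - destruct (Inv1 (K h)) as [u [Hu1 Hu2]].
        + unfold P. rewrite Cpow_1_l, <- K0. apply HKc. now replace (h - 0)%C with h by ring.
        + exists u. intros _. split; [lra|easy].
      - exists 0%C. intros. lra. }
    apply choice in Hs. exact Hs. }
  destruct Hs as [s Hs].
  assert (Hs0 : s 0%C <> 0%C).
  { destruct (Hs 0%C ltac:(rewrite Cmod_0; lra)) as [_ E]. intros E0.
    rewrite K0, E0 in E. unfold P in E. destruct m as [|m']; [lia|]. simpl in E.
    rewrite Cmult_0_l in E. apply RtoC_inj in E. lra. }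
  assert (Hsd : strict_derive s 0 ((0 * PSum b 0 + / a m * PSum (PS_D b) 0)
                 / (INR m * s 0%C ^ (m - 1) * 1))%C).
  { apply (strict_derive_lift P K s 1 _ 0 _ _ d1 r1 HP1 NL1 Hr1); auto.
    intros h Hh. replace (h - 0)%C with h in Hh by ring. now apply Hs. }
  set (psi := fun h => (h * s h)%C).
  pose proof (strict_derive_mult _ _ _ _ _ (strict_derive_id 0) Hsd) as Hpsi.
  fold psi in Hpsi. rewrite Cmult_0_l, Cplus_0_r, Cmult_1_l in Hpsi.
  destruct (Rmin_pos_lt r r1 h1 Hr1) as [k1 [k2 k3]].
  destruct (local_inverse psi 0 _ (Rmin r r1) Hpsi Hs0 k1)
    as [d2 [eta2 [Hd2 [Heta2 [_ Inv2]]]]].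
  (* Both [t] and [t * om] have modulus below [eta2], so both have preimages under [psi], and their
     [m]-th powers agree. *)
  set (t := eta2 / 2). set (om := cis (2 * PI / INR m)).
  assert (Hmpos : 2 <= INR m) by (replace 2 with (INR 2) by easy; now apply le_INR).
  assert (Hom : om <> 1%C).
  { apply cis_neq_1. pose proof PI_RGT_0. split; [apply Rdiv_lt_0_compat; lra|].
    apply Rmult_lt_reg_r with (INR m); [lra|].
    unfold Rdiv. rewrite Rmult_assoc, Rinv_l by lra. nra. }
  assert (Homm : (om ^ m)%C = 1%C).
  { unfold om. rewrite cis_pow. replace (INR m * (2 * PI / INR m)) with (2 * PI) by (field; lra).
    apply cis_2PI. }
  assert (psi0 : psi 0%C = 0%C) by (unfold psi; ring).
  assert (Ht : Cmod t = t) by (rewrite Cmod_R; apply Rabs_pos_eq; unfold t; lra).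
  assert (Hval : forall y, Cmod y = t -> (y ^ m)%C = (t ^ m)%C ->
    exists h, Cmod h < r /\ psi h = y /\ f (z0 + h)%C = (a O + a m * t ^ m)%C).
  { intros y Hy Hym. destruct (Inv2 y) as [h [Hh Eh]].
    { rewrite psi0. replace (y - 0)%C with y by ring. rewrite Hy. unfold t. lra. }
    replace (h - 0)%C with h in Hh by ring.
    exists h. split; [lra|]. split; [easy|].
    rewrite Hfh by lra. rewrite Hab by lra. f_equal.
    destruct (Hs h ltac:(lra)) as [_ E]. unfold P, K in E.
    rewrite <- Hym, <- Eh. unfold psi. rewrite Cpow_mult_l, E. field. exact Ham. }
  destruct (Hval (RtoC t) Ht eq_refl) as [x1 [Hx1 [Ex1 Fx1]]].
  destruct (Hval (t * om)%C) as [x2 [Hx2 [Ex2 Fx2]]].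
  { rewrite Cmod_mult, Ht. unfold om. rewrite Cmod_cis. ring. }
  { rewrite Cpow_mult_l, Homm. ring. }
  assert (E : (z0 + x1)%C = (z0 + x2)%C).
  { apply Hinj; rewrite ?Em; [lra|lra|congruence]. }
  assert (E' : x1 = x2).
  { replace x1 with (z0 + x1 - z0)%C by ring. rewrite E. ring. }
  rewrite E', Ex2 in Ex1. apply Hom.
  assert (Ht0 : RtoC t <> 0%C) by (intros Et; apply RtoC_inj in Et; unfold t in Et; lra).
  replace om with (t * om / t)%C by (field; exact Ht0). rewrite Ex1. field. exact Ht0.
Qed.

(** * The boundary lemma of Jack, Miller and Mocanu *)

(** The quotient [w x / x] is the shifted power series, so no singularity at 0 has to be removed.
    The maximum principle bounds it by [/ rho] on each circle of radius [rho < R], and [rho] tends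
    to [R]. *)
Lemma schwarz (w w' : C -> C) (R : R) (z : C) :
  (forall x, Cmod x < R -> strict_derive w x (w' x)) ->
  (forall x, Cmod x < R -> Cmod (w x) <= 1) ->
  w 0%C = 0%C -> Cmod z < R -> R * Cmod (w z) <= Cmod z.
Proof.
  intros Hw Hw1 Hw0 Hz. pose proof (Cmod_ge_0 z) as Pz.
  assert (E0 : forall x : C, (x - 0)%C = x) by (intros; ring).
  assert (Hrho : forall rho, Cmod z < rho < R -> rho * Cmod (w z) <= Cmod z).
  { intros rho Hrho. set (s := (rho + R) / 2).
    assert (Hs : rho < s < R) by (unfold s; lra).
    destruct (holomorphic_PSum w w' 0 s R) as [c [Hc Hwc]].
    { lra. }
    { intros x Hx. apply Hw. now rewrite E0 in Hx. }
    assert (Hwc' : forall x, Cmod x < s -> w x = (x * PSum (PS_shift c) x)%C).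
    { assert (Ec : c O = 0%C).
      { pose proof (Hwc 0%C) as H0. rewrite E0, Cmod_0, Hw0, PSum_0 in H0.
        symmetry. apply H0. lra. }
      intros x Hx. rewrite Hwc; rewrite E0; [|easy].
      rewrite (PSum_shift c s x Hc Hx), Ec. ring. }
    pose proof (radius_ge_shift c s Hc) as Hc'.
    assert (G : Cmod (PSum (PS_shift c) z) <= / rho).
    { apply (maximum_modulus _ (PSum (PS_D (PS_shift c))) rho s); try lra.
      - intros x Hx. now apply strict_derive_PSum with s.
      - intros x Hx. apply Rmult_le_reg_l with rho; [lra|]. rewrite Rinv_r by lra.
        rewrite <- Hx at 1. rewrite <- Cmod_mult, <- Hwc' by lra. apply Hw1. lra. }
    rewrite Hwc', Cmod_mult by lra.
    apply (Rmult_le_compat_l rho) in G; [|lra]. rewrite Rinv_r in G by lra. nra. }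
  apply Rle_of_le_mult_eps with 1; [lra|]. intros e He.
  (* The midpoint keeps [rho] above [|z|] when [e] is large. *)
  set (rho := Rmax (R - e) ((Cmod z + R) / 2)).
  assert (H1 : R - e <= rho) by apply Rmax_l.
  assert (H2 : (Cmod z + R) / 2 <= rho) by apply Rmax_r.
  assert (H3 : rho < R) by (apply Rmax_lub_lt; lra).
  specialize (Hrho rho ltac:(lra)). specialize (Hw1 z Hz).
  pose proof (Cmod_ge_0 (w z)). nra.
Qed.

(** Small [s] of either sign forces the linear coefficient to vanish; adding the inequalities at [s]
    and [- s] cancels it and isolates [beta]. *)
Lemma first_second_order (alpha beta K s0 : R) :
  0 < s0 -> 0 <= K ->
  (forall s, 0 < Rabs s < s0 -> alpha * s + beta * s ^ 2 <= K * Rabs s ^ 3) ->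
  alpha = 0 /\ beta <= 0.
Proof.
  intros Hs0 HK H.
  assert (B : forall x L, 0 <= L -> (forall s, 0 < s < Rmin s0 1 -> x <= L * s) -> x <= 0).
  { intros x L HL Hx. apply Rle_of_le_mult_eps with L; [easy|]. intros e He.
    destruct (Rmin_pos_lt s0 1 Hs0 Rlt_0_1) as [g1 [g2 g3]].
    destruct (Rmin_pos_lt e (Rmin s0 1 / 2) He ltac:(lra)) as [h1 [h2 h3]].
    specialize (Hx (Rmin e (Rmin s0 1 / 2)) ltac:(lra)).
    apply (Rmult_le_compat_l L) in h2; [|easy]. lra. }
  assert (Hs01 : forall s, 0 < s < Rmin s0 1 -> 0 < s < s0 /\ s < 1).
  { intros s Hs. pose proof (Rmin_l s0 1). pose proof (Rmin_r s0 1). lra. }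
  assert (Hp : forall s, 0 < s < Rmin s0 1 -> alpha + beta * s <= K * s ^ 2 /\
                - alpha + beta * s <= K * s ^ 2).
  { intros s Hs. apply Hs01 in Hs.
    pose proof (H s) as H1. pose proof (H (- s)) as H2. rewrite Rabs_Ropp in H2.
    rewrite Rabs_pos_eq in H1, H2 by lra.
    specialize (H1 ltac:(lra)). specialize (H2 ltac:(lra)).
    split; apply Rmult_le_reg_l with s; lra. }
  assert (L0 : 0 <= K + Rabs beta) by (pose proof (Rabs_pos beta); lra).
  assert (Hbd : forall s, 0 < s < Rmin s0 1 -> K * s ^ 2 - beta * s <= (K + Rabs beta) * s).
  { intros s Hs. apply Hs01 in Hs. pose proof (Rabs_maj2 beta).
    assert (s ^ 2 <= s) by nra. assert (K * s ^ 2 <= K * s) by (apply Rmult_le_compat_l; lra).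
    nra. }
  split.
  - apply Rle_antisym.
    + apply (B _ _ L0). intros s Hs. destruct (Hp s Hs). specialize (Hbd s Hs). lra.
    + enough (- alpha <= 0) by lra.
      apply (B _ _ L0). intros s Hs. destruct (Hp s Hs). specialize (Hbd s Hs). lra.
  - apply (B _ K HK). intros s Hs. destruct (Hp s Hs). apply Hs01 in Hs.
    apply Rmult_le_reg_r with s; [lra|]. nra.
Qed.

(* The test points [h = - (s^2 / 2 + s^4) + i s] lie in [|1 + h| < 1] and are
   tangent to second order to its boundary. *)
Lemma jack_local (psi T : C -> C) (k b : C) (M d : R) :
  0 < d ->
  (forall h, Cmod h < d -> psi h = (1 + k * h + b * h ^ 2 + h ^ 3 * T h)%C) ->
  (forall h, Cmod h < d -> Cmod (T h) <= M) ->
  (forall h, Cmod h < d -> Cmod (1 + h) < 1 -> Cmod (psi h) <= Cmod (1 + h)) ->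
  Im k = 0 /\ 1 <= Re k /\ Re k ^ 2 - Re k <= 2 * Re b.
Proof.
  intros Hd Hpsi HT Hb.
  assert (HM : 0 <= M).
  { eapply Rle_trans; [apply Cmod_ge_0|apply (HT 0%C)]. rewrite Cmod_0. lra. }
  pose proof (Cmod_ge_0 b) as Pb. pose proof (Cmod_ge_0 k) as Pk.
  assert (Hre : 1 <= Re k).
  (* Radial test points [h = - t]: to first order, [1 - t * Re k] is at most [1 - t]. *)
  { enough (1 - Re k <= 0) by lra. apply Rle_of_le_mult_eps with (Cmod b + M); [lra|].
    intros e He. destruct (Rmin_pos_lt e (Rmin d 1 / 2)) as [h1 [h2 h3]]; [easy| |].
    { pose proof (Rmin_pos d 1 Hd Rlt_0_1). lra. }
    pose proof (Rmin_l d 1). pose proof (Rmin_r d 1).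
    set (t := Rmin e (Rmin d 1 / 2)) in *.
    assert (Eh : Cmod (RtoC (- t)) = t) by (rewrite Cmod_R, Rabs_Ropp; apply Rabs_pos_eq; lra).
    assert (E1 : Cmod (1 + RtoC (- t)) = 1 - t).
    { rewrite <- RtoC_plus, Cmod_R. rewrite Rabs_pos_eq; lra. }
    specialize (Hb (RtoC (- t)) ltac:(lra) ltac:(lra)). rewrite E1 in Hb.
    rewrite Hpsi in Hb by lra.
    pose proof (HT (RtoC (- t)) ltac:(lra)) as HTt.
    set (rem := (b * RtoC (- t) ^ 2 + RtoC (- t) ^ 3 * T (RtoC (- t)))%C).
    assert (Hrem : Cmod rem <= (Cmod b + M) * t ^ 2).
    { unfold rem. eapply Rle_trans; [apply Cmod_triangle|].
      rewrite !Cmod_mult, !Cmod_pow, Eh.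
      assert (t ^ 3 * Cmod (T (RtoC (- t))) <= t ^ 2 * M).
      { apply Rmult_le_compat; [apply pow_le; lra|apply Cmod_ge_0| |easy]. nra. }
      lra. }
    replace (1 + k * RtoC (- t) + b * RtoC (- t) ^ 2 + RtoC (- t) ^ 3 * T (RtoC (- t)))%C
      with (1 + k * RtoC (- t) + rem)%C in Hb by (unfold rem; ring).
    pose proof (re_le_Cmod (1 + k * RtoC (- t) + rem)) as R1.
    pose proof (re_le_Cmod rem) as R2.
    assert (ER : Re (1 + k * RtoC (- t) + rem) = 1 - t * Re k + Re rem).
    { unfold Re. simpl. ring. }
    rewrite ER in R1. apply Rabs_le_between in R1. apply Rabs_le_between in R2.
    assert (t * (1 - Re k) <= t * ((Cmod b + M) * t)) by nra.
    apply Rmult_le_reg_l in H1; [|lra].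
    apply (Rmult_le_compat_l (Cmod b + M)) in h2; lra. }
  set (k1 := Re k) in *. set (k2 := Im k) in *. set (b1 := Re b). set (b2 := Im b).
  (* Up to order two in [s], the left side is [2 * Re (k h + b h^2) + |k h|^2], that is
     [|1 + k h + b h^2|^2 - 1] at the test point. It is at most of third order because
     [|psi h| <= |1 + h| < 1]. *)
  assert (Main : exists K s0, 0 < s0 /\ 0 <= K /\ forall s, 0 < Rabs s < s0 ->
     (- 2 * k2) * s + (k1 ^ 2 + k2 ^ 2 - k1 - 2 * b1) * s ^ 2 <= K * Rabs s ^ 3).
  2:{ destruct Main as [K [s0 [Hs0 [HK HH]]]].
      destruct (first_second_order _ _ K s0 Hs0 HK HH) as [A1 A2].
      assert (k2 = 0) by lra. split; [easy|]. split; [easy|].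
      assert (k2 ^ 2 = 0) by (rewrite H; ring). lra. }
  (* The summands pay in turn for the squared remainder [(1 + 8 * M * a ^ 3) ^ 2], the cross term of
     [k h] and [b h^2], the quartic part of [sg] times [k1], the term [b1 * sg ^ 2], and the term
     [b2 * sg * s]. *)
  exists (16 * M + 64 * M ^ 2 + 16 * (Cmod k * Cmod b) + 2 * Rabs k1 + 2 * Rabs b1 + 3 * Rabs b2),
    (Rmin (1 / 2) (d / 2)).
  pose proof (Rmult_le_pos _ _ Pk Pb) as Pkb.
  pose proof (Rabs_pos k1) as Pk1. pose proof (Rabs_pos b1) as Pb1. pose proof (Rabs_pos b2) as Pb2.
  split; [apply Rmin_pos; lra|]. split; [nra|].
  intros s Hs. pose proof (Rmin_l (1 / 2) (d / 2)). pose proof (Rmin_r (1 / 2) (d / 2)).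
  set (a := Rabs s) in *.
  assert (Ea : s ^ 2 = a ^ 2) by (unfold a; rewrite <- !Rsqr_pow2; apply Rsqr_abs).
  set (sg := a ^ 2 / 2 + a ^ 4).
  assert (Ha2 : 0 < a ^ 2 <= 1 / 4) by nra.
  assert (Ea4 : a ^ 4 = a ^ 2 * a ^ 2) by ring.
  assert (Hsg : 0 < sg <= 3 / 4 * a ^ 2) by (unfold sg; nra).
  set (h := (- sg, s) : C).
  assert (Eh2 : Cmod h ^ 2 = sg ^ 2 + a ^ 2).
  { rewrite Cmod2_alt. unfold h, Re, Im. simpl fst. simpl snd. rewrite <- Ea. ring. }
  assert (Hh : Cmod h <= 2 * a).
  { apply Rsqr_incr_0_var; [|lra]. rewrite !Rsqr_pow2, Eh2. nra. }
  assert (Hhs : a ^ 2 <= Cmod h ^ 2) by (rewrite Eh2; nra).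
  (* The quartic part of [sg] puts the point strictly inside: [1 - 2 * sg + a ^ 2 = 1 - 2 * a ^ 4],
     while [sg ^ 2] is at most [9 / 16 * a ^ 4]. *)
  assert (H1h : Cmod (1 + h) < 1).
  { apply Rsqr_incrst_0; [|apply Cmod_ge_0|lra]. rewrite !Rsqr_pow2, Cmod2_alt.
    unfold h, Re, Im. simpl fst. simpl snd.
    replace ((1 + - sg) ^ 2 + (0 + s) ^ 2) with (1 - 2 * sg + sg ^ 2 + s ^ 2) by ring.
    rewrite Ea. assert (sg ^ 2 <= 9 / 16 * a ^ 4) by (rewrite Ea4; nra).
    assert (0 < a ^ 4) by (rewrite Ea4; nra). unfold sg in *. lra. }
  specialize (Hb h ltac:(lra) H1h). rewrite Hpsi in Hb by lra.
  specialize (HT h ltac:(lra)).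
  set (X := (k * h)%C). set (Y := (b * h ^ 2)%C).
  assert (Ph := Cmod_ge_0 h).
  assert (Ph3 : Cmod h ^ 3 <= 8 * a ^ 3).
  { replace (8 * a ^ 3) with ((2 * a) ^ 3) by ring. apply pow_incr. lra. }
  assert (Pa3 : 0 < a ^ 3) by (apply pow_lt; lra).
  assert (HU : Cmod (1 + (X + Y)) <= 1 + 8 * M * a ^ 3).
  { eapply Rle_trans; [apply (Cmod_le_minus _ (- (h ^ 3 * T h)))|].
    rewrite Cmod_opp, Cmod_mult, Cmod_pow.
    replace (1 + (X + Y) - - (h ^ 3 * T h))%C with (1 + k * h + b * h ^ 2 + h ^ 3 * T h)%C
      by (unfold X, Y; ring).
    assert (Cmod h ^ 3 * Cmod (T h) <= 8 * a ^ 3 * M).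
    { apply Rmult_le_compat; [now apply pow_le|apply Cmod_ge_0|easy|easy]. }
    lra. }
  assert (HU2 : Cmod (1 + (X + Y)) ^ 2 <= 1 + (16 * M + 64 * M ^ 2) * a ^ 3).
  { eapply Rle_trans; [apply pow_incr; split; [apply Cmod_ge_0|exact HU]|].
    assert (a ^ 3 <= 1) by (apply pow_le_1; lra).
    assert (0 <= M ^ 2) by (apply pow_le; lra).
    assert (a ^ 3 * a ^ 3 <= a ^ 3) by nra. nra. }
  assert (EU : Cmod (1 + (X + Y)) ^ 2 = 1 + 2 * Re (X + Y) + Cmod (X + Y) ^ 2).
  { rewrite !Cmod2_alt. unfold Re, Im. simpl. ring. }
  assert (HXY : Cmod X ^ 2 - 2 * (Cmod X * Cmod Y) <= Cmod (X + Y) ^ 2).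
  { pose proof (Cmod_triangle (X + Y) (- Y)) as T1. rewrite Cmod_opp in T1.
    replace (X + Y + - Y)%C with X in T1 by ring.
    pose proof (Cmod_ge_0 X). pose proof (Cmod_ge_0 Y). pose proof (Cmod_ge_0 (X + Y)).
    destruct (Rle_lt_dec (Cmod Y) (Cmod X)).
    - assert ((Cmod X - Cmod Y) ^ 2 <= Cmod (X + Y) ^ 2) by (apply pow_incr; lra).
      pose proof (pow2_ge_0 (Cmod Y)). nra.
    - nra. }
  assert (HX2 : (k1 ^ 2 + k2 ^ 2) * a ^ 2 <= Cmod X ^ 2).
  { unfold X. rewrite Cmod_mult, Rpow_mult_distr, (Cmod2_alt k). fold k1 k2.
    apply Rmult_le_compat_l; [|easy]. pose proof (pow2_ge_0 k1). pose proof (pow2_ge_0 k2). lra. }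
  assert (HXYle : Cmod X * Cmod Y <= 8 * (Cmod k * Cmod b) * a ^ 3).
  { unfold X, Y. rewrite !Cmod_mult, Cmod_pow.
    replace (Cmod k * Cmod h * (Cmod b * Cmod h ^ 2)) with (Cmod k * Cmod b * Cmod h ^ 3) by ring.
    apply (Rmult_le_compat_l _ _ _ Pkb) in Ph3. lra. }
  assert (ERe : Re (X + Y) = - k1 * sg - k2 * s + b1 * (sg ^ 2 - a ^ 2) + 2 * b2 * sg * s).
  { rewrite <- Ea. unfold X, Y, h, k1, k2, b1, b2, Re, Im. simpl. ring. }
  assert (B1 : k1 * a ^ 4 <= Rabs k1 * a ^ 3).
  { apply Rle_trans with (Rabs k1 * a ^ 4).
    - apply Rmult_le_compat_r; [nra|apply Rle_abs].
    - apply Rmult_le_compat_l; [easy|]. replace (a ^ 4) with (a ^ 3 * a) by ring. nra. }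
  assert (B2 : - b1 * sg ^ 2 <= Rabs b1 * a ^ 3).
  { apply Rle_trans with (Rabs b1 * sg ^ 2).
    - apply Rmult_le_compat_r; [apply pow2_ge_0|apply Rabs_maj2].
    - apply Rmult_le_compat_l; [easy|].
      assert (sg ^ 2 <= (3 / 4 * a ^ 2) ^ 2) by (apply pow_incr; lra).
      replace ((3 / 4 * a ^ 2) ^ 2) with (9 / 16 * (a ^ 3 * a)) in H1 by field. nra. }
  assert (B3 : - 4 * b2 * sg * s <= 3 * Rabs b2 * a ^ 3).
  { apply Rle_trans with (Rabs (- 4 * b2 * sg * s)); [apply Rle_abs|].
    rewrite !Rabs_mult. rewrite (Rabs_pos_eq sg) by lra. fold a.
    replace (Rabs (-4)) with 4 by (rewrite Rabs_left; lra).
    assert (sg * a <= 3 / 4 * a ^ 2 * a) by (apply Rmult_le_compat_r; lra).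
    apply (Rmult_le_compat_l _ _ _ Pb2) in H1. replace (a ^ 3) with (a ^ 2 * a) by ring. lra. }
  rewrite Ea. rewrite EU, ERe in HU2.
  replace (- k1 * sg) with (- k1 * a ^ 2 / 2 - k1 * a ^ 4) in HU2 by (unfold sg; field). lra.
Qed.

(** * Functions of class Q and lifts through them *)

Lemma disk_not_exceptional (q : C -> C) (z : C) : disk z -> ~ exceptional q z.
Proof. unfold disk, exceptional, unit_circle. intros H [H' _]. lra. Qed.

(** The definition of [class_Q] demands a nonzero derivative on the circle only; inside the disk it
    follows from injectivity. *)
Lemma class_Q_interior (q : C -> C) (z : C) :
  class_Q q -> disk z -> analytic_at q z /\ C_derive q z <> 0%C.
Proof.
  intros [Han [Hinj _]] Hz. unfold disk in Hz.
  assert (Hin : forall x, disk x -> closed_disk x /\ ~ exceptional q x).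
  { intros x Hx. split; [|now apply disk_not_exceptional].
    unfold disk, closed_disk in *. lra. }
  assert (Hq : analytic_at q z) by (apply Han; apply Hin; exact Hz).
  split; [easy|].
  apply (injective_derive_neq_0 q z (1 - Cmod z)); [lra|easy|].
  intros x y Hx Hy. apply Hinj; apply Hin; unfold disk.
  - pose proof (Cmod_le_minus x z). lra.
  - pose proof (Cmod_le_minus y z). lra.
Qed.

Lemma class_Q_injective (q : C -> C) (x y : C) :
  class_Q q -> disk x -> disk y -> q x = q y -> x = y.
Proof.
  intros [_ [Hinj _]] Hx Hy.
  apply Hinj; (split; [|now apply disk_not_exceptional]); unfold disk, closed_disk in *; lra.
Qed.

(** At an exceptional point [|q|] tends to infinity within the disk, so values converging along a
    sequence that clusters there exclude it. *)
Lemma class_Q_bounded_near (q : C -> C) (u : nat -> C) (zeta l : C) :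
  (forall n, disk (u n)) ->
  (forall e N, 0 < e -> exists n, (N <= n)%nat /\ Cmod (u n - zeta) < e) ->
  (forall e, 0 < e -> exists N, forall n, (N <= n)%nat -> Cmod (q (u n) - l) < e) ->
  ~ exceptional q zeta.
Proof.
  intros Hu Hc Hl [_ HE].
  destruct (Hl 1 Rlt_0_1) as [N HN].
  destruct (HE (fun y => Cmod l + 1 < y)) as [e He].
  { exists (Cmod l + 1). easy. }
  destruct (Hc e N (cond_pos e)) as [n [Hn Hd]].
  assert (K : Cmod l + 1 < Cmod (q (u n))).
  { apply He; [|apply Hu]. now apply C_NormedModule_mixin_compat1. }
  specialize (HN n Hn). pose proof (Cmod_le_minus (q (u n)) l). lra.
Qed.

Section Boundary.

Variables (p p' q : C -> C).
Hypothesis Hq : class_Q q.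
Hypothesis Hp : forall z, disk z -> strict_derive p z (p' z).

Definition covered (z : C) : Prop := exists zeta, disk zeta /\ q zeta = p z.

Lemma covered_local_inverse (z zeta : C) :
  disk z -> disk zeta -> q zeta = p z ->
  exists d r, near_linear q zeta (C_derive q zeta) d /\ 0 < r /\
    forall x, Cmod (x - z) < r ->
      exists xi, Cmod (xi - zeta) < d /\ disk xi /\ q xi = p x.
Proof.
  intros Hz Hzeta E. destruct (class_Q_interior q zeta Hq Hzeta) as [Han HD].
  unfold disk in Hzeta.
  destruct (local_inverse q zeta _ (1 - Cmod zeta) (strict_derive_analytic _ _ Han) HD)
    as [d [eta [Hd [Heta [NL Inv]]]]]; [lra|].
  destruct (strict_derive_continuous _ _ _ (Hp z Hz) eta Heta) as [r [Hr Hpc]].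
  exists d, r. split; [easy|]. split; [easy|]. intros x Hx.
  specialize (Hpc x Hx). rewrite <- E in Hpc.
  destruct (Inv (p x) Hpc) as [xi [Hxi Exi]].
  exists xi. split; [lra|]. split; [|easy]. unfold disk.
  pose proof (Cmod_le_minus xi zeta). lra.
Qed.

Lemma covered_open (z : C) :
  disk z -> covered z -> exists r, 0 < r /\ forall x, Cmod (x - z) < r -> covered x.
Proof.
  intros Hz [zeta [Hzeta E]].
  destruct (covered_local_inverse z zeta Hz Hzeta E) as [d [r [_ [Hr H]]]].
  exists r. split; [easy|]. intros x Hx. destruct (H x Hx) as [xi [_ Hxi]]. now exists xi.
Qed.

(** [w] is an arbitrary selection of preimages. Injectivity of [q] on the whole disk identifies it
    near each point with the local inverse, which confines it to a ball where [strict_derive_lift]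
    applies. *)
Lemma inverse_strict_derive (w : C -> C) (R : R) (z : C) :
  R <= 1 -> (forall x, Cmod x < R -> disk (w x) /\ q (w x) = p x) -> Cmod z < R ->
  strict_derive w z (p' z / C_derive q (w z)).
Proof.
  intros HR Hw Hz. destruct (Hw z Hz) as [Hwz E].
  assert (Dz : disk z) by (unfold disk; lra).
  destruct (covered_local_inverse z (w z) Dz Hwz E) as [d [r [NL [Hr H]]]].
  destruct (class_Q_interior q (w z) Hq Hwz) as [Han HD].
  destruct (Rmin_pos_lt r (R - Cmod z) Hr ltac:(lra)) as [h1 [h2 h3]].
  apply (strict_derive_lift q p w (w z) _ z _ _ d _ HD NL h1).
  - intros x Hx. destruct (H x ltac:(lra)) as [xi [Hxi [Dxi Exi]]].
    pose proof (Cmod_le_minus x z). destruct (Hw x ltac:(lra)) as [Hwx Ex].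
    split; [|easy].
    replace (w x) with xi; [easy|].
    apply (class_Q_injective q); auto. congruence.
  - now apply Hp.
  - now apply strict_derive_analytic.
Qed.

(** The radius of [z0] is the supremum [r0] of the radii of covered disks. If the closed disk of
    radius [r0] were covered, openness of coverage and compactness would enlarge [r0]; it is
    positive because 0 is covered. *)
Lemma first_exit :
  covered 0 -> ~ (forall z, disk z -> covered z) ->
  exists z0, 0 < Cmod z0 < 1 /\ ~ covered z0 /\ forall z, Cmod z < Cmod z0 -> covered z.
Proof.
  intros H0 Hnot.
  set (G := fun r => r <= 1 /\ forall z, Cmod z < r -> covered z).
  destruct (completeness G) as [r0 [Hub Hlub]].
  { exists 1. intros r [Hr _]. exact Hr. }
  { exists 0. split; [lra|]. intros z Hz. pose proof (Cmod_ge_0 z). lra. }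
  assert (Hin : forall z, Cmod z < r0 -> covered z).
  { intros z Hz. apply NNPP. intros Hz'. apply (Rlt_not_le _ _ Hz). apply Hlub.
    intros r [_ Hr]. apply Rnot_lt_le. intros h. now apply Hz', Hr. }
  assert (Hr01 : r0 < 1).
  { apply Rnot_le_lt. intros h. apply Hnot. intros z Hz. apply Hin. unfold disk in Hz. lra. }
  destruct (classic (exists z0, Cmod z0 <= r0 /\ ~ covered z0)) as [[z0 [Hz0 Hz0']]|Hno].
  - assert (E : Cmod z0 = r0).
    { apply Rle_antisym; [easy|]. apply Rnot_lt_le. intros h. now apply Hz0', Hin. }
    exists z0. rewrite E. repeat split; auto.
    rewrite <- E. apply Cmod_gt_0. intros K. now rewrite K in Hz0'.
  - exfalso.
    assert (Hall : forall z, Cmod z <= r0 -> covered z).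
    { intros z Hz. apply NNPP. intros K. apply Hno. now exists z. }
    destruct (compact_uniform 0 r0 (fun x d => forall y, Cmod (y - x) < d -> covered y))
      as [d [Hd HP]].
    + intros x d d' Hd HP y Hy. apply HP. lra.
    + intros l Hl. replace (l - 0)%C with l in Hl by ring.
      destruct (covered_open l) as [r [Hr H]]; [unfold disk; lra|now apply Hall|].
      exists (r / 2). split; [lra|]. intros x _ Hx y Hy. apply H.
      pose proof (Cmod_minus_triangle y x l). lra.
    + assert (Hr0 : 0 <= r0).
      { apply Hub. split; [lra|]. intros z Hz. pose proof (Cmod_ge_0 z). lra. }
      destruct (Rmin_pos_lt d (1 - r0) Hd ltac:(lra)) as [h1 [h2 h3]].
      enough (K : G (r0 + Rmin d (1 - r0))) by (apply Hub in K; lra).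
      split; [lra|]. intros y Hy.
      destruct (Rle_lt_dec (Cmod y) r0) as [h|h]; [now apply Hall|].
      assert (Hyn : RtoC (Cmod y) <> 0%C) by (intros E; apply RtoC_inj in E; lra).
      assert (Hq1 : 0 <= r0 / Cmod y < 1).
      { split; [apply Rmult_le_pos; [easy|left; apply Rinv_0_lt_compat; lra]|].
        apply Rmult_lt_reg_r with (Cmod y); [lra|].
        unfold Rdiv. rewrite Rmult_assoc, Rinv_l; lra. }
      (* The base point is the radial projection of [y] onto the circle of radius [r0], at distance
         [|y| - r0 < d]. *)
      apply (HP (RtoC (r0 / Cmod y) * y)%C).
      * replace (RtoC (r0 / Cmod y) * y - 0)%C with (RtoC (r0 / Cmod y) * y)%C by ring.
        rewrite Cmod_mult, Cmod_R, Rabs_pos_eq by lra. right. field. lra.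
      * replace (y - RtoC (r0 / Cmod y) * y)%C with (RtoC (1 - r0 / Cmod y) * y)%C
          by (rewrite RtoC_minus; ring).
        rewrite Cmod_mult, Cmod_R, Rabs_pos_eq by lra.
        replace ((1 - r0 / Cmod y) * Cmod y) with (Cmod y - r0) by (field; lra). lra.
Qed.

End Boundary.

(** To leave the ball of radius [d], the distance to [zeta] would have to pass through [3 / 4 * d],
    inside the forbidden gap between [d / 2] and [d]. *)
Lemma segment_stays (w : C -> C) (x y zeta : C) (d : R) :
  0 < d ->
  (forall s, 0 <= s <= 1 -> continuous_C w (x + s * (y - x))%C) ->
  (forall s, 0 <= s <= 1 -> Cmod (w (x + s * (y - x))%C - zeta) < d ->
     Cmod (w (x + s * (y - x))%C - zeta) <= d / 2) ->
  Cmod (w x - zeta) < d -> Cmod (w y - zeta) < d.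
Proof.
  intros Hd Hc Hgap Hx. apply Rnot_le_lt. intros Hy.
  set (F := fun s : R => Cmod (w (x + s * (y - x))%C - zeta) - 3 / 4 * d).
  assert (E0 : (x + 0 * (y - x))%C = x) by ring.
  assert (E1 : (x + 1 * (y - x))%C = y) by ring.
  destruct (IVT_interv F 0 1) as [s [Hs HFs]].
  - intros s Hs. intros e He. destruct (Hc s Hs e He) as [d' [Hd' H]].
    pose proof (Cmod_ge_0 (y - x)) as P.
    exists (d' / (Cmod (y - x) + 1)). split; [apply Rdiv_lt_0_compat; lra|].
    intros t [_ Ht]. simpl in *. unfold Rdist in *. unfold F.
    assert (Ht' : Cmod (x + t * (y - x) - (x + s * (y - x))) < d').
    { replace (x + t * (y - x) - (x + s * (y - x)))%C with (RtoC (t - s) * (y - x))%C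
        by (rewrite RtoC_minus; ring).
      rewrite Cmod_mult, Cmod_R.
      apply Rle_lt_trans with (Rabs (t - s) * (Cmod (y - x) + 1)).
      - apply Rmult_le_compat_l; [apply Rabs_pos|lra].
      - apply (Rmult_lt_compat_r (Cmod (y - x) + 1)) in Ht; [|lra].
        replace (d' / (Cmod (y - x) + 1) * (Cmod (y - x) + 1)) with d' in Ht by (field; lra).
        exact Ht. }
    specialize (H _ Ht').
    set (a := w (x + t * (y - x))%C) in *. set (b := w (x + s * (y - x))%C) in *.
    pose proof (Cmod_minus_triangle a b zeta). pose proof (Cmod_minus_triangle b a zeta).
    rewrite (Cmod_minus_sym b a) in H1. apply Rabs_lt_between. lra.
  - lra.
  - unfold F. rewrite E0. specialize (Hgap 0 ltac:(lra)). rewrite E0 in Hgap.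
    specialize (Hgap Hx). lra.
  - unfold F. rewrite E1. lra.
  - unfold F in HFs. specialize (Hgap s Hs). lra.
Qed.

Section Boundary_point.

Variables (p p' q w : C -> C) (z0 : C).
Hypothesis Hq : class_Q q.
Hypothesis Hp : forall z, disk z -> strict_derive p z (p' z).
Hypothesis Hz0 : 0 < Cmod z0 < 1.
Hypothesis Hexit : ~ covered p q z0.
Hypothesis Hw : forall z, Cmod z < Cmod z0 -> disk (w z) /\ q (w z) = p z.

(** Approaching [z0] radially, the values of [w] cluster at some [zeta] in the closed disk. It
    cannot lie inside, since then it would cover [z0], nor in [E(q)], since the values of [q] along
    the sequence converge to [p z0]. *)
Lemma boundary_cluster :
  exists zeta, unit_circle zeta /\ ~ exceptional q zeta /\ q zeta = p z0 /\
    forall e, 0 < e -> exists y, Cmod y < Cmod z0 /\ Cmod (y - z0) < e /\ Cmod (w y - zeta) < e.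
Proof.
  set (t := fun n : nat => 1 - / (INR n + 1 + 1)).
  assert (Ht : forall n, 0 < 1 - t n /\ 0 < t n).
  { intros n. unfold t. pose proof (pos_INR n).
    assert (0 < / (INR n + 1 + 1)) by (apply Rinv_0_lt_compat; lra).
    assert (/ (INR n + 1 + 1) < / 1) by (apply Rinv_lt_contravar; lra).
    rewrite Rinv_1 in *. lra. }
  set (y := fun n => (t n * z0)%C).
  assert (Hy : forall n, Cmod (y n) < Cmod z0).
  { intros n. destruct (Ht n). unfold y. rewrite Cmod_mult, Cmod_R, Rabs_pos_eq by lra. nra. }
  assert (Hyz : forall e, 0 < e -> exists N, forall n, (N <= n)%nat -> Cmod (y n - z0) < e).
  { intros e He. destruct (archimed_cor1 e He) as [N [HN HN0]]. exists N. intros n Hn.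
    destruct (Ht n). unfold y. replace (t n * z0 - z0)%C with (- (RtoC (1 - t n) * z0))%C
      by (rewrite RtoC_minus; ring).
    rewrite Cmod_opp, Cmod_mult, Cmod_R, Rabs_pos_eq by lra.
    assert (1 - t n <= / INR N).
    { unfold t. replace (1 - (1 - / (INR n + 1 + 1))) with (/ (INR n + 1 + 1)) by ring.
      apply Rinv_le_contravar; [now apply lt_0_INR|]. apply le_INR in Hn. lra. }
    nra. }
  assert (Hpz : forall e, 0 < e ->
            exists N, forall n, (N <= n)%nat -> Cmod (q (w (y n)) - p z0) < e).
  { intros e He. destruct (strict_derive_continuous p z0 _ (Hp z0 ltac:(unfold disk; lra)) e He)
      as [d [Hd H]].
    destruct (Hyz d Hd) as [N HN]. exists N. intros n Hn.
    destruct (Hw (y n) (Hy n)) as [_ ->]. apply H. now apply HN. }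
  destruct (cluster_C (fun n => w (y n)) 1) as [zeta Hzeta].
  { intros n. destruct (Hw (y n) (Hy n)) as [D _]. unfold disk in D. lra. }
  (* Continuity is kept as a premise because it has two sources: interior analyticity, used to
     refute [|zeta| < 1], and afterwards analyticity at a nonexceptional point of the circle. *)
  assert (Hlim : continuous_C q zeta -> q zeta = p z0).
  { intros Hc. apply Ceq_of_Cmod_lt. intros e He.
    destruct (Hc (e / 2) ltac:(lra)) as [d [Hd H]]. destruct (Hpz (e / 2) ltac:(lra)) as [N HN].
    destruct (Hzeta d N Hd) as [n [Hn Hn']].
    specialize (H _ Hn'). specialize (HN n Hn).
    pose proof (Cmod_minus_triangle (q zeta) (q (w (y n))) (p z0)) as T.
    rewrite (Cmod_minus_sym (q zeta) (q (w (y n)))) in T. lra. }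
  assert (Hcirc : Cmod zeta = 1).
  { apply Rle_antisym.
    - apply Rle_of_le_mult_eps with 1; [lra|]. intros e He.
      destruct (Hzeta e O He) as [n [_ Hn]]. destruct (Hw (y n) (Hy n)) as [D _].
      unfold disk in D. pose proof (Cmod_le_minus zeta (w (y n))) as T.
      rewrite Cmod_minus_sym in T. lra.
    - apply Rnot_lt_le. intros h. apply Hexit. exists zeta. split; [exact h|].
      apply Hlim. destruct (class_Q_interior q zeta Hq h) as [Han _].
      exact (strict_derive_continuous _ _ _ (strict_derive_analytic _ _ Han)). }
  assert (Hne : ~ exceptional q zeta).
  { apply (class_Q_bounded_near q (fun n => w (y n)) zeta (p z0)).
    - intros n. apply Hw. apply Hy.
    - intros e N He. now apply Hzeta.
    - exact Hpz. }
  exists zeta. split; [exact Hcirc|]. split; [exact Hne|]. split.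
  - apply Hlim. destruct Hq as [Han _].
    refine (strict_derive_continuous _ _ _ (strict_derive_analytic _ _ (Han zeta _))).
    split; [unfold closed_disk; lra|easy].
  - intros e He. destruct (Hyz e He) as [N HN]. destruct (Hzeta e N He) as [n [Hn Hn']].
    exists (y n). split; [apply Hy|]. split; [now apply HN|easy].
Qed.

(* The extension is [g o p], with [g] the local inverse of [q] at [zeta]; it agrees with
   [w] because on segments [w] cannot leave the ball where [q] is injective. *)
Lemma boundary_extension :
  exists zeta W r, unit_circle zeta /\ ~ exceptional q zeta /\ 0 < r <= 1 - Cmod z0 /\
    W z0 = zeta /\
    (forall x, Cmod (x - z0) < r ->
       q (W x) = p x /\ strict_derive q (W x) (C_derive q (W x)) /\
       strict_derive W x (p' x / C_derive q (W x))) /\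
    (forall x, Cmod (x - z0) < r -> Cmod x < Cmod z0 -> W x = w x).
Proof.
  destruct boundary_cluster as [zeta [Hcirc [Hne [Eq Hcl]]]].
  assert (Han : analytic_at q zeta).
  { destruct Hq as [Han _]. apply Han. unfold unit_circle, closed_disk in *.
    split; [lra|easy]. }
  assert (HD : C_derive q zeta <> 0%C) by (destruct Hq as [_ [_ H]]; now apply H).
  destruct (analytic_at_C_derive q zeta Han) as [[rq [Hrq Hqs]] _].
  destruct (local_inverse q zeta _ rq (strict_derive_analytic _ _ Han) HD Hrq)
    as [d [eta [Hd [Heta [NL Inv]]]]].
  assert (Dz0 : disk z0) by (unfold disk; lra).
  destruct (strict_derive_continuous p z0 _ (Hp z0 Dz0) eta Heta) as [r1 [Hr1 Hpc]].
  destruct (Rmin_pos_lt r1 (1 - Cmod z0) Hr1 ltac:(lra)) as [h1 [h2 h3]].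
  set (r := Rmin r1 (1 - Cmod z0)) in *.
  assert (HW : forall x, exists u, Cmod (x - z0) < r -> Cmod (u - zeta) <= d / 2 /\ q u = p x).
  { intros x. destruct (Rlt_le_dec (Cmod (x - z0)) r) as [Hx|Hx].
    - destruct (Inv (p x)) as [u Hu].
      + rewrite Eq. apply Hpc. lra.
      + now exists u.
    - exists 0%C. intros. lra. }
  apply choice in HW. destruct HW as [W HW].
  assert (HWd : forall x, Cmod (x - z0) < r -> strict_derive q (W x) (C_derive q (W x))).
  { intros x Hx. apply Hqs. destruct (HW x Hx). lra. }
  exists zeta, W, r. split; [easy|]. split; [easy|]. split; [lra|]. split; [|split].
  - assert (Hx : Cmod (z0 - z0) < r) by (rewrite Cmod_minus_diag; lra).
    destruct (HW z0 Hx) as [Hu Eu].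
    apply (near_linear_inj q zeta _ d _ _ HD NL); [lra| |congruence].
    rewrite Cmod_minus_diag. lra.
  - intros x Hx. split; [now apply HW|]. split; [now apply HWd|].
    apply (strict_derive_lift q p W zeta _ x _ _ d (r - Cmod (x - z0)) HD NL).
    + lra.
    + intros y Hy. pose proof (Cmod_minus_triangle y x z0).
      destruct (HW y ltac:(lra)) as [H1 H2]. split; [lra|easy].
    + apply Hp. unfold disk. pose proof (Cmod_le_minus x z0). lra.
    + now apply HWd.
  - intros x Hx Hx0.
    (* The comparison starts at a point [y] where [w] is already close to [zeta]; the segment from
       [y] to [x] stays in the intersection of two balls, which is convex. *)
    destruct (Hcl (Rmin r d)) as [y [Hy1 [Hy2 Hy3]]]; [apply Rmin_pos; lra|].
    pose proof (Rmin_l r d). pose proof (Rmin_r r d).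
    assert (Hseg : forall s, 0 <= s <= 1 -> Cmod (y + s * (x - y)) < Cmod z0 /\
                     Cmod (y + s * (x - y) - z0) < r).
    { intros s Hs.
      assert (Conv : forall a b R, Cmod a < R -> Cmod b < R ->
                       Cmod (RtoC (1 - s) * a + RtoC s * b) < R).
      { intros a b R Ha Hb. eapply Rle_lt_trans; [apply Cmod_triangle|].
        rewrite !Cmod_mult, !Cmod_R, !Rabs_pos_eq by lra.
        destruct (Rle_lt_or_eq_dec 0 s (proj1 Hs)) as [h|<-]; [nra|lra]. }
      split.
      - replace (y + s * (x - y))%C with (RtoC (1 - s) * y + s * x)%C
          by (rewrite RtoC_minus; ring).
        now apply Conv.
      - replace (y + s * (x - y) - z0)%C with (RtoC (1 - s) * (y - z0) + s * (x - z0))%C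
          by (rewrite RtoC_minus; ring).
        apply Conv; lra. }
    assert (Hin : forall u, Cmod u < Cmod z0 -> Cmod (u - z0) < r ->
              Cmod (w u - zeta) < d -> W u = w u).
    { intros u Hu1 Hu2 Hu3. destruct (HW u Hu2) as [H3 H4]. destruct (Hw u Hu1) as [_ H5].
      apply (near_linear_inj q zeta _ d _ _ HD NL); [lra|easy|congruence]. }
    apply Hin; [easy|easy|].
    apply (segment_stays w y x zeta d); [lra| | |lra].
    + intros s Hs. destruct (Hseg s Hs) as [H1 H2].
      exact (strict_derive_continuous _ _ _
        (inverse_strict_derive p p' q Hq Hp w (Cmod z0) _ ltac:(lra) Hw H1)).
    (* Wherever [w] is within [d] of [zeta] it equals [W], which is within [d / 2]: this is the
       gap. *)
    + intros s Hs Hds. destruct (Hseg s Hs) as [H1 H2].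
      rewrite <- (Hin _ H1 H2 Hds). now apply HW.
Qed.

End Boundary_point.

(** Everything is normalised to [psi h = W (z0 (1 + h)) / zeta], for which [psi 0 = 1] and Schwarz'
    lemma reads [|psi h| <= |1 + h|]. The two inequalities of [jack_local] on its Taylor
    coefficients are then carried over to [p] by the chain rule. *)
Lemma miller_mocanu (p p' p'' q : C -> C) :
  class_Q q -> p 0%C = 0%C -> q 0%C = 0%C ->
  (forall z, disk z -> strict_derive p z (p' z)) ->
  (forall z, disk z -> strict_derive p' z (p'' z)) ->
  ~ (forall z, disk z -> covered p q z) ->
  exists (z zeta : C) (k : R), disk z /\ unit_circle zeta /\ ~ exceptional q zeta /\ 1 <= k /\
    p z = q zeta /\ (z * p' z = k * (zeta * C_derive q zeta))%C /\
    k * Re (zeta * C_derive (C_derive q) zeta / C_derive q zeta + 1) <= Re (z * p'' z / p' z + 1).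
Proof.
  intros Hq Hp0 Hq0 Hp Hp' Hnot.
  assert (D0 : disk 0) by (unfold disk; rewrite Cmod_0; lra).
  destruct (first_exit p p' q Hq Hp) as [z0 [Hz0 [Hexit Hin]]];
    [exists 0%C; split; [easy|congruence]|easy|].
  assert (Hw : exists w, forall z, Cmod z < Cmod z0 -> disk (w z) /\ q (w z) = p z).
  { apply (choice (fun z u => Cmod z < Cmod z0 -> disk u /\ q u = p z)). intros z.
    destruct (Rlt_le_dec (Cmod z) (Cmod z0)) as [h|h].
    - destruct (Hin z h) as [u Hu]. now exists u.
    - exists 0%C. intros. lra. }
  destruct Hw as [w Hw].
  destruct (boundary_extension p p' q w z0 Hq Hp Hz0 Hexit Hw)
    as [zeta [W [r [Hcirc [Hne [Hr [EW0 [HW HWw]]]]]]]].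
  unfold unit_circle in Hcirc.
  assert (Hw0 : w 0%C = 0%C).
  { destruct (Hw 0%C ltac:(rewrite Cmod_0; lra)) as [Dw Ew].
    apply (class_Q_injective q); auto. congruence. }
  assert (Hschwarz : forall z, Cmod z < Cmod z0 -> Cmod z0 * Cmod (w z) <= Cmod z).
  { intros z Hz. apply (schwarz w (fun x => p' x / C_derive q (w x))%C (Cmod z0) z); auto.
    - intros x Hx. apply (inverse_strict_derive p p' q Hq Hp w (Cmod z0)); auto. lra.
    - intros x Hx. destruct (Hw x Hx) as [D _]. unfold disk in D. lra. }
  destruct (holomorphic_PSum W (fun x => p' x / C_derive q (W x))%C z0 (r / 2) r)
    as [c [Hc HWc]].
  { lra. }
  { intros x Hx. now apply HW. }
  assert (Z0 : (z0 - z0)%C = 0%C) by ring.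
  assert (C00 : Cmod (z0 - z0) < r / 2) by (rewrite Cmod_minus_diag; lra).
  assert (Hc0 : c O = zeta).
  { rewrite <- EW0, HWc by easy. now rewrite Z0, PSum_0. }
  assert (Hzeta : zeta <> 0%C) by now apply Cmod_1_neq_0.
  assert (Hz0n : z0 <> 0%C) by (apply Cmod_gt_0; lra).
  destruct (PSum_split c (r / 2) 0 3 Hc ltac:(rewrite Cmod_0; lra)) as [Hc3 _].
  set (T3 := PSum (fun n => c (n + 3)%nat)) in *.
  destruct (strict_derive_continuous T3 0 _
    (strict_derive_PSum _ _ 0 Hc3 ltac:(rewrite Cmod_0; lra)) 1 Rlt_0_1) as [d3 [Hd3 HT3]].
  (* The Taylor coefficients of [psi]: [k = z0 W' / W] and [b = z0^2 W'' / (2 W)] at [z0], so that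
     [z0 W'' / W' = 2 b / k]. *)
  set (k := (c 1%nat * z0 / zeta)%C). set (b := (c 2%nat * z0 ^ 2 / zeta)%C).
  assert (Hd : 0 < Rmin (r / 2) d3 / Cmod z0).
  { apply Rdiv_lt_0_compat; [apply Rmin_pos; lra|lra]. }
  assert (Hsmall : forall h, Cmod h < Rmin (r / 2) d3 / Cmod z0 ->
            Cmod (z0 * h) < r / 2 /\ Cmod (z0 * h) < d3).
  { intros h Hh. apply (Rmult_lt_compat_l (Cmod z0)) in Hh; [|lra].
    replace (Cmod z0 * (Rmin (r / 2) d3 / Cmod z0)) with (Rmin (r / 2) d3) in Hh by (field; lra).
    pose proof (Rmin_l (r / 2) d3). pose proof (Rmin_r (r / 2) d3). rewrite Cmod_mult. lra. }
  destruct (jack_local (fun h => W (z0 + z0 * h) / zeta)%C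
              (fun h => z0 ^ 3 / zeta * T3 (z0 * h))%C k b
              (Cmod (z0 ^ 3 / zeta) * (Cmod (T3 0%C) + 1)) _ Hd) as [Jk2 [Jk1 Jb]].
  { intros h Hh. destruct (Hsmall h Hh) as [Hh1 _].
    assert (E : (z0 + z0 * h - z0)%C = (z0 * h)%C) by ring.
    rewrite HWc; rewrite E; [|easy].
    destruct (PSum_split c (r / 2) (z0 * h) 3 Hc Hh1) as [_ ->]. fold T3.
    cbn [csum]. rewrite Hc0. unfold k, b. rewrite !Cpow_mult_l. cbn [Cpow]. field. exact Hzeta. }
  { intros h Hh. destruct (Hsmall h Hh) as [_ Hh2]. rewrite Cmod_mult.
    apply Rmult_le_compat_l; [apply Cmod_ge_0|].
    specialize (HT3 (z0 * h)%C). replace (z0 * h - 0)%C with (z0 * h)%C in HT3 by ring.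
    specialize (HT3 Hh2). pose proof (Cmod_le_minus (T3 (z0 * h)%C) (T3 0%C)). lra. }
  { intros h Hh H1h. destruct (Hsmall h Hh) as [Hh1 _].
    assert (E : (z0 + z0 * h - z0)%C = (z0 * h)%C) by ring.
    assert (E' : Cmod (z0 + z0 * h) = Cmod z0 * Cmod (1 + h)).
    { rewrite <- Cmod_mult. f_equal. ring. }
    assert (Hlt : Cmod (z0 + z0 * h) < Cmod z0) by (rewrite E'; nra).
    rewrite HWw by (rewrite ?E; lra). rewrite Cmod_div by exact Hzeta. rewrite Hcirc.
    pose proof (Hschwarz _ Hlt) as S. rewrite E' in S. apply Rmult_le_reg_l in S; lra. }
  assert (Hkr : k = RtoC (Re k)).
  { rewrite (surjective_pairing k) at 1. unfold RtoC. f_equal. exact Jk2. }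
  assert (Hk0 : k <> 0%C).
  { intros E. rewrite E in Jk1. simpl in Jk1. lra. }
  set (W1 := fun x => PSum (PS_D c) (x - z0)).
  assert (HWs : forall x, Cmod (x - z0) < r / 2 -> strict_derive W x (W1 x)).
  { intros x Hx.
    apply strict_derive_ext_loc with (fun x => PSum c (x - z0)) (r / 2 - Cmod (x - z0)).
    - lra.
    - intros y Hy. symmetry. apply HWc. pose proof (Cmod_minus_triangle y x z0). lra.
    - apply (strict_derive_translate (PSum c)). now apply strict_derive_PSum with (r / 2). }
  assert (HW1 : strict_derive W1 z0 (2 * c 2%nat)).
  { replace (2 * c 2%nat)%C with (PSum (PS_D (PS_D c)) (z0 - z0)).
    - apply (strict_derive_translate (PSum (PS_D c))).
      apply strict_derive_PSum with (r / 2); [now apply radius_ge_D|easy].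
    - rewrite Z0, PSum_0. unfold PS_D. simpl. rewrite RtoC_plus. ring. }
  assert (HW10 : W1 z0 = c 1%nat).
  { unfold W1. rewrite Z0, PSum_0. unfold PS_D. simpl. ring. }
  assert (Ep' : forall x, Cmod (x - z0) < r / 2 -> p' x = (C_derive q (W x) * W1 x)%C).
  { intros x Hx. apply (strict_derive_unique p x).
    - apply Hp. unfold disk. pose proof (Cmod_le_minus x z0). lra.
    - apply strict_derive_ext_loc with (fun x => q (W x)) (r - Cmod (x - z0)).
      + lra.
      + intros y Hy. apply HW. pose proof (Cmod_minus_triangle y x z0). lra.
      + apply (strict_derive_comp W q); [now apply HWs|]. apply HW. lra. }
  assert (Han : analytic_at q zeta).
  { destruct Hq as [Han _]. apply Han. unfold closed_disk. split; [lra|easy]. }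
  assert (HD : C_derive q zeta <> 0%C) by (destruct Hq as [_ [_ H]]; now apply H).
  destruct (analytic_at_C_derive q zeta Han) as [_ Han'].
  assert (Ep'' : p'' z0 = (C_derive (C_derive q) zeta * c 1%nat * c 1%nat
                           + C_derive q zeta * (2 * c 2%nat))%C).
  { apply (strict_derive_unique p' z0).
    - apply Hp'. unfold disk. lra.
    - apply strict_derive_ext_loc with (fun x => C_derive q (W x) * W1 x)%C (r / 2).
      + lra.
      + intros x Hx. symmetry. now apply Ep'.
      + rewrite <- HW10 at 1 2. rewrite <- EW0.
        apply (strict_derive_mult (fun x => C_derive q (W x)) W1); [|easy].
        apply (strict_derive_comp W (C_derive q)); [now apply HWs|].
        rewrite EW0. now apply strict_derive_analytic. }
  assert (Ep0 : p' z0 = (C_derive q zeta * c 1%nat)%C).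
  { rewrite Ep', EW0, HW10 by easy. easy. }
  assert (Hc1 : c 1%nat = (k * zeta / z0)%C) by (unfold k; field; now split).
  assert (Hc2 : c 2%nat = (b * zeta / z0 ^ 2)%C).
  { unfold b. field. now split. }
  exists z0, zeta, (Re k). split; [unfold disk; lra|]. split; [easy|]. split; [easy|].
  split; [easy|]. split; [|split].
  - destruct (HW z0 ltac:(rewrite Cmod_minus_diag; lra)) as [E _]. now rewrite <- E, EW0.
  - rewrite Ep0, <- Hkr, Hc1. field. exact Hz0n.
  (* Logarithmic differentiation of [p' = q' (W) W']. What remains is [2 Re b / k >= k - 1], which
     is the second-order inequality divided by [k]. *)
  - assert (E : (z0 * p'' z0 / p' z0 + 1)%C =
      (RtoC (Re k) * (zeta * C_derive (C_derive q) zeta / C_derive q zeta)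
       + RtoC (/ Re k) * (2 * b) + 1)%C).
    { rewrite RtoC_inv by lra. rewrite Ep'', Ep0, <- Hkr, Hc1, Hc2. field.
      repeat split; easy. }
    rewrite E.
    set (X := (zeta * C_derive (C_derive q) zeta / C_derive q zeta)%C).
    replace (Re (RtoC (Re k) * X + RtoC (/ Re k) * (2 * b) + 1))
      with (Re k * Re X + / Re k * (2 * Re b) + 1).
    2:{ set (k1 := Re k). unfold Re. simpl. ring. }
    replace (Re (X + 1)) with (Re X + 1) by (unfold Re; simpl; ring).
    assert (Re k - 1 <= / Re k * (2 * Re b)).
    { apply Rmult_le_reg_l with (Re k); [lra|]. rewrite <- Rmult_assoc, Rinv_r by lra. lra. }
    lra.
Qed.

(** * The operator [Bop] *)

Lemma sums_S_inv (u : nat -> C) (l : C) : sums u l -> sums (fun n => u (S n)) (l - u O).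
Proof.
  intros H e He. destruct (H e He) as [N HN]. exists N. intros n Hn.
  specialize (HN (S n) ltac:(lia)). rewrite csum_S_l in HN.
  replace (csum (fun k => u (S k)) n - (l - u O))%C
    with (u O + csum (fun k => u (S k)) n - l)%C by ring.
  exact HN.
Qed.

Lemma iter_C_derive_PSum (f : C -> C) (a : nat -> C) (R : R) (n : nat) :
  radius_ge a R -> (forall z, Cmod z < R -> f z = PSum a z) ->
  radius_ge (Nat.iter n PS_D a) R /\
  forall z, Cmod z < R -> Nat.iter n C_derive f z = PSum (Nat.iter n PS_D a) z.
Proof.
  intros Ha Hf. induction n as [|n [IH1 IH2]]; [easy|]. simpl. split.
  - now apply radius_ge_D.
  - intros z Hz. apply C_derive_of_strict.
    apply strict_derive_ext_loc with (PSum (Nat.iter n PS_D a)) (R - Cmod z); [lra| |].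
    + intros x Hx. symmetry. apply IH2. pose proof (Cmod_le_minus x z). lra.
    + now apply strict_derive_PSum with R.
Qed.

Lemma iter_PS_D (a : nat -> C) (n k : nat) :
  (Nat.iter n PS_D a k * INR (fact k) = INR (fact (n + k)) * a (n + k)%nat)%C.
Proof.
  revert k. induction n as [|n IH]; intros k; [simpl; ring|].
  replace (S n + k)%nat with (n + S k)%nat by lia. rewrite <- IH.
  change (Nat.iter (S n) PS_D a k) with (INR (S k) * Nat.iter n PS_D a (S k))%C.
  rewrite fact_simpl, mult_INR, RtoC_mult. ring.
Qed.

Lemma INR_C_neq_0 (n : nat) : n <> 0%nat -> RtoC (INR n) <> 0%C.
Proof. intros H E. apply RtoC_inj in E. now apply (not_0_INR n). Qed.

Lemma taylor_coef_PSum (f : C -> C) (a : nat -> C) (R : R) (n : nat) :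
  0 < R -> radius_ge a R -> (forall z, Cmod z < R -> f z = PSum a z) -> taylor_coef f n = a n.
Proof.
  intros HR Ha Hf. destruct (iter_C_derive_PSum f a R n Ha Hf) as [_ H].
  unfold taylor_coef. rewrite H, PSum_0 by (rewrite Cmod_0; lra).
  pose proof (iter_PS_D a n 0) as E. rewrite Nat.add_0_r in E. simpl (fact 0) in E.
  replace (Nat.iter n PS_D a 0%nat) with (INR (fact n) * a n)%C.
  - field. apply INR_C_neq_0, fact_neq_0.
  - rewrite <- E. simpl. ring.
Qed.

(** [taylor_coef] is built from iterated [C_derive] and has to be identified with the coefficients
    of a convergent expansion. The sequence [A] puts the normalised coefficients 0 and 1 in front of
    those of the tail. *)
Lemma class_A_taylor (f : C -> C) :
  class_A f -> radius_ge (taylor_coef f) 1 /\ taylor_coef f 1 = 1%C.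
Proof.
  intros [_ [a Ha]].
  set (A := fun n => match n with O => RtoC 0 | S O => RtoC 1 | S (S m) => a (m + 2)%nat end).
  assert (HA : forall z, Cmod z < 1 -> sums (fun n => A n * z ^ n)%C (f z)).
  { intros z Hz. specialize (Ha z Hz). apply sums_is_series in Ha.
    replace (f z) with (A O * z ^ 0 + (A 1%nat * z ^ 1 + (f z - z)))%C by (simpl; ring).
    apply (sums_S (fun n => A n * z ^ n)%C), (sums_S (fun n => A (S n) * z ^ (S n))%C).
    apply sums_ext with (2 := Ha). intros n. unfold A.
    now replace (S (S n)) with (n + 2)%nat by lia. }
  assert (HR : radius_ge A 1) by (now apply radius_ge_of_sums with f).
  assert (E : forall n, taylor_coef f n = A n).
  { intros n. apply taylor_coef_PSum with 1; [lra|easy|].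
    intros z Hz. symmetry. apply PSum_unique. now apply HA. }
  split; [|now rewrite E].
  intros r Hr. destruct (HR r Hr) as [M HM]. exists M. intros n. rewrite E. apply HM.
Qed.

Lemma eventually_decreasing_bounded (t : nat -> R) (N : nat) :
  (forall n, (N <= n)%nat -> t (S n) <= t n) -> exists M, forall n, t n <= M.
Proof.
  intros H.
  assert (B : exists M, forall n, (n <= N)%nat -> t n <= M).
  { clear H. induction N as [|N [M HM]].
    - exists (t O). intros n Hn. replace n with O by lia. lra.
    - exists (Rmax M (t (S N))). intros n Hn. destruct (Nat.eq_dec n (S N)) as [->|h].
      + apply Rmax_r.
      + eapply Rle_trans; [apply HM; lia|apply Rmax_l]. }
  destruct B as [M HM]. exists M. intros n.
  destruct (Nat.le_gt_cases n N) as [h|h]; [now apply HM|].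
  replace n with (N + (n - N))%nat by lia.
  induction (n - N)%nat as [|k IH]; [rewrite Nat.add_0_r; now apply HM|].
  rewrite Nat.add_succ_r. eapply Rle_trans; [apply H; lia|exact IH].
Qed.

(** Both sides are the product of [lambda + i] for [i] from 0 to [m], with the last, respectively
    the first, factor split off. *)
Lemma poch_shift (lambda : C) (m : nat) :
  (poch lambda m * (lambda + INR m) = lambda * poch (lambda + 1) m)%C.
Proof.
  induction m as [|m IH]; [simpl; ring|].
  cbn [poch]. rewrite IH, S_INR, RtoC_plus. ring.
Qed.

Lemma poch_neq_0 (lambda : C) (m : nat) :
  (forall n : nat, (lambda + INR n)%C <> 0%C) -> poch lambda m <> 0%C.
Proof.
  intros H. induction m as [|m IH]; simpl.
  - intros E. apply RtoC_inj in E. lra.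
  - now apply Cmult_neq_0.
Qed.

Definition Bweight (lambda c : C) (m : nat) : C :=
  ((- c) ^ m / (4 ^ m * poch lambda m) / INR (fact m))%C.

(** The weight index lags by one behind the power of [z]. As weight 0 is 1, the isolated leading
    term [z] of the operator becomes the coefficient of index 1. *)
Definition Bcoef (lambda c : C) (f : C -> C) (n : nat) : C :=
  match n with O => RtoC 0 | S m => (Bweight lambda c m * taylor_coef f (S m))%C end.

Lemma C4_pow_neq_0 (m : nat) : (4 ^ m)%C <> 0%C.
Proof. apply Cpow_nz. intros E. apply RtoC_inj in E. lra. Qed.

(** The quotient of successive weights is [- c / (4 (lambda + m) (m + 1))], of modulus at most 1
    once [m] exceeds [|lambda| + 1 + |c|]. Bounded weights preserve the radius of convergence. *)
Lemma Bweight_bounded (lambda c : C) :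
  (forall n : nat, (lambda + INR n)%C <> 0%C) ->
  exists M, forall m, Cmod (Bweight lambda c m) <= M.
Proof.
  intros H.
  destruct (INR_unbounded (Cmod lambda + 1 + Cmod c)) as [N HN].
  apply (eventually_decreasing_bounded (fun m => Cmod (Bweight lambda c m)) N).
  intros m Hm. pose proof (Cmod_ge_0 c) as Pc. pose proof (Cmod_ge_0 lambda) as Pl.
  assert (H4 : RtoC 4 <> 0%C) by (intros E; apply RtoC_inj in E; lra).
  assert (HS : RtoC (INR (S m)) <> 0%C) by (apply INR_C_neq_0; lia).
  assert (HF : RtoC (INR (fact m)) <> 0%C) by apply INR_C_neq_0, fact_neq_0.
  assert (E : Bweight lambda c (S m) =
    (Bweight lambda c m * ((- c) / (4 * (lambda + INR m) * INR (S m))))%C).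
  { unfold Bweight. rewrite fact_simpl, mult_INR, RtoC_mult. cbn [poch Cpow]. field.
    repeat split; auto using C4_pow_neq_0, poch_neq_0. }
  rewrite E, Cmod_mult.
  rewrite <- (Rmult_1_r (Cmod (Bweight lambda c m))) at 2.
  apply Rmult_le_compat_l; [apply Cmod_ge_0|].
  rewrite Cmod_div, Cmod_opp, !Cmod_mult, !Cmod_R
    by (apply Cmult_neq_0; [apply Cmult_neq_0|]; auto).
  rewrite (Rabs_pos_eq 4), (Rabs_pos_eq (INR (S m))) by (try apply pos_INR; lra).
  assert (Hm' : INR N <= INR m) by now apply le_INR.
  assert (L : 1 <= Cmod (lambda + INR m)).
  { pose proof (Cmod_le_minus (INR m) (- lambda)) as T.
    rewrite Cmod_opp, Cmod_R, Rabs_pos_eq in T by apply pos_INR.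
    replace (INR m - - lambda)%C with (lambda + INR m)%C in T by ring. lra. }
  rewrite S_INR.
  assert (Den : Cmod c <= 4 * Cmod (lambda + INR m) * (INR m + 1)) by nra.
  apply Rmult_le_reg_r with (4 * Cmod (lambda + INR m) * (INR m + 1)); [nra|].
  unfold Rdiv. rewrite Rmult_assoc, Rinv_l by nra. lra.
Qed.

Lemma radius_ge_Bcoef (lambda c : C) (f : C -> C) :
  (forall n : nat, (lambda + INR n)%C <> 0%C) -> class_A f -> radius_ge (Bcoef lambda c f) 1.
Proof.
  intros H Hf r Hr. destruct (class_A_taylor f Hf) as [HR _]. destruct (HR r Hr) as [M HM].
  destruct (Bweight_bounded lambda c H) as [K HK].
  assert (PK : 0 <= K) by (eapply Rle_trans; [apply Cmod_ge_0|apply (HK O)]).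
  exists (K * M). intros [|m].
  - simpl. rewrite Cmod_0, Rmult_0_l. apply Rmult_le_pos; [easy|].
    eapply Rle_trans; [|apply (HM O)]. apply Rmult_le_pos; [apply Cmod_ge_0|simpl; lra].
  - cbn [Bcoef]. rewrite Cmod_mult, Rmult_assoc.
    apply Rmult_le_compat; auto using Cmod_ge_0.
    apply Rmult_le_pos; [apply Cmod_ge_0|apply pow_le; lra].
Qed.

Lemma Bop_PSum (lambda c : C) (f : C -> C) (z : C) :
  (forall n : nat, (lambda + INR n)%C <> 0%C) -> class_A f -> disk z ->
  Bop lambda c f z = PSum (Bcoef lambda c f) z.
Proof.
  intros H Hf Hz. destruct (class_A_taylor f Hf) as [_ E1].
  pose proof (PSum_sums _ 1 z (radius_ge_Bcoef lambda c f H Hf) Hz) as HS.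
  apply sums_S_inv in HS. apply (sums_S_inv (fun n => Bcoef lambda c f (S n) * z ^ S n)%C) in HS.
  unfold Bop. rewrite (CSeries_sums _ (PSum (Bcoef lambda c f) z - Bcoef lambda c f 0 * z ^ 0
    - Bcoef lambda c f 1 * z ^ 1)%C).
  - unfold Bcoef at 2 3. unfold Bweight. rewrite E1. simpl. field.
  - apply sums_ext with (2 := HS). intros m. cbn [Bcoef]. unfold Bweight.
    rewrite Nat.add_1_r. field. repeat split; auto using C4_pow_neq_0, poch_neq_0.
    apply INR_C_neq_0, fact_neq_0.
Qed.

(** [poch_shift] gives [lambda / (lambda)_m = (lambda + m) / (lambda + 1)_m], and for [n = m + 1]
    one has [lambda + m = n + (lambda - 1)]; the factor [n] becomes [z d/dz] on the series. *)
Lemma Bcoef_shift (lambda c : C) (f : C -> C) (n : nat) :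
  (forall n : nat, (lambda + INR n)%C <> 0%C) ->
  (lambda * Bcoef lambda c f n =
    INR n * Bcoef (lambda + 1) c f n + (lambda - 1) * Bcoef (lambda + 1) c f n)%C.
Proof.
  intros H.
  assert (H' : forall n : nat, (lambda + 1 + INR n)%C <> 0%C).
  { intros k. specialize (H (S k)). rewrite S_INR, RtoC_plus in H.
    now replace (lambda + 1 + INR k)%C with (lambda + (INR k + 1))%C by ring. }
  destruct n as [|m]; [simpl; ring|]. cbn [Bcoef].
  assert (E : (lambda * Bweight lambda c m = (lambda + INR m) * Bweight (lambda + 1) c m)%C).
  { unfold Bweight.
    assert (Hl : lambda <> 0%C) by (specialize (H O); simpl in H; now rewrite Cplus_0_r in H).
    replace (poch (lambda + 1) m) with (poch lambda m * (lambda + INR m) / lambda)%C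
      by (rewrite poch_shift; field; easy).
    field. repeat split; auto using C4_pow_neq_0, poch_neq_0.
    apply INR_C_neq_0, fact_neq_0. }
  rewrite Cmult_assoc, E, S_INR, RtoC_plus. ring.
Qed.

Lemma Bop_recurrence (lambda c : C) (f : C -> C) (z : C) :
  (forall n : nat, (lambda + INR n)%C <> 0%C) -> class_A f -> disk z ->
  (lambda * PSum (Bcoef lambda c f) z =
    z * PSum (PS_D (Bcoef (lambda + 1) c f)) z + (lambda - 1) * PSum (Bcoef (lambda + 1) c f) z)%C.
Proof.
  intros H Hf Hz.
  assert (H' : forall n : nat, (lambda + 1 + INR n)%C <> 0%C).
  { intros k. specialize (H (S k)). rewrite S_INR, RtoC_plus in H.
    now replace (lambda + 1 + INR k)%C with (lambda + (INR k + 1))%C by ring. }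
  pose proof (radius_ge_Bcoef _ c f H Hf) as R0. pose proof (radius_ge_Bcoef _ c f H' Hf) as R1.
  set (P := Bcoef (lambda + 1) c f) in *.
  apply (sums_unique (fun n => lambda * (Bcoef lambda c f n * z ^ n))%C).
  - apply sums_scal. now apply PSum_sums with 1.
  - apply sums_ext with (fun n => INR n * P n * z ^ n + (lambda - 1) * (P n * z ^ n))%C.
    + intros n. rewrite (Cmult_assoc lambda), Bcoef_shift by easy. fold P. ring.
    + apply sums_plus.
      * replace (z * PSum (PS_D P) z)%C with (INR 0 * P O * z ^ 0 + z * PSum (PS_D P) z)%C
          by (simpl; ring).
        apply (sums_S (fun n => INR n * P n * z ^ n)%C).
        apply sums_ext with (fun n => z * (PS_D P n * z ^ n))%C.
        -- intros n. unfold PS_D. cbn [Cpow]. ring.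
        -- apply sums_scal. apply PSum_sums with 1; [now apply radius_ge_D|easy].
      * apply sums_scal. now apply PSum_sums with 1.
Qed.

(** Selected preimages are differentiable by injectivity of [q], and the Cauchy expansion upgrades
    this to the power series that [analytic_on] requires. *)
Lemma subordinate_of_covered (p p' q : C -> C) :
  class_Q q -> p 0%C = 0%C -> q 0%C = 0%C ->
  (forall z, disk z -> strict_derive p z (p' z)) ->
  (forall z, disk z -> covered p q z) -> subordinate p q.
Proof.
  intros Hq Hp0 Hq0 Hp Hcov.
  assert (Hw : exists w, forall z, disk z -> disk (w z) /\ q (w z) = p z).
  { apply (choice (fun z u => disk z -> disk u /\ q u = p z)). intros z.
    destruct (classic (disk z)) as [h|h].
    - destruct (Hcov z h) as [u Hu]. now exists u.
    - now exists 0%C. }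
  destruct Hw as [w Hw]. exists w.
  assert (D0 : disk 0) by (unfold disk; rewrite Cmod_0; lra).
  split; [|split; [|split]].
  - intros z Hz. unfold disk in Hz.
    destruct (holomorphic_PSum w (fun x => p' x / C_derive q (w x))%C z
      ((1 - Cmod z) / 2) (1 - Cmod z)) as [a [Ha Hwa]].
    + lra.
    + intros x Hx. apply (inverse_strict_derive p p' q Hq Hp w 1); auto; [lra|].
      pose proof (Cmod_le_minus x z). lra.
    + apply analytic_at_PSum. exists a, ((1 - Cmod z) / 2). split; [lra|]. now split.
  - destruct (Hw 0%C D0) as [D E]. apply (class_Q_injective q); auto. congruence.
  - intros z Hz. now apply Hw.
  - intros z Hz. symmetry. now apply Hw.
Qed.

Open Scope C_scope.

Theorem theorem2p1 (c kappa : C)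
    (hkappa : forall n : nat, kappa <> 1 - INR n)
    (Omega : C -> Prop) (q : C -> C) (hQ0 : class_Q0 q) (hH0 : class_H0 q)
    (phi : C -> C -> C -> C -> C) (hphi : admissible kappa Omega q phi)
    (f : C -> C) (hf : class_A f)
    (hOmega : forall z : C, disk z ->
       Omega (phi (Bop (kappa + 1) c f z) (Bop kappa c f z)
                  (Bop (kappa - 1) c f z) z)) :
  subordinate (Bop (kappa + 1) c f) q.
Proof.
  destruct hQ0 as [hQ hq0].
  (* The excluded values of [kappa] are exactly the zeros of the Pochhammer products for
     [kappa - 1]; the parameters [kappa] and [kappa + 1] follow by shifting [n]. *)
  assert (Hm1 : forall n : nat, kappa - 1 + INR n <> 0).
  { intros n E. apply (hkappa n).
    replace kappa with (kappa - 1 + INR n + (1 - INR n)) by ring. rewrite E. ring. }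
  assert (H0 : forall n : nat, kappa + INR n <> 0).
  { intros n. replace (kappa + INR n) with (kappa - 1 + INR (S n)); [easy|].
    rewrite S_INR, RtoC_plus. ring. }
  assert (H1 : forall n : nat, kappa + 1 + INR n <> 0).
  { intros n. replace (kappa + 1 + INR n) with (kappa + INR (S n)); [easy|].
    rewrite S_INR, RtoC_plus. ring. }
  assert (Hk1 : kappa - 1 <> 0).
  { specialize (Hm1 O). simpl in Hm1. now rewrite Cplus_0_r in Hm1. }
  assert (Hk : kappa <> 0).
  { specialize (H0 O). simpl in H0. now rewrite Cplus_0_r in H0. }
  set (P := Bcoef (kappa + 1) c f).
  assert (HP : radius_ge P 1) by now apply radius_ge_Bcoef.
  pose proof (radius_ge_D _ _ HP) as HP'. pose proof (radius_ge_D _ _ HP') as HP''.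
  set (p := Bop (kappa + 1) c f). set (p' := PSum (PS_D P)). set (p'' := PSum (PS_D (PS_D P))).
  assert (Ep : forall z, disk z -> p z = PSum P z) by (intros; now apply Bop_PSum).
  assert (Hp : forall z, disk z -> strict_derive p z (p' z)).
  { intros z Hz. unfold disk in Hz.
    apply strict_derive_ext_loc with (PSum P) (1 - Cmod z)%R; [lra| |].
    - intros x Hx. symmetry. apply Ep. unfold disk. pose proof (Cmod_le_minus x z). lra.
    - now apply strict_derive_PSum with 1%R. }
  assert (Hp' : forall z, disk z -> strict_derive p' z (p'' z))
    by (intros z Hz; now apply strict_derive_PSum with 1%R).
  assert (p0 : p 0 = 0).
  { rewrite Ep by (unfold disk; rewrite Cmod_0; lra). apply PSum_0. }
  destruct (classic (forall z, disk z -> covered p q z)) as [Hcov|Hnot].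
  { now apply subordinate_of_covered with p'. }
  exfalso.
  destruct (miller_mocanu p p' p'' q hQ p0 hq0 Hp Hp' Hnot)
    as [z [zeta [k [Hz [Hzeta [Hne [Hk1' [Epz [Ezp Hre]]]]]]]]].
  set (V := PSum (Bcoef kappa c f)).
  assert (EV : forall x, disk x -> V x = / kappa * (x * p' x + (kappa - 1) * PSum P x)).
  { intros x Hx. pose proof (Bop_recurrence kappa c f x H0 hf Hx) as E. fold P V p' in E.
    rewrite <- E. field. exact Hk. }
  (* The recurrence for [kappa - 1] involves the derivative of [V], so the formula for [V] in terms
     of [p] is differentiated; this is where [p''] enters. *)
  assert (HV' : PSum (PS_D (Bcoef kappa c f)) z =
                / kappa * (p' z + z * p'' z + (kappa - 1) * p' z)).
  { apply (strict_derive_unique V z).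
    - apply strict_derive_PSum with 1%R; [now apply radius_ge_Bcoef|easy].
    - unfold disk in Hz.
      apply strict_derive_ext_loc
        with (fun x => / kappa * (x * p' x + (kappa - 1) * PSum P x)) (1 - Cmod z)%R.
      + lra.
      + intros x Hx. symmetry. apply EV. unfold disk. pose proof (Cmod_le_minus x z). lra.
      + replace (/ kappa * (p' z + z * p'' z + (kappa - 1) * p' z)) with
          (0 * (z * p' z + (kappa - 1) * PSum P z)
           + / kappa * ((1 * p' z + z * p'' z)
             + (0 * PSum P z + (kappa - 1) * p' z))) by ring.
        apply (strict_derive_mult (fun _ => / kappa)
          (fun x => x * p' x + (kappa - 1) * PSum P x)); [apply strict_derive_const|].
        apply (strict_derive_plus (fun x => x * p' x) (fun x => (kappa - 1) * PSum P x)).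
        * apply (strict_derive_mult (fun x => x)); [apply strict_derive_id|now apply Hp'].
        * apply (strict_derive_mult (fun _ => kappa - 1)); [apply strict_derive_const|].
          now apply strict_derive_PSum with 1%R. }
  assert (Ev : Bop kappa c f z = / kappa * (z * p' z + (kappa - 1) * p z)).
  { rewrite Bop_PSum, Ep by easy. now apply EV. }
  assert (Ew : Bop (kappa - 1) c f z =
     / (kappa - 1) * (z * (/ kappa * (p' z + z * p'' z + (kappa - 1) * p' z))
        + (kappa - 2) * (/ kappa * (z * p' z + (kappa - 1) * p z)))).
  { rewrite Bop_PSum by easy.
    pose proof (Bop_recurrence (kappa - 1) c f z Hm1 hf Hz) as E.
    replace (kappa - 1 + 1) with kappa in E by ring. rewrite HV' in E. fold V in E.
    rewrite EV, <- Ep in E by easy.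
    replace (kappa - 1 - 1) with (kappa - 2) in E.
    - rewrite <- E. field. exact Hk1.
    - replace 2%R with (1 + 1)%R by ring. rewrite RtoC_plus. ring. }
  assert (HD : C_derive q zeta <> 0) by (destruct hQ as [_ [_ H]]; now apply H).
  (* [z * p' z] is the denominator [v * kappa - (kappa - 1) * u] of the admissibility condition. *)
  assert (Hzp : z * p' z <> 0).
  { rewrite Ezp. apply Cmult_neq_0; [|apply Cmult_neq_0; [|easy]].
    - intros E. apply RtoC_inj in E. lra.
    - now apply Cmod_1_neq_0. }
  assert (Hz0 : z <> 0) by (intros E; apply Hzp; rewrite E; ring).
  assert (Hpz : p' z <> 0) by (intros E; apply Hzp; rewrite E; ring).
  apply (hphi (p z) (Bop kappa c f z) (Bop (kappa - 1) c f z) z zeta k); auto.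
  - rewrite Ev, <- Epz, <- Cmult_assoc, <- Ezp. field. exact Hk.
  (* Here [kappa (kappa - 1) w - (kappa - 2)(kappa - 1) u = z^2 p'' + (2 kappa - 2) z p'], so the
     expression in the admissibility condition is exactly [z p'' / p' + 1]. *)
  - apply Rle_ge. eapply Rle_trans; [exact Hre|]. right. f_equal.
    rewrite Ew, Ev. replace 3%R with (2 + 1)%R by ring. rewrite RtoC_plus.
    replace 2%R with (1 + 1)%R by ring. rewrite RtoC_plus.
    field. cbv beta. split; [exact Hk|]. split; [exact Hk1|]. split; [|exact Hpz].
    replace (z * p' z + (kappa - 1) * p z - (kappa - 1) * p z) with (z * p' z) by ring.
    exact Hzp.
Qed.
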